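(* Assume that the semigroup $(R_t)$ is symmetric and let $\beta\in\mathbb R$. Then $$|S_Q(t)h|\le e^{-\beta t}|h|\qquad\text{for all }h\in H,\ t\ge0,$$ if and only if $$\Big\|R_t\phi-\int_H\phi\,d\mu\Big\|_2\le e^{-\beta t}\|\phi\|_2\qquad\text{for all }\phi\in L^2(H,\mu),\ t\ge0.$$
   Context: $H$ is a separable real Hilbert space with inner product $\langle\cdot,\cdot\rangle$ and norm $|\cdot|$. $Q$ is a bounded selfadjoint nonnegative operator on $H$, $A$ is the generator of a strongly continuous semigroup $(S(t))_{t\ge0}$ on $H$, and $W$ is a standard cylindrical Wiener process on $H$. Put $Q_t=\int_0^tS(s)QS^*(s)\,ds$ for $0<t\le\infty$. Standing assumption: $\int_0^\infty\mathrm{tr}(S(s)QS^*(s))\,ds<\infty$ and $Q_\infty$ is injective; in addition $H\ne\{0\}$. The Ornstein-Uhlenbeck process is $Z(t,x)=S(t)x+\int_0^tS(t-s)Q^{1/2}\,dW(s)$, and $R_t\phi(x)=E\phi(Z(t,x))$ for bounded Borel $\phi$. Then the centered Gaussian measure $\mu=N(0,Q_\infty)$ is invariant for $(R_t)$, and $(R_t)$ extends to a $C_0$-semigroup of contractions on $L^p(H,\mu)$, $p\in[1,\infty)$; $\|\cdot\|_2$ is the norm of $L^2(H,\mu)$. ''$(R_t)$ is symmetric'' means that $R_t$ is a symmetric operator in $L^2(H,\mu)$ for every $t\ge0$. When $(R_t)$ is symmetric, $Q$ is injective, $S(t)Q^{1/2}(H)\subset Q^{1/2}(H)$, and $S_Q(t)=Q^{-1/2}S(t)Q^{1/2}$,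 $t\ge0$, is a $C_0$-semigroup of symmetric contractions on $H$. *)

(* Defs.v *)
From HB Require Import structures.
From mathcomp Require Import all_boot all_order all_algebra.
From mathcomp Require Import all_classical all_reals all_analysis.

Set Implicit Arguments.
Unset Strict Implicit.
Unset Printing Implicit Defensive.

Import Order.TTheory GRing.Theory Num.Theory.
Import numFieldNormedType.Exports.

Local Open Scope classical_set_scope.
Local Open Scope ring_scope.

Notation borel H := (g_sigma_algebraType (@open H)).

Section operators.
Context {R : realType} {H : completeNormedModType R} (dot : {dot H for idfun}).

Definition separable : Prop :=
  exists D : set H, countable D /\ dense D.

Definition c0_semigroup (S : R -> {linear H -> H}) : Prop :=
  [/\ forall x, S 0 x = x,
      forall s t x, 0 <= s -> 0 <= t -> S (s + t) x = S s (S t x),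
      forall t, 0 <= t -> continuous (S t) &
      forall x, S t x @[t --> 0^'+] --> x].

Definition adjoint_of (T T' : H -> H) : Prop :=
  forall x y, dot (T x) y = dot x (T' y).

Definition selfadjoint_nonneg (T : H -> H) : Prop :=
  adjoint_of T T /\ forall x, 0 <= dot (T x) x.

(* A set of vectors rather than a sequence, as H may have finite dimension. *)
Definition orthonormal_basis (E : set H) : Prop :=
  (forall e f, E e -> E f -> dot e f = (e == f)%:R) /\
  (forall x, (forall e, E e -> dot x e = 0) -> x = 0).

(* Meant for nonnegative T, since [esum] is a supremum of finite sums. *)
Definition trace (E : set H) (T : H -> H) : \bar R :=
  \esum_(e in E) (dot (T e) e)%:E.

Definition hs_norm2 (E : set H) (T : H -> H) : \bar R :=
  \esum_(e in E) (`|T e| ^+ 2)%:E.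

(* T = \int_D F(s) ds, an integral of operators in the weak sense. *)
Definition op_integral (D : set R) (F : R -> H -> H) (T : H -> H) : Prop :=
  forall x y,
    (@lebesgue_measure R).-integrable D (fun s => (dot (F s x) y)%:E) /\
    dot (T x) y = \int[@lebesgue_measure R]_(s in D) dot (F s x) y.

Definition op_inv (T : H -> H) (y : H) : H := xget 0 [set x | T x = y].

End operators.

Section gaussian.
Context {R : realType}.

(* [normal_prob m 0] is the uniform law on [0, 1], not the Dirac mass at m:
   the degenerate case has to be treated apart. *)
Definition gauss_law (v : R) (B : set R) : \bar R :=
  if v == 0 then \d_(0 : R) B else normal_prob 0 (Num.sqrt v) B.

Definition centered_gaussian {d} {T : measurableType d} (P : probability T R)
    (X : T -> R) (v : R) : Prop :=
  measurable_fun [set: T] X /\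
  forall B : set R, measurable B -> P (X @^-1` B) = gauss_law v B.

(* mu = N(0, C) *)
Definition gaussian_measure {H : completeNormedModType R}
    (dot : {dot H for idfun}) (C : H -> H)
    (mu : probability (borel H) R) : Prop :=
  forall h, centered_gaussian mu (fun x => dot x h) (dot (C h) h).

End gaussian.

Section stochastic_integral.
Context {R : realType} {H : completeNormedModType R} (dot : {dot H for idfun}).
Context {d} {Omega : measurableType d} (P : probability Omega R).

(* W t h stands for the real random variable <W(t), h>; taking arbitrary
   linear combinations makes (W t h)_{t, h} jointly Gaussian, with covariance
   E[W(s)h W(t)k] = min(s, t) <h, k>, and W t linear almost surely. *)
Definition cylindrical_wiener (W : R -> H -> Omega -> R) : Prop :=
  (forall n (a t : 'I_n -> R) (h : 'I_n -> H), (forall i, 0 <= t i) ->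
     centered_gaussian P (fun w => \sum_i a i * W (t i) (h i) w)
       (\sum_i \sum_j a i * a j * Num.min (t i) (t j) * dot (h i) (h j))) /\
  (forall h, {ae P, forall w,
     {within `[0, +oo[, continuous (fun t => W t h w)}}).

(* The integrand s |-> 1_(a, b](s) <f, .> g. *)
Record rank1_step :=
  Rank1Step { step_a : R; step_b : R; step_f : H; step_g : H }.

Definition step_fun (F : seq rank1_step) (s : R) (x : H) : H :=
  \sum_(q <- F) (if step_a q < s <= step_b q
                 then dot (step_f q) x *: step_g q else 0).

Definition step_integral (W : R -> H -> Omega -> R) (F : seq rank1_step)
    (w : Omega) : H :=
  \sum_(q <- F) (W (step_b q) (step_f q) w - W (step_a q) (step_f q) w)
                  *: step_g q.

(* X = \int_0^t Phi(s) dW(s), for a deterministic operator-valued Phi: the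
   Ito isometry extends the integral from step integrands to L2(0,t; HS). *)
Definition stoch_integral (E : set H) (W : R -> H -> Omega -> R) (t : R)
    (Phi : R -> H -> H) (X : Omega -> borel H) : Prop :=
  measurable_fun [set: Omega] X /\
  exists F : nat -> seq rank1_step,
    [/\ forall n, all (fun q => [&& 0 <= step_a q, step_a q <= step_b q
                                  & step_b q <= t]) (F n),
        (\int[@lebesgue_measure R]_(s in `[0%R, t])
            hs_norm2 E (fun x => (Phi s x - step_fun (F n) s x)%R))%E
          @[n --> \oo] --> 0%E &
        (\int[P]_w ((`|(X w : H) - step_integral W (F n) w| ^+ 2)%R)%:E)%E
          @[n --> \oo] --> 0%E].

End stochastic_integral.

Section ornstein_uhlenbeck.
Context {R : realType} {H : completeNormedModType R} (dot : {dot H for idfun}).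
Context {d} {Omega : measurableType d} (P : probability Omega R).

(* Z(t,x) = S(t)x + \int_0^t S(t-s) Q^{1/2} dW(s), where Qh is Q^{1/2}. *)
Definition ou_process (E : set H) (S : R -> {linear H -> H}) (Qh : H -> H)
    (W : R -> H -> Omega -> R) (Z : R -> H -> Omega -> H) : Prop :=
  forall t x, 0 <= t ->
    stoch_integral dot P E W t (fun s y => S (t - s) (Qh y))
      (fun w => Z t x w - S t x).

Definition bounded_borel (phi : borel H -> R) : Prop :=
  measurable_fun [set: borel H] phi /\ exists M, forall x, `|phi x| <= M.

Definition ou_semigroup (Z : R -> H -> Omega -> H) (t : R)
    (phi : borel H -> R) : borel H -> R :=
  fun x => \int[P]_w phi (Z t x w).

(* The continuous extension of R_t to L2(mu): a version of the L2(mu)-limit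
   of R_t phi_n along bounded Borel phi_n that converge to phi in L2(mu). *)
Definition ou_semigroup2 (Z : R -> H -> Omega -> H)
    (mu : probability (borel H) R) (t : R) (phi : borel H -> R) :
    borel H -> R :=
  xget (cst 0) [set psi | psi \in Lfun mu 2%:E /\
    exists phi_ : nat -> borel H -> R,
      [/\ forall n, bounded_borel (phi_ n),
          ('N[mu]_2%:E[EFin \o (phi_ n \- phi)%R])%E @[n --> \oo] --> 0%E &
          ('N[mu]_2%:E[EFin \o (ou_semigroup Z t (phi_ n) \- psi)%R])%E
            @[n --> \oo] --> 0%E]].

Definition ou_symmetric (Z : R -> H -> Omega -> H)
    (mu : probability (borel H) R) : Prop :=
  forall t phi psi, 0 <= t -> phi \in Lfun mu 2%:E -> psi \in Lfun mu 2%:E ->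
    \int[mu]_x (ou_semigroup2 Z mu t phi x * psi x) =
    \int[mu]_x (phi x * ou_semigroup2 Z mu t psi x).

(* S_Q(t) = Q^{-1/2} S(t) Q^{1/2}, where Qh is Q^{1/2}. *)
Definition SQ (S : R -> {linear H -> H}) (Qh : H -> H) (t : R) (h : H) : H :=
  op_inv Qh (S t (Qh h)).

End ornstein_uhlenbeck.

(* Main.v *)
Require Import Defs.
From HB Require Import structures.
From mathcomp Require Import all_boot all_order all_algebra.
From mathcomp Require Import all_classical all_reals all_analysis.
From mathcomp Require Import measurable_realfun ring lra.

Set Implicit Arguments.
Unset Strict Implicit.
Unset Printing Implicit Defensive.

Import Order.TTheory GRing.Theory Num.Theory.
Import numFieldNormedType.Exports.

Local Open Scope classical_set_scope.
Local Open Scope ring_scope.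

(** Write T_t for the adjoint of S(t), q(h,k) = <Q h, k> and
a(h,k) = <Q_oo h, k>, so that a is the covariance form of mu and
a(h,h) is the integral over s >= 0 of q(T_s h, T_s h). Both sides of the
equivalence turn out to say that the flow T_t decays in a quadratic form:

  a(T_t h, T_t h) <= e^{-2 beta t} a(h, h)     for all h and t.

The bridge to R_t is the Fourier picture. The stochastic convolution is a
limit of Gaussian step integrals, so Z(t,x) - S(t)x is Gaussian with covariance
form a(h,k) - a(T_t h, T_t k) ([stoch_integral_cos]). Hence R_t maps a
plane wave cos(<x,h> + th) to a multiple of cos(<x,T_t h> + th), and the L2(mu)
scalar products of plane waves are explicit in a ([inner_ou_op_waves]). A
functional monotone class theorem ([functional_monotone_class]) carries
identities and approximations from trigonometric polynomials to all bounded
Borel functions: mu is invariant, R_t contracts L2(mu), and trigonometric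
polynomials are dense in L2(mu).

Symmetry of R_t, tested on sines, implies that T_t is symmetric for a
([symmetric_aform]).

From L2 decay to a: apply the decay to sin(<., r h>), of mean zero; its squared
norm and that of its image are, up to the same factor, hyperbolic sines of
r^2 a(h,h) and r^2 a(T_t h,T_t h), and letting r tend to 0 linearizes them
([bounded_decay_aform]).

From a to L2 decay: for a trigonometric polynomial phi the covariance
f(t) = <R_t phi, phi> - (mean)^2 is explicit and O(e^{-beta t}), with a constant
that depends on phi (for beta >= 0; the rate 0 is always available and covers
beta < 0). Since R_t is a symmetric semigroup,
f(t)^2 <= f(0) f(2t), and iterating this doubling inequality replaces the
constant by f(0) ([doubling_decay], [trig_decay]). Density does the rest.

From a to S_Q: the same doubling argument, applied to the forms
a(h,h) - a(T_t h,T_t h) as t tends to 0, shows that decay of T_t in a and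
decay of T_t in q are equivalent ([aform_qform_decay]), and that T_t is symmetric
for q as well. As q(k,k) = |Q^{1/2} k|^2, the symmetry reads Q T_t = S(t) Q,
that is S_Q(t) Q^{1/2} k = Q^{1/2} T_t k; the range of Q^{1/2} is dense, so
the decay of T_t in q is the decay of the norm of S_Q(t)
([op_inv_bound], [qform_decay_SQ]). *)

(** * Elementary inequalities *)

(** The quadratic polynomial A + 2 t B + t^2 C has a nonpositive discriminant.
The source of every Cauchy-Schwarz inequality below. *)
Lemma discriminant_le (R : realFieldType) (A B C : R) :
  0 <= C -> (forall t, 0 <= A + 2 * t * B + t ^+ 2 * C) -> B ^+ 2 <= A * C.
Proof.
rewrite le_eqVlt => /predU1P[<-|C0] h.
  rewrite mulr0; have [->|B0] := eqVneq B 0; first by rewrite expr0n.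
  have := h (- (A + 1) / (2 * B)).
  have -> : A + 2 * (- (A + 1) / (2 * B)) * B + (- (A + 1) / (2 * B)) ^+ 2 * 0 = -1.
    by field.
  lra.
have := h (- B / C).
have -> : A + 2 * (- B / C) * B + (- B / C) ^+ 2 * C = A - B ^+ 2 / C.
  by field; exact: lt0r_neq0.
by rewrite subr_ge0 ler_pdivrMr.
Qed.

Lemma bernoulli_expr (R : realFieldType) (r : R) n : 0 <= r -> 1 + n%:R * (r - 1) <= r ^+ n.
Proof.
move=> r0; elim: n => [|n IH]; first by rewrite mul0r addr0 expr0.
rewrite exprS -natr1.
apply: (@le_trans _ _ (r * (1 + n%:R * (r - 1)))); last by rewrite ler_wpM2l.
have : 0 <= n%:R * (r - 1) ^+ 2 by rewrite mulr_ge0// sqr_ge0.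
rewrite !expr2; nra.
Qed.

Lemma le1_of_bounded_expr (R : realType) (r C : R) :
  0 <= r -> (forall n, r ^+ (2 ^ n) <= C) -> r <= 1.
Proof.
move=> r0 h; rewrite leNgt; apply/negP => r1.
have B n : 1 + n%:R * (r - 1) <= r ^+ n by exact: bernoulli_expr.
pose N := (Num.truncn ((C + 1) / (r - 1))).+1.
have hN : (C + 1) / (r - 1) < N%:R by rewrite truncnS_gt.
have := le_trans (B (2 ^ N)%N) (h N).
have : (N%:R : R) <= (2 ^ N)%:R by rewrite ler_nat ltnW// ltn_expl.
move: hN; rewrite ltr_pdivrMr ?subr_gt0// => h1 h2 h3.
have : N%:R * (r - 1) <= (2 ^ N)%:R * (r - 1) by rewrite ler_wpM2r// ltW// subr_gt0.
lra.
Qed.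

(** Iterating f(t)^2 <= f(0) f(2t) gives (f(t)/f(0))^(2^n) <= f(2^n t)/f(0). With
r = f(t) e^{g t} / f(0) the a priori bound then reads r^(2^n) <= C/f(0) for all n,
which forces r <= 1: a decay rate with some constant is a decay rate with the
constant f(0). *)
Lemma doubling_decay (R : realType) (f : R -> R) (C g : R) :
  (forall t, 0 <= t -> 0 <= f t) ->
  (forall t, 0 <= t -> f t ^+ 2 <= f 0 * f (2 * t)) ->
  (forall t, 0 <= t -> f t <= C * expR (- (g * t))) ->
  forall t, 0 <= t -> f t <= expR (- (g * t)) * f 0.
Proof.
move=> f0 f2 fC t t0.
have [z|nz] := eqVneq (f 0) 0.
  have := f2 t t0; rewrite z mul0r => h.
  have /eqP : f t ^+ 2 = 0 by apply/eqP; rewrite eq_le h sqr_ge0.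
  by rewrite expf_eq0/= => /eqP ->; rewrite mulr0.
have f0p : 0 < f 0 by rewrite lt_def nz f0.
pose r := f t * expR (g * t) / f 0.
have r0 : 0 <= r by rewrite divr_ge0 ?mulr_ge0 ?expR_ge0 ?f0.
have step n : r ^+ (2 ^ n) <= f (2 ^+ n * t) * expR (g * (2 ^+ n * t)) / f 0.
  elim: n => [|n IH]; first by rewrite expn0 expr1 expr0 mul1r.
  rewrite expnS mulnC exprM.
  have tn : 0 <= 2 ^+ n * t by rewrite mulr_ge0// exprn_ge0.
  have h1 : (r ^+ (2 ^ n)) ^+ 2 <=
      (f (2 ^+ n * t) * expR (g * (2 ^+ n * t)) / f 0) ^+ 2.
    by rewrite ler_pXn2r// ?nnegrE ?exprn_ge0// divr_ge0 ?mulr_ge0 ?expR_ge0 ?f0.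
  apply: le_trans h1 _.
  have := f2 _ tn; rewrite mulrA -exprS => h.
  rewrite !exprMn exprVn.
  have -> : expR (g * (2 ^+ n.+1 * t)) = expR (g * (2 ^+ n * t)) ^+ 2.
    by rewrite -expRM_natl; congr expR; rewrite exprS; ring.
  rewrite ler_pdivrMr ?exprn_gt0//.
  have -> : f (2 ^+ n.+1 * t) * expR (g * (2 ^+ n * t)) ^+ 2 / f 0 * f 0 ^+ 2 =
     (f 0 * f (2 ^+ n.+1 * t)) * expR (g * (2 ^+ n * t)) ^+ 2 by field.
  by rewrite ler_wpM2r// sqr_ge0.
have : r <= 1.
  apply: (@le1_of_bounded_expr _ _ (C / f 0)) => // n.
  apply: le_trans (step n) _.
  have tn : 0 <= 2 ^+ n * t by rewrite mulr_ge0// exprn_ge0.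
  rewrite ler_pM2r ?invr_gt0//.
  by rewrite -ler_pdivlMr ?expR_gt0// -expRN; exact: fC.
rewrite /r ler_pdivrMr// mul1r => h.
by rewrite expRN mulrC ler_pdivlMr ?expR_gt0.
Qed.

(** * The inner product *)

Section inner_product.
Context {R : realType} {H : completeNormedModType R} (dot : {dot H for idfun}).

Lemma dotDl x y z : dot (x + y) z = dot x z + dot y z.
Proof. exact: linearDl. Qed.
Lemma dotBl x y z : dot (x - y) z = dot x z - dot y z.
Proof. exact: linearBl. Qed.
Lemma dotZl a x y : dot (a *: x) y = a * dot x y.
Proof. exact: linearZl_LR. Qed.
Lemma dot0l x : dot 0 x = 0. Proof. exact: linear0l. Qed.
Lemma dotC x y : dot x y = dot y x.
Proof. by have := @hermitian_subproof _ _ _ _ dot x y; rewrite /= expr0 mul1r. Qed.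
Lemma dotDr x y z : dot z (x + y) = dot z x + dot z y.
Proof. by rewrite dotC dotDl !(dotC z). Qed.
Lemma dotBr x y z : dot z (x - y) = dot z x - dot z y.
Proof. by rewrite dotC dotBl !(dotC z). Qed.
Lemma dotZr a x y : dot x (a *: y) = a * dot x y.
Proof. by rewrite dotC dotZl dotC. Qed.
Lemma dot0r x : dot x 0 = 0. Proof. by rewrite dotC dot0l. Qed.
Lemma dot_suml I (r : seq I) (F : I -> H) y :
  dot (\sum_(i <- r) F i) y = \sum_(i <- r) dot (F i) y.
Proof. exact: linear_sumlz. Qed.
Lemma dot_sumr I (r : seq I) (F : I -> H) y :
  dot y (\sum_(i <- r) F i) = \sum_(i <- r) dot y (F i).
Proof. by rewrite dotC dot_suml; apply: eq_bigr => i _; rewrite dotC. Qed.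

Context (dot_norm : forall x, dot x x = `|x| ^+ 2).

Lemma dot_CS x y : `|dot x y| <= `|x| * `|y|.
Proof.
rewrite -(@ler_pXn2r _ 2)// ?nnegrE ?mulr_ge0// exprMn real_normK ?num_real//.
rewrite -!dot_norm; apply: discriminant_le; first by rewrite dot_norm sqr_ge0.
move=> t; have -> : dot x x + 2 * t * dot x y + t ^+ 2 * dot y y =
    dot (x + t *: y) (x + t *: y).
  by rewrite !(dotDl, dotDr, dotZl, dotZr) (dotC y x); ring.
by rewrite dot_norm sqr_ge0.
Qed.

Lemma dot_nondeg x : (forall y, dot x y = 0) -> x = 0.
Proof.
by move=> /(_ x); rewrite dot_norm => /eqP; rewrite expf_eq0/= normr_eq0 => /eqP.
Qed.

Lemma dot_inj x y : (forall z, dot x z = dot y z) -> x = y.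
Proof.
move=> h; apply/eqP; rewrite -subr_eq0; apply/eqP/dot_nondeg => z.
by rewrite dotBl h subrr.
Qed.

Lemma dotr_continuous y : continuous (fun x => dot x y).
Proof.
move=> x; apply/cvgrPdist_lt => e e0.
have y1 : 0 < `|y| + 1 by rewrite ltr_wpDl.
near=> z; rewrite -dotBl.
apply: le_lt_trans (dot_CS _ _) _.
apply: (@le_lt_trans _ _ (`|x - z| * (`|y| + 1))).
  by rewrite ler_wpM2l// lerDl.
rewrite -ltr_pdivlMr//; near: z.
by apply: cvgr_dist_lt; rewrite ?divr_gt0//; exact: cvg_id.
Unshelve. all: by end_near. Qed.

Lemma dot_cvg {T} {F : set_system T} {FF : Filter F} (f : T -> H) x y :
  f @ F --> x -> dot (f t) y @[t --> F] --> dot x y.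
Proof. move=> fx; exact: (cvg_comp f (dot^~ y) fx (@dotr_continuous y x)). Qed.

End inner_product.

(** * Bounded measurable functions under a probability *)

Section dct.
Context {d} {T : measurableType d} {R : realType} (mu : {measure set T -> \bar R}).

Lemma Rintegral_dct (f_ : nat -> T -> R) (f g : T -> R) :
  (forall n, measurable_fun setT (f_ n)) ->
  (forall x, f_ n x @[n --> \oo] --> f x) ->
  mu.-integrable setT (EFin \o g) ->
  (forall n x, `|f_ n x| <= g x) ->
  measurable_fun setT f /\
  (\int[mu]_x f_ n x @[n --> \oo] --> \int[mu]_x f x).
Proof.
move=> mf_ f_f ig f_g.
have mf : measurable_fun setT f.
  by apply: (measurable_fun_cvg mf_) => x _; exact: f_f.
split=> //.
have [|||||h1 _ h3] := @dominated_convergence _ _ _ mu setT measurableT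
  (fun n => EFin \o f_ n) (EFin \o f) (EFin \o g).
- by move=> n; exact/measurable_EFinP.
- exact/measurable_EFinP.
- by apply: aeW => x _; apply: cvg_EFin; [exact: nearW|exact: f_f].
- exact: ig.
- by apply: aeW => x n _ /=; rewrite lee_fin.
apply: fine_cvg.
rewrite fineK//.
exact: integrable_fin_num.
Qed.

End dct.

Definition bounded_measurable {d} {T : measurableType d} {R : realType}
  (f : T -> R) := measurable_fun setT f /\ exists M : R, forall x, `|f x| <= M.

Section bounded_measurable.
Context {d} {T : measurableType d} {R : realType}.
Implicit Types f g : T -> R.

Lemma bmf_cst (c : R) : bounded_measurable (fun _ : T => c).
Proof. by split; [exact: measurable_cst|exists `|c|]. Qed.

Lemma bmfD f g : bounded_measurable f -> bounded_measurable g ->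
  bounded_measurable (fun x => f x + g x).
Proof.
move=> [mf [M fM]] [mg [N gN]]; split; first exact: measurable_funD.
by exists (M + N) => x; rewrite (le_trans (ler_normD _ _))// lerD.
Qed.

Lemma bmfM f g : bounded_measurable f -> bounded_measurable g ->
  bounded_measurable (fun x => f x * g x).
Proof.
move=> [mf [M fM]] [mg [N gN]]; split; first exact: measurable_funM.
by exists (M * N) => x; rewrite normrM ler_pM.
Qed.

Lemma bmfZ (c : R) f : bounded_measurable f -> bounded_measurable (fun x => c * f x).
Proof. by move=> bf; apply: bmfM => //; exact: bmf_cst. Qed.

Lemma bmfB f g : bounded_measurable f -> bounded_measurable g ->
  bounded_measurable (fun x => f x - g x).
Proof.
move=> bf bg; have := bmfD bf (bmfZ (-1) bg).
by congr bounded_measurable; apply/funext => x; rewrite mulN1r.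
Qed.

Lemma bmfX f n : bounded_measurable f -> bounded_measurable (fun x => f x ^+ n).
Proof.
move=> bf; elim: n => [|n IH].
  have := bmf_cst 1; congr bounded_measurable; by apply/funext => x; rewrite expr0.
have := bmfM bf IH; congr bounded_measurable; by apply/funext => x; rewrite exprS.
Qed.

Lemma bmf_sum I (r : seq I) (F : I -> T -> R) :
  (forall i, bounded_measurable (F i)) ->
  bounded_measurable (fun x => \sum_(i <- r) F i x).
Proof.
move=> bF; elim: r => [|i r IH].
  have := bmf_cst 0; congr bounded_measurable; by apply/funext => x; rewrite big_nil.
have := bmfD (bF i) IH; congr bounded_measurable; by apply/funext => x; rewrite big_cons.
Qed.

Lemma bmf_indic (A : set T) : measurable A -> bounded_measurable (\1_A : T -> R).
Proof.
move=> mA; split; first exact: measurable_indic.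
by exists 1 => x; rewrite indicE; case: (_ \in _); rewrite ?normr0 ?normr1.
Qed.

Lemma bmf_comp d' (T' : measurableType d') (u : T' -> T) f :
  measurable_fun setT u -> bounded_measurable f ->
  bounded_measurable (f \o u).
Proof.
move=> mu [mf [M fM]]; split; first exact: measurableT_comp.
by exists M => x; exact: fM.
Qed.

Context (P : probability T R).

Lemma bmf_integrable f : bounded_measurable f -> P.-integrable setT (EFin \o f).
Proof.
move=> [mf [M fM]]; apply: measurable_bounded_integrable => //.
  by apply: le_lt_trans (probability_le1 P measurableT) (ltry 1).
exists M; split; first exact: num_real.
by move=> y My x _; apply: le_trans (fM x) _; exact: ltW.
Qed.

Lemma bmf_intD f g : bounded_measurable f -> bounded_measurable g ->
  \int[P]_x (f x + g x) = \int[P]_x f x + \int[P]_x g x.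
Proof. by move=> bf bg; rewrite RintegralD//; exact: bmf_integrable. Qed.

Lemma bmf_intB f g : bounded_measurable f -> bounded_measurable g ->
  \int[P]_x (f x - g x) = \int[P]_x f x - \int[P]_x g x.
Proof. by move=> bf bg; rewrite RintegralB//; exact: bmf_integrable. Qed.

Lemma bmf_intZ (c : R) f : bounded_measurable f ->
  \int[P]_x (c * f x) = c * \int[P]_x f x.
Proof. by move=> bf; rewrite RintegralZl//; exact: bmf_integrable. Qed.

Lemma prob_int_cst (c : R) : \int[P]_x c = c.
Proof.
rewrite Rintegral_cst//; have -> : fine ((P : {measure set T -> \bar R}) setT) = 1.
  exact: (congr1 fine (probability_setT P)).
by rewrite mulr1.
Qed.

Lemma bmf_int_sum I (r : seq I) (F : I -> T -> R) :
  (forall i, bounded_measurable (F i)) ->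
  \int[P]_x (\sum_(i <- r) F i x) = \sum_(i <- r) \int[P]_x F i x.
Proof.
move=> bF; elim: r => [|i r IH].
  by rewrite big_nil; under eq_Rintegral do rewrite big_nil; rewrite prob_int_cst.
rewrite big_cons -IH -bmf_intD//; last exact: bmf_sum.
by apply: eq_Rintegral => x _; rewrite big_cons.
Qed.

Lemma bmf_int_le f g : bounded_measurable f -> bounded_measurable g ->
  (forall x, f x <= g x) -> \int[P]_x f x <= \int[P]_x g x.
Proof.
by move=> bf bg fg; apply: le_Rintegral => //; exact: bmf_integrable.
Qed.

Lemma bmf_int_norm_le f (M : R) : bounded_measurable f -> (forall x, `|f x| <= M) ->
  `|\int[P]_x f x| <= M.
Proof.
move=> bf fM; rewrite ler_norml.
apply/andP; split; [rewrite -(prob_int_cst (- M))|rewrite -[leRHS]prob_int_cst];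
  apply: bmf_int_le => //; try exact: bmf_cst.
- by move=> x; have := fM x; rewrite ler_norml => /andP[].
- by move=> x; have := fM x; rewrite ler_norml => /andP[].
Qed.

Lemma bmf_int_dct (f_ : nat -> T -> R) f (M : R) :
  (forall n, measurable_fun setT (f_ n)) ->
  (forall n x, `|f_ n x| <= M) ->
  (forall x, f_ n x @[n --> \oo] --> f x) ->
  bounded_measurable f /\ (\int[P]_x f_ n x @[n --> \oo] --> \int[P]_x f x).
Proof.
move=> mf_ fM f_f.
have [mf cf] := @Rintegral_dct _ _ _ P f_ f (fun=> M) mf_ f_f
  (bmf_integrable (bmf_cst M)) fM.
split=> //; split=> //; exists M => x.
have h := cvg_norm (f_f x).
by apply: (cvgr_to_le (h _)); apply: nearW => n; exact: fM.
Qed.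

End bounded_measurable.

(** Transport of an integral along a law: both integrals are integrals against the
common image measure. *)
Lemma eq_law_int {d d' d0} {T : measurableType d} {T' : measurableType d'}
  {U : measurableType d0} {R : realType}
  (P : probability T R) (P' : probability T' R) (X : T -> U) (X' : T' -> U) f :
  measurable_fun setT X -> measurable_fun setT X' ->
  (forall B, measurable B -> P (X @^-1` B) = P' (X' @^-1` B)) ->
  bounded_measurable f ->
  \int[P]_w f (X w) = \int[P']_w f (X' w).
Proof.
move=> mX mX' PP bf.
have mf := bf.1.
have h d1 (T1 : measurableType d1) (P1 : probability T1 R) (X1 : T1 -> U)
  (mX1 : measurable_fun setT X1) :
  (\int[P1]_w (f (X1 w))%:E = \int[pushforward P1 X1]_y (f y)%:E)%E.
  rewrite (@integral_pushforward _ _ _ _ _ X1 mX1 P1 setT (EFin \o f))//.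
  + exact/measurable_EFinP.
  + rewrite preimage_setT; exact: (bmf_integrable P1 (bmf_comp mX1 bf)).
rewrite /Rintegral !h//; congr fine.
by apply: eq_measure_integral => A mA _; exact: PP.
Qed.

(** * The characteristic function of a centered Gaussian *)

Section normal_characteristic.
Context {R : realType} (s : R) (s0 : 0 < s).
Local Notation leb := (@lebesgue_measure R).
Local Notation p := (normal_pdf 0 s).

Implicit Types x : R.

Let sn0 : s != 0. Proof. exact: lt0r_neq0. Qed.

Lemma is_derive_normal_pdf x : is_derive x (1:R) p (- (x / s ^+ 2) * p x).
Proof.
rewrite normal_pdfE//.
have h : is_derive x (1:R) (fun x : R => - (x - 0) ^+ 2 / (s ^+ 2 *+ 2)) (- (x / s ^+ 2)).
  apply: is_derive_eq; rewrite /= ?scaler0 ?addr0 ?subr0 !scaler1 ?scalerN.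
  by rewrite /GRing.scale/=; field.
have h2 : is_derive x (1:R) (fun x : R => normal_peak s * expR (- (x - 0) ^+ 2 / (s ^+ 2 *+ 2)))
   (normal_peak s * (- (x / s ^+ 2) * expR (- (x - 0) ^+ 2 / (s ^+ 2 *+ 2)))).
  have h3 := @is_derive1_comp R expR _ x _ _ (is_derive_expR _) h.
  apply: (is_derive_eq (is_deriveZ (normal_peak s) h3)).
  by rewrite /GRing.scale/=; congr (_ * _); rewrite mulrC.
apply: (is_derive_eq h2).
by rewrite /normal_fun mulrCA.
Qed.

(** The factor |x| is absorbed by widening the Gaussian from variance s^2 to 2 s^2;
this reduces the integrability of functions of linear growth to that of a density. *)
Lemma norm_mul_normal_pdf_le x :
  `|x| * p x <= (s * normal_peak s / normal_peak (s * Num.sqrt 2)) * normal_pdf 0 (s * Num.sqrt 2) x.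
Proof.
have s20 : s * Num.sqrt 2 != 0 by rewrite mulf_neq0// gt_eqF// sqrtr_gt0.
rewrite !normal_pdfE//.
have -> : s * normal_peak s / normal_peak (s * Num.sqrt 2) *
  (normal_peak (s * Num.sqrt 2) * normal_fun 0 (s * Num.sqrt 2) x) =
  normal_peak s * (s * normal_fun 0 (s * Num.sqrt 2) x).
  have := normal_peak_gt0 s20; move=> h; field; exact: lt0r_neq0.
rewrite mulrCA ler_pM2l ?normal_peak_gt0//.
rewrite /normal_fun subr0 exprMn sqr_sqrtr//.
have -> : - x ^+ 2 / (s ^+ 2 *+ 2) =
   - x ^+ 2 / (s ^+ 2 * 2 *+ 2) + - (x ^+ 2 / (s ^+ 2 * 2 *+ 2)) by field.
rewrite expRD mulrCA mulrC ler_pM2r ?expR_gt0//.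
rewrite expRN ler_pdivrMr ?expR_gt0//.
have h := expR_ge1Dx (x ^+ 2 / (s ^+ 2 * 2 *+ 2)).
apply: (@le_trans _ _ (s * (1 + x ^+ 2 / (s ^+ 2 * 2 *+ 2)))); last by rewrite ler_pM2l.
rewrite -(real_normK (num_real x)).
have -> : s * (1 + `|x| ^+ 2 / (s ^+ 2 * 2 *+ 2)) =
  `|x| + ((`|x| - 2 * s) ^+ 2 / (4 * s)) by field.
by rewrite lerDl divr_ge0// ?sqr_ge0// mulr_ge0// ltW.
Qed.

Lemma integrable_mul_normal_pdf (g : R -> R) (C : R) :
  measurable_fun setT g -> (forall x, `|g x| <= C * (1 + `|x|)) ->
  leb.-integrable setT (fun x => (g x * p x)%:E).
Proof.
move=> mg gC.
have C0 : 0 <= C by have := gC 0; rewrite normr0 addr0 mulr1; exact: le_trans.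
pose s2 := s * Num.sqrt 2.
pose K := s * normal_peak s / normal_peak s2.
have i1 := @integrable_normal_pdf R 0 s.
have i2 := @integrable_normal_pdf R 0 s2.
have i3 : leb.-integrable setT
    (fun x => (C%:E * ((p x)%:E + (K%:E * (normal_pdf 0 s2 x)%:E)))%E).
  apply: integrableZl => //; apply: integrableD => //; exact: integrableZl.
apply: le_integrable i3 => //.
  apply/measurable_EFinP; apply: measurable_funM => //.
  exact: measurable_normal_pdf.
move=> x _; rewrite /= lee_fin.
have pk t : 0 <= normal_peak t :> R := normal_peak_ge0 t.
have K0 : 0 <= K by rewrite divr_ge0// mulr_ge0// ltW.
have px t := @normal_pdf_ge0 R 0 t x.
rewrite normrM (ger0_norm (px s)) [leRHS]ger0_norm; last first.
  by rewrite mulr_ge0 ?addr_ge0 ?px ?(mulr_ge0 K0 (px _)).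
apply: (@le_trans _ _ (C * (1 + `|x|) * p x)); first by rewrite ler_wpM2r.
rewrite -mulrA ler_wpM2l// mulrDl mul1r lerD2l.
exact: norm_mul_normal_pdf_le.
Qed.

Lemma normal_pdf_cvg0 (e : nat -> R) : (forall n, `|e n| = n%:R) ->
  p (e n) @[n --> \oo] --> 0.
Proof.
move=> en.
pose K := s * normal_peak s / normal_peak (s * Num.sqrt 2).
pose M := K * normal_peak (s * Num.sqrt 2).
have s20 : s * Num.sqrt 2 != 0 by rewrite mulf_neq0// gt_eqF// sqrtr_gt0.
apply: (@squeeze_cvgr _ _ _ _ (fun=> 0) (fun n => M * n%:R^-1)).
- near=> n.
  have n0 : (0 : R) < n%:R by rewrite ltr0n; near: n; exists 1%N.
  rewrite normal_pdf_ge0/= ler_pdivlMr// mulrC -(en n).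
  apply: le_trans (norm_mul_normal_pdf_le _) _.
  rewrite ler_wpM2l ?normal_pdf_ub// divr_ge0// ?normal_peak_ge0//.
  by rewrite mulr_ge0// ?normal_peak_ge0// ltW.
- exact: cvg_cst.
- rewrite -[X in _ --> X](mulr0 M); apply: cvgMl_tmp.
  apply/gtr0_cvgV0; last exact: cvgr_idn.
  by near=> n; rewrite ltr0n; near: n; exists 1%N.
Unshelve. all: by end_near. Qed.

Variable th : R.

Let arg_derive (l x : R) : is_derive x (1:R) (fun x => l * x + th) l.
Proof. by apply: is_derive_eq; rewrite ?addr0 scaler1/= ?mulr1. Qed.

Let sin_derive (l x : R) :
  is_derive x (1:R) (fun x => sin (l * x + th)) (l * cos (l * x + th)).
Proof.
have h3 := @is_derive1_comp R sin _ x _ _ (is_derive_sin _) (arg_derive l x).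
by apply: (is_derive_eq h3); rewrite mulrC.
Qed.

Let mcos l : measurable_fun setT (fun x : R => cos (l * x + th)).
Proof.
apply: measurableT_comp; first by apply: continuous_measurable_fun; exact: continuous_cos.
by apply: measurable_funD => //; exact: measurable_funM.
Qed.

Let msin l : measurable_fun setT (fun x : R => sin (l * x + th)).
Proof.
apply: measurableT_comp; first by apply: continuous_measurable_fun; exact: continuous_sin.
by apply: measurable_funD => //; exact: measurable_funM.
Qed.

Let cos_le1 (x : R) : `|cos x| <= 1. Proof. by rewrite ler_norml cos_geN1 cos_le1. Qed.
Let sin_le1 (x : R) : `|sin x| <= 1. Proof. by rewrite ler_norml sin_geN1 sin_le1. Qed.

Let int_cos l : leb.-integrable setT (fun x => (cos (l * x + th) * p x)%:E).
Proof.
apply: (@integrable_mul_normal_pdf _ 1) => // x.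
by rewrite mul1r (le_trans (cos_le1 _))// lerDl.
Qed.

Let int_xsin l : leb.-integrable setT (fun x => (x * sin (l * x + th) * p x)%:E).
Proof.
apply: (@integrable_mul_normal_pdf _ 1) => [|x]; first exact: measurable_funM.
by rewrite mul1r normrM (@le_trans _ _ `|x|)// ?lerDr// ler_piMr.
Qed.

(** Integration by parts with p' = - x p / s^2: the derivative of sin(l x + th) p(x)
has integral zero, being the limit of its integrals over [-n, n]. *)
Lemma normal_ibp l :
  \int[leb]_x (x * sin (l * x + th) * p x) =
  l * s ^+ 2 * \int[leb]_x (cos (l * x + th) * p x).
Proof.
pose g x := l * (cos (l * x + th) * p x) - (s ^+ 2)^-1 * (x * sin (l * x + th) * p x).
have ig1 : leb.-integrable setT (EFin \o (fun x => l * (cos (l * x + th) * p x))).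
  exact: (integrableZl measurableT l (int_cos l)).
have ig2 : leb.-integrable setT
    (EFin \o (fun x => (s ^+ 2)^-1 * (x * sin (l * x + th) * p x))).
  exact: (integrableZl measurableT (s ^+ 2)^-1 (int_xsin l)).
have ig : leb.-integrable setT (EFin \o g).
  exact: (integrableB measurableT ig1 ig2).
suff : \int[leb]_x g x = 0.
  rewrite /g (RintegralB measurableT ig1 ig2).
  rewrite (RintegralZl _ measurableT (int_cos l)) (RintegralZl _ measurableT (int_xsin l)).
  move=> /eqP; rewrite subr_eq0 => /eqP h.
  apply: (@mulfI _ (s ^+ 2)^-1); first by rewrite invr_neq0// expf_neq0.
  by rewrite -h; field.
pose G x := sin (l * x + th) * p x.
have dG (x : R) : is_derive x (1:R) G (g x).
  apply: (is_derive_eq (is_deriveM (sin_derive l x) (is_derive_normal_pdf x))).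
  by rewrite /g /GRing.scale/=; field.
have cg : continuous g.
  move=> x; apply: cvgB; apply: cvgMl_tmp; apply: cvgM; try exact: continuous_normal_pdf.
    apply: (@continuous_comp _ _ _ (fun x => l * x + th) cos); last exact: continuous_cos.
    by apply: cvgD; [apply: cvgMl_tmp; exact: cvg_id|exact: cvg_cst].
  apply: cvgM; first exact: cvg_id.
  apply: (@continuous_comp _ _ _ (fun x => l * x + th) sin); last exact: continuous_sin.
  by apply: cvgD; [apply: cvgMl_tmp; exact: cvg_id|exact: cvg_cst].
have cG : continuous G.
  by move=> x; apply/differentiable_continuous/derivable1_diffP; apply: ex_derive; exact: dG.
pose h (n : nat) := g \_ `[- n%:R, n%:R].
have [] := @Rintegral_dct _ _ _ leb h g (fun x => `|g x|).
- move=> n; apply/(measurable_restrictT g) => //.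
  by apply: measurable_funTS; apply: continuous_measurable_fun; exact: cg.
- move=> x; apply: cvg_near_cst; near=> n.
  rewrite /h patchE mem_set//= in_itv/=.
  rewrite -ler_norml.
  by near: n; exact: nbhs_infty_ger.
- exact: integrable_norm.
- by move=> n x; rewrite /h patchE; case: ifPn => //; rewrite normr0.
move=> _ c1.
have c2 : \int[leb]_x h n x @[n --> \oo] --> 0.
  have E : \forall n \near \oo, G n%:R - G (- n%:R) = \int[leb]_x h n x.
    near=> n.
    have n0 : (0 : R) < n%:R by rewrite ltr0n; near: n; exists 1%N.
    rewrite /h -Rintegral_mkcond /Rintegral.
    have nn : - n%:R < n%:R :> R by rewrite (@lt_trans _ _ 0)// oppr_lt0.
    rewrite (@continuous_FTC2 _ g G _ _ nn)//.
    + by apply: continuous_subspaceT.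
    + split; first by move=> x _; apply: ex_derive; exact: dG.
        by apply: cvg_at_right_filter; exact: cG.
      by apply: cvg_at_left_filter; exact: cG.
    + by move=> x _; rewrite derive1E; apply: derive_val.
  apply: cvg_trans (near_eq_cvg E) _.
  have z e : (forall n : nat, `|e n| = n%:R) -> G (e n) @[n --> \oo] --> 0.
    move=> en; apply: norm_cvg0.
    apply: (@squeeze_cvgr _ _ _ _ (fun=> 0) (fun n => p (e n))).
    - apply: nearW => n; rewrite normr_ge0/= normrM (ger0_norm (normal_pdf_ge0 _ _ _)).
      by rewrite ler_piMl// normal_pdf_ge0.
    - exact: cvg_cst.
    - exact: normal_pdf_cvg0.
  rewrite -(subr0 (0:R)); apply: cvgB; apply: z => n.
    by rewrite ger0_norm.
  by rewrite normrN ger0_norm.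
have := cvg_unique _ c1 c2; exact.
Unshelve. all: by end_near. Qed.

(** Differentiating in l under the integral and integrating by parts gives
F'(l) = - l s^2 F(l), whose solution is F(0) e^{- l^2 s^2 / 2}. *)
Lemma normal_char l :
  \int[leb]_x (cos (l * x + th) * p x) = cos th * expR (- (l ^+ 2 * s ^+ 2 / 2)).
Proof.
pose F (l : R) := \int[leb]_x (cos (l * x + th) * p x).
have dF (l0 : R) : is_derive l0 (1:R) F (- (l0 * s ^+ 2 * F l0)).
  have d1 (k x : R) : is_derive k (1:R) (fun l => cos (l * x + th) * p x)
      (- (x * sin (k * x + th) * p x)).
    have h0 : is_derive k (1:R) (fun k => k * x + th) x.
      by apply: is_derive_eq; rewrite ?addr0 /GRing.scale/= ?mulr1 ?mulr0 ?add0r.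
    have h1 := @is_derive1_comp R cos _ k _ _ (is_derive_cos _) h0.
    apply: (is_derive_eq (is_deriveM h1 (is_derive_cst (p x) k (1:R)))).
    by rewrite /GRing.scale/=; ring.
  have p1 (k x : R) : partial1of2 (fun l x => cos (l * x + th) * p x) k x =
      - (x * sin (k * x + th) * p x).
    by rewrite partial1of2E; have [_ ->] := d1 k x.
  have I0 : `](l0 - 1), (l0 + 1)[%classic l0 by rewrite /= in_itv/=; apply/andP; split; lra.
  have iG : leb.-integrable setT (EFin \o (fun x => `|x| * p x)).
    apply: (@integrable_mul_normal_pdf _ 1) => // x.
    by rewrite mul1r normr_id lerDr.
  have hyp1 : forall x, `](l0 - 1), (l0 + 1)[%classic x ->
      leb.-integrable setT (EFin \o (fun y => cos (x * y + th) * p y)) by move=> x _; exact: int_cos.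
  have hyp2 : forall (x y : R), `](l0 - 1), (l0 + 1)[%classic x -> setT y ->
     derivable (fun l : R => cos (l * y + th) * p y) x (1:R).
    by move=> x y _ _; apply: ex_derive; exact: d1.
  have hyp3 : forall y : R, 0 <= `|y| * p y.
    by move=> y; rewrite mulr_ge0// normal_pdf_ge0.
  have hyp4 : forall (x y : R), `](l0 - 1), (l0 + 1)[%classic x -> setT y ->
     `|partial1of2 (fun l x => cos (l * x + th) * p x) x y| <= `|y| * p y.
    move=> x y _ _; rewrite p1 normrN !normrM (ger0_norm (normal_pdf_ge0 _ _ _)).
    by rewrite ler_wpM2r ?normal_pdf_ge0// ler_piMr.
  have D1 := @derivable_under_integral R _ _ leb (fun l x => cos (l * x + th) * p x)
    setT measurableT l0 _ _ I0 hyp1 hyp2 _ hyp3 iG hyp4.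
  have D2 := @differentiation_under_integral R _ _ leb (fun l x => cos (l * x + th) * p x)
    setT measurableT l0 _ _ I0 hyp1 hyp2 _ hyp3 iG hyp4.
  apply: DeriveDef; first exact: D1.
  rewrite -derive1E; apply: (etrans D2).
  rewrite /F -normal_ibp -mulN1r -(RintegralZl _ measurableT (int_xsin l0)).
  by apply: eq_Rintegral => x _; rewrite p1 mulN1r.
pose K (l : R) := F l * expR (l ^+ 2 * (s ^+ 2 / 2)).
have dK : forall m : R, is_derive m (1:R) K 0.
  move=> m.
  have h0 : is_derive m (1:R) (fun l => l ^+ 2 * (s ^+ 2 / 2)) (m * s ^+ 2).
    apply: is_derive_eq; rewrite ?scaler0 ?add0r /GRing.scale/=; by field.
  have h1 := @is_derive1_comp R expR _ m _ _ (is_derive_expR _) h0.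
  apply: (is_derive_eq (is_deriveM (dF m) h1)).
  by rewrite /GRing.scale/=; ring.
have := is_derive_0_is_cst l 0 dK; rewrite /K expr0n/= mul0r expR0 mulr1.
have -> : F 0 = cos th.
  rewrite /F; under eq_Rintegral do rewrite mul0r add0r.
  rewrite RintegralZl//; last exact: integrable_normal_pdf.
  by rewrite /Rintegral integral_normal_pdf mulr1.
move=> <-; rewrite -/(F l) -[RHS]mulrA -expRD.
by rewrite (_ : _ + _ = 0) ?expR0 ?mulr1//; ring.
Qed.

End normal_characteristic.

Section centered_gaussian.
Context {R : realType}.

(** The density of the normal law is its Radon-Nikodym derivative. *)
Lemma integral_normal_prob (s : R) (f : R -> R) : bounded_measurable f ->
  \int[normal_prob 0 s]_x f x = \int[@lebesgue_measure R]_x (f x * normal_pdf 0 s x).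
Proof.
move=> bf.
have fint := bmf_integrable (normal_prob 0 s) bf.
have dom : normal_prob 0 s `<< @lebesgue_measure R := normal_prob_dominates 0 s.
rewrite /Rintegral; congr fine.
transitivity (\int[@lebesgue_measure R]_x ((f x)%:E * (normal_pdf 0 s x)%:E))%E; last first.
  by apply: eq_integral => x _; rewrite EFinM.
rewrite -(Radon_Nikodym_change_of_variables dom)//=.
apply: ae_eq_integral => //.
- apply: emeasurable_funM; first by apply/measurable_EFinP; exact: bf.1.
  apply: (measurable_int (@lebesgue_measure R)); exact: Radon_Nikodym_integrable.
- apply: emeasurable_funM; apply/measurable_EFinP; first exact: bf.1.
  exact: measurable_normal_pdf.
- apply: ae_eqe_mul2l => /=.
  rewrite Radon_NikodymE//=; case: cid => /= h [h1 h2 h3].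
  apply: integral_ae_eq => //=.
  + by apply/measurable_EFinP; exact: measurable_normal_pdf.
  + by move=> E E01 mE; rewrite -h3.
Qed.

Lemma bmf_cos (a th : R) : bounded_measurable (fun x : R => cos (a * x + th)).
Proof.
split.
  apply: measurableT_comp; first by apply: continuous_measurable_fun; exact: continuous_cos.
  by apply: measurable_funD => //; exact: measurable_funM.
by exists 1 => x; rewrite ler_norml cos_geN1 cos_le1.
Qed.

(** The phase th makes this real formula equivalent to the complex characteristic
function at frequency 1; the Dirac mass v = 0 follows the same formula. *)
Lemma gauss_cos {d} {T : measurableType d} (P : probability T R) (X : T -> R) (v th : R) :
  0 <= v -> centered_gaussian P X v ->
  \int[P]_w cos (X w + th) = cos th * expR (- (v / 2)).
Proof.
move=> v0 [mX lawX].
have bc := bmf_cos 1 th.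
have [z|vn0] := eqVneq v 0.
  rewrite z mul0r oppr0 expR0 mulr1.
  rewrite (@eq_law_int _ _ _ _ _ _ _ P (\d_(0:R)) X id (fun x => cos (x + th)))//.
  + rewrite /Rintegral integral_dirac//=; last first.
      apply/measurable_EFinP; move: bc.1; congr measurable_fun.
      by apply/funext => x; rewrite mul1r.
    by rewrite indicE in_setT mul1r add0r.
  + by move=> B mB; rewrite lawX// /gauss_law z eqxx.
  + by move: bc; congr bounded_measurable; apply/funext => x; rewrite mul1r.
have s0 : 0 < Num.sqrt v by rewrite sqrtr_gt0 lt_def vn0.
transitivity (\int[P]_w cos (1 * X w + th)).
  by apply: eq_Rintegral => w _; rewrite mul1r.
rewrite (@eq_law_int _ _ _ _ _ _ _ P (normal_prob 0 (Num.sqrt v)) X id (fun x => cos (1 * x + th)))//.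
rewrite integral_normal_prob// normal_char// expr1n mul1r sqr_sqrtr//.
by move=> B mB; rewrite lawX// /gauss_law (negbTE vn0).
Qed.

End centered_gaussian.

(** * Polynomials that approximate a step function *)

Section step_approximation.
Context {R : realType}.

Lemma natmul_geometric_cvg0 (r : R) : 0 <= r -> r < 1 ->
  n%:R * r ^+ n @[n --> \oo] --> 0.
Proof.
move=> r0 r1; have [->|rn0] := eqVneq r 0.
  apply: cvg_near_cst; near=> n.
  have n0 : (0 < n)%N by near: n; exists 1%N.
  by rewrite expr0n gtn_eqF// mulr0.
pose t := Num.sqrt r.
have t0 : 0 < t by rewrite sqrtr_gt0 lt_def rn0.
have t1 : t < 1 by rewrite -sqrtr1 ltr_sqrt.
have tE : t ^+ 2 = r by rewrite sqr_sqrtr.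
pose h := t^-1 - 1.
have h0 : 0 < h by rewrite subr_gt0 invf_gt1.
have B n : n%:R * r ^+ n <= h^-1 * t ^+ n.
  have := @bernoulli_expr R t^-1 n _; rewrite invr_ge0 (ltW t0) => /(_ isT).
  rewrite -/h => b2.
  have k : n%:R * h <= (t ^+ n)^-1 by rewrite -exprVn (le_trans _ b2)// lerDr.
  rewrite -tE -exprM mulnC exprM expr2 mulrA ler_pM2r ?exprn_gt0//.
  by rewrite -ler_pdivlMr ?exprn_gt0// mulrC ler_pdivlMr.
apply: (@squeeze_cvgr _ _ _ _ (fun=> 0) (fun n => h^-1 * t ^+ n)).
- by apply: nearW => n; rewrite B mulr_ge0// exprn_ge0.
- exact: cvg_cst.
- rewrite -[X in _ --> X](mulr0 h^-1); apply: cvgMl_tmp.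
  by apply: cvg_expr; rewrite ger0_norm// ltW.
Unshelve. all: by end_near. Qed.

(** These polynomials tend pointwise on [0, 1] to the indicator of [0, 1/2[: the
exponent n 2^n lies between the orders of 1/y^n for y < 1/2 and for y >= 1/2.
They are of the kind used in elementary proofs of the Stone-Weierstrass theorem. *)
Definition step_poly n (y : R) := (1 - y ^+ n) ^+ (n * 2 ^ n).

Lemma step_poly_itv n y : 0 <= y <= 1 -> 0 <= step_poly n y <= 1.
Proof.
move=> /andP[y0 y1]; have h : 0 <= y ^+ n <= 1 by rewrite exprn_ge0// exprn_ile1.
have {h} /andP[h1 h2] := h.
by rewrite exprn_ge0 ?exprn_ile1// ?subr_ge0// lerBlDr lerDl.
Qed.

Lemma step_poly_cvg y : 0 <= y <= 1 ->
  step_poly n y @[n --> \oo] --> ((y < 1/2)%R%:R : R).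
Proof.
move=> y01; have /andP[y0 y1] := y01.
have [yh|yh] := ltP y (1/2).
  apply: (@squeeze_cvgr _ _ _ _ (fun n => 1 - n%:R * (2 * y) ^+ n) (fun=> 1)).
  - apply: nearW => n; have /andP[_ ->] := step_poly_itv n y01.
    rewrite andbT /step_poly.
    have h : 0 <= 1 - y ^+ n by rewrite subr_ge0 exprn_ile1.
    apply: le_trans (bernoulli_expr _ h).
    rewrite natrM natrX exprMn; lra.
  - rewrite -[X in _ --> X](subr0 1); apply: cvgB; first exact: cvg_cst.
    by apply: natmul_geometric_cvg0; lra.
  - exact: cvg_cst.
apply: (@squeeze_cvgr _ _ _ _ (fun=> 0) (fun n => n.+1%:R^-1)).
- apply: nearW => n; have /andP[-> _] := step_poly_itv n y01.
  rewrite /= /step_poly.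
  pose a : R := (1/2) ^+ n.
  have a0 : 0 < a by rewrite exprn_gt0//; lra.
  have a1 : a <= 1 by rewrite exprn_ile1//; lra.
  have ay : a <= y ^+ n by rewrite lerXn2r ?nnegrE//; lra.
  have y1n : y ^+ n <= 1 by rewrite exprn_ile1.
  apply: (@le_trans _ _ ((1 - a) ^+ (n * 2 ^ n))).
    by rewrite lerXn2r ?nnegrE; lra.
  (* 1 - a <= 1/(1 + a), and Bernoulli bounds (1 + a)^(n 2^n) below by 1 + n since
     a = 2^-n. *)
  apply: (@le_trans _ _ (((1 + a)^-1) ^+ (n * 2 ^ n))).
    rewrite lerXn2r ?nnegrE ?invr_ge0//; try lra.
    rewrite -[leRHS]div1r ler_pdivlMr; last lra.
    have : 0 <= a ^+ 2 by exact: sqr_ge0.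
    rewrite expr2; lra.
  rewrite exprVn lef_pV2 ?posrE ?exprn_gt0//; last lra.
  have h : 0 <= 1 + a by lra.
  apply: le_trans (bernoulli_expr _ h).
  have -> : 1 + a - 1 = a by ring.
  rewrite natrM natrX -mulrA -exprMn.
  have -> : (2 * (1 / 2) : R) = 1 by field.
  by rewrite expr1n mulr1 -natr1 addrC.
- exact: cvg_cst.
- exact: cvg_harmonic.
Qed.

Lemma cvg_prod_seq {I} (r : seq I) (F : nat -> I -> R) (G : I -> R) :
  (forall i, F n i @[n --> \oo] --> G i) ->
  \prod_(i <- r) F n i @[n --> \oo] --> \prod_(i <- r) G i.
Proof.
move=> FG; elim: r => [|i r IH].
  rewrite big_nil; under eq_fun do rewrite big_nil; exact: cvg_cst.
rewrite big_cons; under eq_fun do rewrite big_cons.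
by apply: cvgM => //; exact: FG.
Qed.

Lemma sin_lt0_small (z : R) : `|z| < pi -> (sin z < 0) = (z < 0).
Proof.
rewrite ltr_norml => /andP[h1 h2]; have [z0|z0|->] := ltgtP z 0.
- by rewrite -(opprK z) sinN oppr_lt0 sin_gt0_pi//; apply/andP; split; lra.
- by rewrite ltNge ltW// sin_gt0_pi// z0 h2.
- by rewrite sin0 ltxx.
Qed.

End step_approximation.

(** * The Borel sets of a separable Hilbert space *)

Section borel_hilbert.
Context {R : realType} {H : completeNormedModType R} (dot : {dot H for idfun}).
Context (dot_norm : forall x, dot x x = `|x| ^+ 2) (H_sep : @separable R H).

Definition polyhedron (l : seq (H * R)) : set H :=
  [set x | all (fun q => dot x q.1 < q.2) l].

Lemma polyhedron_nil : polyhedron [::] = setT.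
Proof. by apply/seteqP. Qed.

Lemma polyhedron_cons q l :
  polyhedron (q :: l) = [set x | dot x q.1 < q.2] `&` polyhedron l.
Proof. by apply/seteqP; split=> x; rewrite /polyhedron/= => /andP. Qed.

(** A class stable by intersection, hence fit for Dynkin's lemma, made of sets that only
involve finitely many coordinates <x, h>. *)
Definition polyhedra : set (set H) := range polyhedron.

Lemma polyhedra_setI : setI_closed polyhedra.
Proof.
move=> _ _ [l _ <-] [k _ <-]; exists (l ++ k) => //.
by apply/seteqP; split=> x; rewrite /polyhedron/= all_cat => /andP.
Qed.

Lemma measurable_borel_continuous (f : H -> R) : continuous f ->
  measurable_fun [set: borel H] f.
Proof.
move=> /continuousP cf; apply: (measurability _ (RGenOpens.measurableE R)).
move=> _ [_ [a [b ->] <-]]; rewrite setTI.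
by apply: sub_sigma_algebra; apply: cf; exact: interval_open.
Qed.

Lemma measurable_dot h : measurable_fun [set: borel H] (fun x : borel H => dot x h).
Proof. by apply: measurable_borel_continuous; exact: dotr_continuous. Qed.

Lemma sigma_halfspace h c : <<s polyhedra >> [set x | dot x h < c].
Proof.
apply: sub_sigma_algebra; exists [:: (h, c)] => //.
by apply/seteqP; split=> x; rewrite /polyhedron/= andbT.
Qed.

Lemma separable_seq : exists e : nat -> H,
  forall x (r : R), 0 < r -> exists n, `|x - e n| < r.
Proof.
have [D [/pcard_surjP[e eD] dD]] := H_sep; exists e => x r r0.
have [|y [By /eD[n _ eny]]] := dD (ball x r) _ (ball_open x r).
  by exists x; exact: ballxx.
by exists n; rewrite eny; move: By; rewrite -ball_normE.
Qed.

(** A closed ball is the intersection of the half-spaces <x - a, e> <= r |e| over a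
dense sequence of e: if |x - a| > r, any e close to x - a violates the
corresponding inequality. Strict half-spaces are reached by a margin 1/(k+1). *)
Lemma sigma_closed_ball a (r : R) : 0 <= r -> <<s polyhedra >> [set x | `|x - a| <= r].
Proof.
move=> r0; have [e eP] := separable_seq.
have -> : [set x | `|x - a| <= r] =
    \bigcap_n ~` (\bigcup_k ~` [set x | dot x (e n) < r * `|e n| + dot a (e n) + k.+1%:R^-1]).
  apply/seteqP; split=> x /=.
    move=> xr n _ [k _] /= /negP; rewrite -leNgt => h.
    have : dot (x - a) (e n) <= r * `|e n|.
      rewrite (le_trans (ler_norm _))//.
      by rewrite (le_trans (dot_CS dot_norm _ _))// ler_wpM2r.
    have k0 : (0 : R) < k.+1%:R^-1 by rewrite invr_gt0.
    rewrite dotBl; move: k0 h; set kk := _^-1; set A := dot x _; set B := dot a _; set C := r * _ => k0 h1 h2; lra.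
  move=> h; rewrite leNgt; apply/negP => rx.
  set z := x - a in rx.
  have z0 : 0 < `|z| by exact: le_lt_trans rx.
  pose dl := `|z| * (`|z| - r) / (`|z| + r).
  have dl0 : 0 < dl by rewrite divr_gt0 ?mulr_gt0 ?subr_gt0// ltr_wpDr.
  have [n zn] := eP z dl dl0.
  have h1 : dot z (e n) <= r * `|e n|.
    apply/ler_addgt0Pr => t t0.
    have [k kt] : exists k, (k.+1%:R^-1 : R) < t.
      exists (Num.truncn t^-1); rewrite invf_plt ?posrE//; exact: truncnS_gt.
    have : dot x (e n) < r * `|e n| + dot a (e n) + k.+1%:R^-1.
      rewrite ltNge; apply/negP => hk; apply: (h n I); exists k => //=.
      by apply/negP; rewrite -leNgt.
    rewrite /z dotBl; move: kt; set kk := _^-1; set A := dot x _; set B := dot a _; set C := r * _ => h1 h2; lra.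
  have h2 : `|z| ^+ 2 - dot z (e n) <= `|z| * `|z - e n|.
    rewrite -dot_norm -dotBr (le_trans (ler_norm _))//; exact: dot_CS.
  have h3 : `|e n| <= `|z| + `|z - e n|.
    by rewrite -[X in `|X| <= _](subKr z) (le_trans (ler_normB _ _)).
  have h4 : `|z - e n| * (`|z| + r) < `|z| * (`|z| - r).
    by rewrite -ltr_pdivlMr// ltr_wpDr.
  have h5 : r * `|e n| <= r * (`|z| + `|z - e n|) by rewrite ler_wpM2l.
  rewrite expr2 in h2; move: h1 h2; set A := dot z _ => h1 h2; nra.
apply: (@bigcap_measurable _ (g_sigma_algebraType polyhedra)) => [|n _]; first by exists 0%N.
apply: (@measurableC _ (g_sigma_algebraType polyhedra)).
apply: (@bigcup_measurable _ (g_sigma_algebraType polyhedra)) => k _.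
apply: (@measurableC _ (g_sigma_algebraType polyhedra)).
exact: sigma_halfspace.
Qed.

(** In a separable space an open set is a countable union of closed balls. *)
Lemma borel_polyhedra : @measurable _ (borel H) = <<s polyhedra >>.
Proof.
apply/seteqP; split; last first.
  apply: smallest_sub; first exact: smallest_sigma_algebra.
  move=> _ [l _ <-]; elim: l => [|q l IH].
    by rewrite polyhedron_nil; exact: (@measurableT _ (borel H)).
  rewrite polyhedron_cons.
    apply: (@measurableI _ (borel H)) => //; apply: sub_sigma_algebra.
    rewrite (_ : [set x | _] = (fun x => dot x q.1) @^-1` `]-oo, q.2[%classic).
      by move/continuousP : (@dotr_continuous _ _ dot dot_norm q.1); apply; exact: interval_open.
    by apply/seteqP; split=> x /=; rewrite in_itv.
apply: smallest_sub; first exact: smallest_sigma_algebra.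
move=> U oU; have [e eP] := separable_seq.
have -> : U = \bigcup_n \bigcup_(k in [set k | [set x | `|x - e n| <= k.+1%:R^-1 ] `<=` U])
    [set x | `|x - e n| <= (k.+1%:R^-1 : R)].
  apply/seteqP; split=> [x Ux|x [n _] [k /= kU xk]]; last exact: kU.
  have /nbhs_ballP[r /= r0 rU] : nbhs x U by exact: open_nbhs_nbhs.
  have [k kr] : exists k, (k.+1%:R^-1 : R) < r / 2.
    exists (Num.truncn (r / 2)^-1); rewrite invf_plt ?posrE ?divr_gt0//; exact: truncnS_gt.
  have k0 : (0 : R) < k.+1%:R^-1 by rewrite invr_gt0.
  have [n xn] := eP x _ k0.
  exists n => //; exists k => /=; last exact: ltW.
  move=> y yn; apply: rU; rewrite -ball_normE /=.
  rewrite -(subrKA (e n)) (le_lt_trans (ler_normD _ _))// (distrC (e n)).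
  move: kr xn yn; set kk := _^-1 => kr xn /= yn; lra.
apply: (@bigcup_measurable _ (g_sigma_algebraType polyhedra)) => n _.
apply: (@bigcup_measurable _ (g_sigma_algebraType polyhedra)) => k _.
by apply: sigma_closed_ball; rewrite invr_ge0.
Qed.

(** Weak measurability is measurability, as the sets <x, h> < c generate the Borel sets. *)
Lemma measurable_to_borel {d} {T : measurableType d} (f : T -> borel H) :
  (forall h, measurable_fun setT (fun t => dot (f t) h)) -> measurable_fun setT f.
Proof.
move=> mf; apply: (measurability _ borel_polyhedra).
move=> _ [_ [l _ <-] <-]; rewrite setTI; elim: l => [|q l IH].
  by rewrite polyhedron_nil preimage_setT.
rewrite polyhedron_cons preimage_setI; apply: measurableI => //.
rewrite (_ : _ @^-1` _ = (fun t => dot (f t) q.1) @^-1` `]-oo, q.2[%classic).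
  rewrite -[X in measurable X]setTI; apply: mf => //; exact: measurable_itv.
by apply/seteqP; split=> t /=; rewrite in_itv.
Qed.

End borel_hilbert.

(** * Trigonometric polynomials and a functional monotone class theorem *)

Section trigonometric.
Context {R : realType} {H : completeNormedModType R} (dot : {dot H for idfun}).
Context (dot_norm : forall x, dot x x = `|x| ^+ 2) (H_sep : @separable R H).

Definition trig_poly (l : seq (R * H * R)) (x : H) : R :=
  \sum_(q <- l) q.1.1 * cos (dot x q.1.2 + q.2).

Definition is_trig (f : H -> R) := exists l, f = trig_poly l.

Lemma is_trig_cos h th : is_trig (fun x => cos (dot x h + th)).
Proof.
by exists [:: (1, h, th)]; apply/funext => x; rewrite /trig_poly big_seq1 mul1r.
Qed.

Lemma is_trigD f g : is_trig f -> is_trig g -> is_trig (fun x => f x + g x).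
Proof.
move=> [l ->] [k ->]; exists (l ++ k); apply/funext => x.
by rewrite /trig_poly big_cat.
Qed.

Lemma is_trigZ (c : R) f : is_trig f -> is_trig (fun x => c * f x).
Proof.
move=> [l ->]; exists [seq (c * q.1.1, q.1.2, q.2) | q <- l]; apply/funext => x.
by rewrite /trig_poly big_map mulr_sumr; apply: eq_bigr => q _; rewrite mulrA.
Qed.

Lemma is_trig_cst (c : R) : is_trig (fun=> c).
Proof.
have := is_trigZ c (is_trig_cos 0 0); congr is_trig; apply/funext => x.
by rewrite (dot0r dot) addr0 cos0 mulr1.
Qed.

Lemma is_trig_sum I (r : seq I) (F : I -> H -> R) :
  (forall i, is_trig (F i)) -> is_trig (fun x => \sum_(i <- r) F i x).
Proof.
move=> tF; elim: r => [|i r IH].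
  have := is_trig_cst 0; congr is_trig; by apply/funext => x; rewrite big_nil.
have := is_trigD (tF i) IH; congr is_trig; by apply/funext => x; rewrite big_cons.
Qed.

Lemma cosM_sum (a b : R) : cos a * cos b = 1/2 * cos (a + b) + 1/2 * cos (a - b).
Proof. by rewrite cosD cosB; field. Qed.

Lemma is_trigM f g : is_trig f -> is_trig g -> is_trig (fun x => f x * g x).
Proof.
move=> [l ->] [k ->].
have := @is_trig_sum _ l (fun q x => q.1.1 *
  (\sum_(p <- k) p.1.1 * (1/2 * cos (dot x (q.1.2 + p.1.2) + (q.2 + p.2)) +
                 1/2 * cos (dot x (q.1.2 - p.1.2) + (q.2 - p.2))))).
move=> h.
have : is_trig (fun x : H => \sum_(q <- l) q.1.1 *
  (\sum_(p <- k) p.1.1 * (1/2 * cos (dot x (q.1.2 + p.1.2) + (q.2 + p.2)) +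
                 1/2 * cos (dot x (q.1.2 - p.1.2) + (q.2 - p.2))))).
  apply: h => q; apply: is_trigZ; apply: is_trig_sum => p; apply: is_trigZ.
  by apply: is_trigD; apply: is_trigZ; exact: is_trig_cos.
congr is_trig; apply/funext => x; rewrite /trig_poly mulr_suml.
apply: eq_bigr => q _; rewrite -mulrA; congr (_ * _).
rewrite mulr_sumr; apply: eq_bigr => p _.
rewrite mulrCA; congr (_ * _); rewrite cosM_sum (dotDr dot) (dotBr dot).
by congr (_ * cos _ + _ * cos _); ring.
Qed.

Lemma is_trigX f n : is_trig f -> is_trig (fun x => f x ^+ n).
Proof.
move=> tf; elim: n => [|n IH].
  have := is_trig_cst 1; congr is_trig; by apply/funext => x; rewrite expr0.
have := is_trigM tf IH; congr is_trig; by apply/funext => x; rewrite exprS.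
Qed.

Lemma is_trig_prod I (r : seq I) (F : I -> H -> R) :
  (forall i, is_trig (F i)) -> is_trig (fun x => \prod_(i <- r) F i x).
Proof.
move=> tF; elim: r => [|i r IH].
  have := is_trig_cst 1; congr is_trig; by apply/funext => x; rewrite big_nil.
have := is_trigM (tF i) IH; congr is_trig; by apply/funext => x; rewrite big_cons.
Qed.

Lemma bmf_cos_dot h th :
  bounded_measurable (fun x : borel H => cos (dot x h + th)).
Proof.
split; last by exists 1 => x; rewrite ler_norml cos_geN1 cos_le1.
apply: (@measurableT_comp _ _ _ _ _ _ (fun y : R => cos (y + th))) => //; last first.
  exact: measurable_dot.
by have [+ _] := bmf_cos 1 th; congr measurable_fun; apply/funext => x; rewrite mul1r.
Qed.

Lemma bmf_trig f : is_trig f -> bounded_measurable (f : borel H -> R).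
Proof.
by move=> [l ->]; apply: bmf_sum => q; apply: bmfZ; exact: bmf_cos_dot.
Qed.

Section monotone_class.
Import HBSimple HBNNSimple.
Variable V : set (H -> R).
Hypothesis V_trig : forall f, is_trig f -> V f.
Hypothesis VD : forall f g, V f -> V g -> V (fun x => f x + g x).
Hypothesis VZ : forall (c : R) f, V f -> V (fun x => c * f x).
Hypothesis V_lim : forall (f_ : nat -> H -> R) f (M : R),
  (forall n, V (f_ n)) -> (forall n x, `|f_ n x| <= M) ->
  (forall x, f_ n x @[n --> \oo] --> f x) -> V f.

(** A trigonometric function that is below 1/2 exactly on the half-space
<x, q.1> < q.2, as long as |<x, q.1> - q.2| < pi (N + 1); applying [step_poly] to it
and letting N grow gives the indicator of the half-space. *)
Let ramp N (q : H * R) (x : H) : R := 1/2 + 1/2 * sin ((dot x q.1 - q.2) / N.+1%:R).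

Let ramp_itv N q x : 0 <= ramp N q x <= 1.
Proof.
have := sin_le1 ((dot x q.1 - q.2) / N.+1%:R).
have := sin_geN1 ((dot x q.1 - q.2) / N.+1%:R).
by rewrite /ramp; set s := sin _; move=> *; apply/andP; split; lra.
Qed.

Let trig_ramp N q : is_trig (ramp N q).
Proof.
apply: is_trigD; first exact: is_trig_cst.
apply: is_trigZ.
have := is_trig_cos (N.+1%:R^-1 *: q.1) (- (q.2 / N.+1%:R) - pi / 2).
congr is_trig; apply/funext => x.
rewrite (dotZr dot) addrA cosBpihalf; congr sin.
by rewrite mulrBl mulrC.
Qed.

Let trig_step N n l : is_trig (fun x => \prod_(q <- l) step_poly n (ramp N q x)).
Proof.
apply: is_trig_prod => q; rewrite /step_poly; apply: is_trigX.
have := is_trigD (is_trig_cst 1) (is_trigZ (-1) (is_trigX n (trig_ramp N q))).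
by congr is_trig; apply/funext => x; rewrite mulN1r.
Qed.

Let prod01 (I : Type) (r : seq I) (F : I -> R) :
  (forall i, 0 <= F i <= 1) -> `|\prod_(i <- r) F i| <= 1.
Proof.
move=> h; elim: r => [|i r IH]; first by rewrite big_nil normr1.
rewrite big_cons normrM; have /andP[h0 h1] := h i.
by rewrite mulr_ile1// ger0_norm.
Qed.

Let V_step N l : V (fun x => \prod_(q <- l) ((ramp N q x < 1/2)%R%:R)).
Proof.
apply: (V_lim (fun n => V_trig (trig_step N n l)) (M := 1)).
- by move=> n x; apply: prod01 => q; apply: step_poly_itv; exact: ramp_itv.
- by move=> x; apply: cvg_prod_seq => q; apply: step_poly_cvg; exact: ramp_itv.
Qed.

Let V_polyhedron l : V (\1_(polyhedron dot l)).
Proof.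
have -> : \1_(polyhedron dot l) = (fun x : H => \prod_(q <- l) ((dot x q.1 < q.2)%R%:R : R)).
  apply/funext => x; elim: l => [|q l IH].
    by rewrite polyhedron_nil big_nil indicE in_setT.
  rewrite big_cons -IH polyhedron_cons indicI /= !indicE; congr (_ * _).
  by congr (nat_of_bool _)%:R; apply/idP/idP; rewrite inE.
apply: (V_lim (fun N => V_step N l) (M := 1)).
- by move=> n x; apply: prod01 => q; case: (_ < _); rewrite ?lexx ?ler01.
- move=> x; apply: cvg_prod_seq => q; apply: cvg_near_cst; near=> N.
  congr (nat_of_bool _)%:R.
  have -> : (ramp N q x < 1 / 2) = (sin ((dot x q.1 - q.2) / N.+1%:R) < 0).
    by rewrite /ramp; set s := sin _; apply/idP/idP => ?; lra.
  rewrite sin_lt0_small; first by rewrite pmulr_llt0 ?invr_gt0// subr_lt0.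
  rewrite normrM normfV (@ger0_norm _ N.+1%:R)// ltr_pdivrMr// mulrC.
  rewrite -ltr_pdivrMr ?pi_gt0//.
  near: N.
  have h := @nbhs_infty_gtr R (`|dot x q.1 - q.2| / pi).
  apply: filterS h => n h; apply: lt_le_trans h _; by rewrite ler_nat.
Unshelve. all: by end_near. Qed.

Let V_cst (c : R) : V (fun=> c). Proof. by apply: V_trig; exact: is_trig_cst. Qed.

Let V_sum I (r : seq I) (F : I -> H -> R) :
  (forall i, V (F i)) -> V (fun x => \sum_(i <- r) F i x).
Proof.
move=> tF; elim: r => [|i r IH].
  have := V_cst 0; congr V; by apply/funext => x; rewrite big_nil.
have := VD (tF i) IH; congr V; by apply/funext => x; rewrite big_cons.
Qed.

Let V_indic (A : set (borel H)) : measurable A -> V (\1_A).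
Proof.
rewrite (borel_polyhedra dot_norm H_sep).
have P1 := @dynkin_induction _ (borel H) (polyhedra dot)
  (fun A : set (borel H) => V (\1_A)) (borel_polyhedra dot_norm H_sep)
  (@polyhedra_setI _ _ dot).
move: A; apply: P1.
- have := V_cst 1; congr V; by apply/funext => x; rewrite indicT.
- by move=> _ [l _ <-]; exact: V_polyhedron.
- move=> S _ VS; have := VD (V_cst 1) (VZ (-1) VS); congr V; apply/funext => x.
  by rewrite !indicE in_setC mulN1r; case: (x \in S); rewrite /= ?subrr ?subr0.
- move=> F mF tF VF.
  have sumE k x n : F k x -> \sum_(i < n) (\1_(F i) x : R) = (k < n)%:R.
    move=> Fkx; elim: n => [|n IH]; first by rewrite big_ord0.
    rewrite big_ord_recr/= IH indicE.
    have -> : (x \in F n) = (k == n).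
      apply/idP/eqP => [|<-]; last by rewrite inE.
      by rewrite inE => Fnx; apply: (tF k n) => //; exists x.
    by rewrite -natrD; congr _%:R; case: ltngtP => h; rewrite ?ltnS ?h ?(ltnW h) ?leqnn//
      leqNgt ?h.
  have sum0 x n : ~ (\bigcup_k F k) x -> \sum_(i < n) (\1_(F i) x : R) = 0.
    move=> nF; rewrite big1// => i _; rewrite indicE memNset// => Fi.
    by apply: nF; exists i.
  apply: (@V_lim (fun n x => \sum_(k < n) \1_(F k) x) _ 1).
  + by move=> n; apply: V_sum => k; exact: VF.
  + move=> n x; have [[k _ Fk]|nF] := pselect ((\bigcup_k F k) x).
      by rewrite (sumE k)//; case: (k < n)%N; rewrite ?normr0 ?normr1.
    by rewrite sum0// normr0.
  + move=> x; rewrite indicE; have [[k _ Fk]|nF] := pselect ((\bigcup_k F k) x).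
      rewrite mem_set; last by exists k.
      apply: cvg_near_cst; near=> n; rewrite (sumE k)//.
      by have -> : (k < n)%N by near: n; exists k.+1.
    rewrite memNset//; apply: cvg_near_cst; apply: nearW => n; exact: sum0.
Unshelve. all: by end_near. Qed.

(** A vector space of functions that contains the trigonometric polynomials and is
closed under bounded pointwise limits contains the bounded Borel functions: it
contains the indicators of polyhedra as limits of trigonometric polynomials, then
those of Borel sets by Dynkin's lemma, then simple functions and their limits. *)
Lemma functional_monotone_class f : bounded_measurable (f : borel H -> R) -> V f.
Proof.
have V_simple (g : {fimfun (borel H) >-> R}) : measurable_fun setT (g : borel H -> R) -> V g.
  move=> mg.
  have E := fimfunEord g; rewrite (funext E).
  apply: V_sum => i; apply: VZ; apply: V_indic.
  by rewrite -[X in measurable X]setTI; apply: mg.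
have Vnn g M : measurable_fun setT (g : borel H -> R) -> (forall x, 0 <= g x <= M) -> V g.
  move=> mg gM.
  have mEg : measurable_fun [set: borel H] (EFin \o g) by exact/measurable_EFinP.
  have g0 x : setT x -> (0 <= (EFin \o g) x)%E.
    by move=> _; rewrite lee_fin; have /andP[] := gM x.
  pose a n : H -> R := nnsfun_approx measurableT mEg n.
  have ca x : a n x @[n --> \oo] --> g x.
    by have := @cvg_nnsfun_approx _ _ _ _ measurableT _ mEg g0 x I => /fine_cvgP[].
  apply: (@V_lim a g M) => //.
  - by move=> n; apply: V_simple; exact: measurable_funP.
  - move=> n x; rewrite ger0_norm//.
    have /andP[_ gx] := gM x; apply: le_trans gx.
    have nd : nondecreasing_seq (a ^~ x).
      by move=> m k mk; have /lefP := @nd_nnsfun_approx _ _ _ _ measurableT _ mEg m k mk; exact.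
    by rewrite -(cvg_lim _ (ca x))//; apply: nondecreasing_cvgn_le => //; apply/cvg_ex; exists (g x); exact: ca.
move=> [mf [M fM]].
have h : V (fun x => f x + M).
  apply: (@Vnn _ (M + M)); first by apply: measurable_funD.
  by move=> x; have := fM x; rewrite ler_norml => /andP[? ?]; apply/andP; split; lra.
have := VD h (V_cst (- M)); congr V; apply/funext => x.
by rewrite addrK.
Qed.

End monotone_class.
End trigonometric.

(** * Translations and reflections of the Lebesgue measure *)

Section lebesgue_isometry.
Context {R : realType}.
Local Notation leb := (@lebesgue_measure R).

Lemma lebesgue_measure_shift (c : R) (A : set R) : measurable A ->
  leb ((fun s : R => c + s) @^-1` A) = leb A.
Proof.
have mphi : measurable_fun setT (fun s : R => c + s : measurableTypeR R).
  exact: measurable_funD.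
move=> mA; symmetry.
apply: (@lebesgue_measure_unique _ (pushforward leb (fun s : R => c + s : measurableTypeR R))) => //= _ [[a b]] _ <-.
rewrite /pushforward (_ : _ @^-1` _ = `]a - c, b - c]%classic); last first.
  by apply/seteqP; split=> x /=; rewrite !in_itv/= ltrBlDl lerBrDl.
rewrite !lebesgue_measure_itv/= !lte_fin ltrD2r -!EFinB; case: ifP => // _.
by congr (_%:E); ring.
Qed.

Lemma lebesgue_measure_reflect (c : R) (A : set R) : measurable A ->
  leb ((fun s : R => c - s) @^-1` A) = leb A.
Proof.
move=> mA; rewrite (_ : _ @^-1` A = (-%R : _ -> measurableTypeR R) @^-1` ((fun s : R => c + s) @^-1` A))//.
have := @lebesgue_measureN R ((fun s : R => c + s) @^-1` A); rewrite /pushforward => ->.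
  exact: lebesgue_measure_shift.
rewrite -[X in measurable X]setTI.
have mphi : measurable_fun setT (fun s : R => c + s) by exact: measurable_funD.
exact: mphi.
Qed.

Lemma ge0_integral_isometry (phi : R -> R) (D : set R) (f : R -> \bar R) :
  measurable_fun setT phi ->
  (forall A, measurable A -> leb (phi @^-1` A) = leb A) ->
  measurable D -> measurable_fun D f -> (forall x, D x -> (0 <= f x)%E) ->
  (\int[leb]_(x in D) f x = \int[leb]_(x in phi @^-1` D) f (phi x))%E.
Proof.
move=> mphi phiE mD mf f0.
have f0' : {in D, forall x, (0 <= f x)%E} by move=> x /set_mem; exact: f0.
have := @ge0_integral_pushforward _ _ (measurableTypeR R) (measurableTypeR R) R phi mphi
  (@lebesgue_measure R) D f mD mf f0'.
move=> <-; apply: eq_measure_integral => A mA _; exact/esym/phiE.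
Qed.

Lemma measurable_fun_shift (c : R) : measurable_fun setT (fun s : R => c + s).
Proof. exact: measurable_funD. Qed.

Lemma measurable_fun_reflect (c : R) : measurable_fun setT (fun s : R => c - s).
Proof. exact: measurable_funB. Qed.

End lebesgue_isometry.

Section continuous_linear.
Context {R : realType} {H : completeNormedModType R}.

Lemma continuous_linear_bound (f : {linear H -> H}) : continuous f ->
  exists2 C : R, 0 <= C & forall x, `|f x| <= C * `|x|.
Proof.
move=> /linear_bounded_continuous/linear_boundedP/pinfty_ex_gt0[C C0 fC].
by exists C => //; exact: ltW.
Qed.

End continuous_linear.

(** * The adjoint semigroup and the covariance forms *)

Section adjoint_semigroup.
Context {R : realType} {H : completeNormedModType R} (dot : {dot H for idfun}).
Context (dot_norm : forall x, dot x x = `|x| ^+ 2).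
Context (S : R -> {linear H -> H}) (S_semigroup : c0_semigroup S).
Context (T : R -> H -> H) (S_adj : forall t : R, 0 <= t -> adjoint_of dot (S t) (T t)).
Context (Q : {linear H -> H}) (Q_bounded : continuous Q)
    (Q_ge0 : selfadjoint_nonneg dot Q).
Context (Qoo : H -> H)
    (Qoo_int : op_integral dot `[0, +oo[ (fun s x => S s (Q (T s x))) Qoo).
Implicit Types (s t : R) (h k x y : H).

Let dotC := dotC dot.
Let dotDl := dotDl dot.
Let dotDr := dotDr dot.
Let dotZl := dotZl dot.
Let dotZr := dotZr dot.

Lemma adjointD t h k : 0 <= t -> T t (h + k) = T t h + T t k.
Proof.
move=> t0; apply: (dot_inj dot_norm) => z.
by rewrite dotDl !(dotC _ z) -!S_adj// dotDr.
Qed.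

Lemma adjointZ t (c : R) h : 0 <= t -> T t (c *: h) = c *: T t h.
Proof.
move=> t0; apply: (dot_inj dot_norm) => z.
by rewrite dotZl !(dotC _ z) -!S_adj// dotZr.
Qed.

Lemma adjointB t h k : 0 <= t -> T t (h - k) = T t h - T t k.
Proof. by move=> t0; rewrite -scaleN1r adjointD// adjointZ// scaleN1r. Qed.

Lemma adj_semigroup s t h : 0 <= s -> 0 <= t -> T (s + t) h = T s (T t h).
Proof.
move=> s0 t0; apply: (dot_inj dot_norm) => z.
rewrite !(dotC _ z) -!S_adj// ?addr_ge0// addrC.
by have [_ E _ _] := S_semigroup; rewrite E.
Qed.

Lemma adjoint_at0 h : T 0 h = h.
Proof.
apply: (dot_inj dot_norm) => z; rewrite !(dotC _ z) -S_adj//.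
by have [-> _ _ _] := S_semigroup.
Qed.

(** Strong continuity of S at 0 passes to the adjoint semigroup only as weak continuity. *)
Lemma adj_weakly_continuous h y : dot (T t h) y @[t --> 0^'+] --> dot h y.
Proof.
have [_ _ _ S0] := S_semigroup.
have := @dot_cvg _ _ dot dot_norm _ _ _ _ _ h (S0 y).
rewrite (dotC y h) => S1.
have E : \forall t \near 0^'+, dot (S t y) h = dot (T t h) y.
  near=> t; have t0 : 0 < t by near: t; exact: nbhs_right_gt.
  by rewrite (dotC _ y) -S_adj// ltW.
by apply: cvg_trans (S1 _); exact: near_eq_cvg E.
Unshelve. all: by end_near. Qed.

Definition qform h k := dot (Q h) k.
Definition aform h k := dot (Qoo h) k.

Lemma qformC h k : qform h k = qform k h.
Proof. by rewrite /qform Q_ge0.1 dotC. Qed.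
Lemma qformDl h k y : qform (h + k) y = qform h y + qform k y.
Proof. by rewrite /qform linearD dotDl. Qed.
Lemma qformZl (c : R) h k : qform (c *: h) k = c * qform h k.
Proof. by rewrite /qform linearZ dotZl. Qed.
Lemma qform_ge0 h : 0 <= qform h h. Proof. exact: Q_ge0.2. Qed.
Lemma qformDr h k y : qform y (h + k) = qform y h + qform y k.
Proof. by rewrite qformC qformDl !(qformC _ y). Qed.
Lemma qformZr (c : R) h k : qform k (c *: h) = c * qform k h.
Proof. by rewrite qformC qformZl qformC. Qed.

Lemma form_CS (b : H -> H -> R) :
  (forall h k, b h k = b k h) -> (forall h k y, b (h + k) y = b h y + b k y) ->
  (forall (c : R) h k, b (c *: h) k = c * b h k) -> (forall h, 0 <= b h h) ->
  forall h k, b h k ^+ 2 <= b h h * b k k.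
Proof.
move=> bC bD bZ b0 h k; apply: discriminant_le => // t.
have -> : b h h + 2 * t * b h k + t ^+ 2 * b k k = b (h + t *: k) (h + t *: k).
  have bDr x y z : b z (x + y) = b z x + b z y by rewrite bC bD !(bC z).
  have bZr (c : R) x z : b z (c *: x) = c * b z x by rewrite bC bZ (bC z).
  by rewrite !(bD, bDr, bZ, bZr) (bC k h); ring.
exact: b0.
Qed.

Lemma qformE s h k : 0 <= s -> dot (S s (Q (T s h))) k = qform (T s h) (T s k).
Proof. by move=> s0; rewrite S_adj. Qed.

Local Notation leb := (@lebesgue_measure R).

Lemma qform_adj_integrable h k :
  leb.-integrable `[0, +oo[ (fun s => (qform (T s h) (T s k))%:E).
Proof.
have [+ _] := Qoo_int h k; apply: eq_integrable => // s.
by rewrite inE/= in_itv/= andbT => s0; rewrite qformE.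
Qed.

Lemma aformE h k : aform h k = \int[leb]_(s in `[0, +oo[) qform (T s h) (T s k).
Proof.
rewrite /aform; have [_ ->] := Qoo_int h k; apply: eq_Rintegral => s.
by rewrite inE/= in_itv/= andbT => s0; rewrite qformE.
Qed.

Lemma aformC h k : aform h k = aform k h.
Proof. by rewrite !aformE; apply: eq_Rintegral => s _; rewrite qformC. Qed.

Lemma aformDl h k y : aform (h + k) y = aform h y + aform k y.
Proof.
rewrite !aformE -RintegralD//; try exact: qform_adj_integrable.
apply: eq_Rintegral => s; rewrite inE/= in_itv/= andbT => s0.
by rewrite adjointD// qformDl.
Qed.

Lemma aformZl (c : R) h y : aform (c *: h) y = c * aform h y.
Proof.
rewrite !aformE -RintegralZl//; try exact: qform_adj_integrable.
apply: eq_Rintegral => s; rewrite inE/= in_itv/= andbT => s0.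
by rewrite adjointZ// qformZl.
Qed.

Lemma aformDr h k y : aform y (h + k) = aform y h + aform y k.
Proof. by rewrite aformC aformDl !(aformC _ y). Qed.
Lemma aformZr (c : R) h y : aform y (c *: h) = c * aform y h.
Proof. by rewrite aformC aformZl aformC. Qed.

Lemma aform_ge0 h : 0 <= aform h h.
Proof. by rewrite aformE; apply: Rintegral_ge0 => s _; exact: qform_ge0. Qed.

Lemma aform_CS h k : aform h k ^+ 2 <= aform h h * aform k k.
Proof.
apply: (form_CS aformC aformDl aformZl aform_ge0).
Qed.

Let q_measurable (D : set R) h : measurable D -> D `<=` `[0, +oo[ ->
  measurable_fun D (fun s => (qform (T s h) (T s h))%:E).
Proof.
move=> mD D0; have /integrableP[mq _] := qform_adj_integrable h h.
exact: measurable_funS mq.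
Qed.

Let aformE_ereal h : (aform h h)%:E = (\int[leb]_(s in `[0%R, +oo[) (qform (T s h) (T s h))%:E)%E.
Proof.
rewrite aformE /Rintegral fineK//; apply: integrable_fin_num => //.
exact: qform_adj_integrable.
Qed.

(** The integral that defines a(h, h), started at time t instead of 0. *)
Lemma aform_adj_tail t h : 0 <= t ->
  (aform (T t h) (T t h))%:E = (\int[leb]_(s in `[t, +oo[) (qform (T s h) (T s h))%:E)%E.
Proof.
move=> t0; rewrite aformE_ereal.
rewrite [RHS](@ge0_integral_isometry _ (fun s => t + s))//.
- rewrite (_ : _ @^-1` _ = `[0, +oo[%classic); last first.
    by apply/seteqP; split=> x /=; rewrite !in_itv/= !andbT lerDl.
  apply: eq_integral => s; rewrite inE/= in_itv/= andbT => s0.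
  by rewrite addrC adj_semigroup.
- exact: measurable_fun_shift.
- by move=> A; exact: lebesgue_measure_shift.
- apply: q_measurable => // s /=; rewrite !in_itv/= !andbT; exact: le_trans.
- by move=> s _; rewrite lee_fin qform_ge0.
Qed.

(** This is <Q_t h, h>: the difference of the integrals over [0, oo[ and [t, oo[. *)
Lemma qform_adj_integral t h : 0 <= t ->
  (\int[leb]_(s in `[0%R, t]) (qform (T s h) (T s h))%:E)%E =
  (aform h h - aform (T t h) (T t h))%:E.
Proof.
move=> t0; rewrite EFinB aformE_ereal aform_adj_tail//.
have -> : (`[0, +oo[ = `[0%R, t[ `|` `[t, +oo[)%classic.
  apply/seteqP; split=> x /=; rewrite !in_itv/= !andbT; last first.
    by case=> [/andP[]//|]; exact: le_trans.
  by move=> x0; case: (ltP x t) => ?; [left; rewrite x0|right].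
rewrite ge0_integral_setU//=.
- rewrite integral_itv_bndo_bndc; last first.
    by apply: q_measurable => // s /=; rewrite !in_itv/= !andbT => /andP[].
  rewrite addeK// -aform_adj_tail//.
- apply: q_measurable; first exact: measurableU.
  by move=> s /= [|]; rewrite !in_itv/= ?andbT; [case/andP|exact: le_trans].
- by move=> s _; rewrite lee_fin qform_ge0.
- apply/disj_setPS => s /=; rewrite !in_itv/= andbT => -[/andP[_ h1] h2].
  by move: (lt_le_trans h1 h2); rewrite ltxx.
Qed.

Lemma qform_adj_integral_reflect t h : 0 <= t ->
  (\int[leb]_(s in `[0%R, t]) (qform (T (t - s) h) (T (t - s) h))%:E)%E =
  (aform h h - aform (T t h) (T t h))%:E.
Proof.
move=> t0; rewrite -qform_adj_integral//.
rewrite [RHS](@ge0_integral_isometry _ (fun s => t - s))//.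
- rewrite (_ : _ @^-1` _ = `[0, t]%classic)//.
  by apply/seteqP; split=> x /=; rewrite !in_itv/= => /andP[h1 h2]; apply/andP; split; lra.
- exact: measurable_fun_reflect.
- by move=> A; exact: lebesgue_measure_reflect.
- apply: q_measurable => // s /=; rewrite !in_itv/= !andbT; by case/andP.
- by move=> s _; rewrite lee_fin qform_ge0.
Qed.

Lemma aform_adj_le t h : 0 <= t -> aform (T t h) (T t h) <= aform h h.
Proof.
move=> t0; rewrite -subr_ge0 -lee_fin -qform_adj_integral//.
by apply: integral_ge0 => s _; rewrite lee_fin qform_ge0.
Qed.

(** The endpoint 0 is left out because bounds on q(T_s h, T_s h) for small s are only
available for s > 0. *)
Lemma qform_adj_integral_bounds t h (m M : R) : 0 <= t ->
  (forall s, 0 < s <= t -> m <= qform (T s h) (T s h) <= M) ->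
  t * m <= aform h h - aform (T t h) (T t h) <= t * M.
Proof.
move=> t0 mM.
have E : (\int[leb]_(s in `]0%R, t]) (qform (T s h) (T s h))%:E)%E =
  (aform h h - aform (T t h) (T t h))%:E.
  rewrite -qform_adj_integral// integral_itv_obnd_cbnd//.
  by apply: q_measurable => // s /=; rewrite !in_itv/= !andbT => /andP[/ltW].
have C (c : R) : (\int[leb]_(s in `]0%R, t]) c%:E = (t * c)%:E)%E.
  rewrite integral_cst//= lebesgue_measure_itv/= lte_fin.
  have [->|tn0] := eqVneq t 0; first by rewrite ltxx mule0 mul0r.
  by rewrite lt_def tn0 t0/= -EFinB subr0 -EFinM mulrC.
have ii : leb.-integrable `]0%R, t] (fun s => (qform (T s h) (T s h))%:E).
  apply: integrableS (qform_adj_integrable h h) => //.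
  by move=> s /=; rewrite !in_itv/= andbT => /andP[/ltW].
have ic (c : R) : leb.-integrable `]0%R, t] (fun s => c%:E).
  apply/integrableP; split; first exact: measurable_cst.
  by rewrite (eq_integral (fun=> `|c|%:E))// C ltry.
by rewrite -!lee_fin -E -!C; apply/andP; split; apply: le_integral => // s;
  rewrite inE/= in_itv/= lee_fin => /mM/andP[].
Qed.

End adjoint_semigroup.

(** * Decay in the covariance form and decay in the form of Q *)

Section symmetric_adjoint_semigroup.
Context {R : realType} {H : completeNormedModType R} (dot : {dot H for idfun}).
Context (dot_norm : forall x, dot x x = `|x| ^+ 2).
Context (S : R -> {linear H -> H}) (S_semigroup : c0_semigroup S).
Context (T : R -> H -> H) (S_adj : forall t : R, 0 <= t -> adjoint_of dot (S t) (T t)).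
Context (Q : {linear H -> H}) (Q_bounded : continuous Q)
    (Q_ge0 : selfadjoint_nonneg dot Q).
Context (Qoo : H -> H)
    (Qoo_int : op_integral dot `[0, +oo[ (fun s x => S s (Q (T s x))) Qoo).
Implicit Types (s t u : R) (h k x y : H).
Local Notation q := (qform dot Q).
Local Notation a := (aform dot Qoo).

Let aC := aformC S_adj Q_ge0 Qoo_int.
Let aDl := aformDl dot_norm S_adj Qoo_int.
Let aZl := aformZl dot_norm S_adj Qoo_int.
Let aDr := aformDr dot_norm S_adj Q_ge0 Qoo_int.
Let aZr := aformZr dot_norm S_adj Q_ge0 Qoo_int.
Let a0 := aform_ge0 S_adj Q_ge0 Qoo_int.
Let qC := qformC Q_ge0.
Let qDl := qformDl dot Q.
Let qZl := qformZl dot Q.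
Let qDr := qformDr Q_ge0.
Let qZr := qformZr Q_ge0.
Let q0 := qform_ge0 Q_ge0.
Let TD := adjointD dot_norm S_adj.
Let TZ := adjointZ dot_norm S_adj.
Let TT := adj_semigroup dot_norm S_semigroup S_adj.
Let T0 := adjoint_at0 dot_norm S_semigroup S_adj.

Lemma adj_comm s t h : 0 <= s -> 0 <= t -> T s (T t h) = T t (T s h).
Proof. by move=> s0 t0; rewrite -!TT// addrC. Qed.

(** Otherwise there are u_n tending to 0 with q(T_{u_n} h, T_{u_n} h) unbounded; but
the operators S(u_n) are bounded uniformly in n by the Banach-Steinhaus theorem,
and so are their adjoints. *)
Lemma qform_adj_locally_bounded h : exists2 d : R, 0 < d &
  exists M : R, forall u, 0 < u <= d -> q (T u h) (T u h) <= M.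
Proof.
apply: contrapT => nb.
have ex (n : nat) : exists u, (0 < u <= n.+1%:R^-1) /\ n%:R < q (T u h) (T u h).
  apply: contrapT => nu; apply: nb; exists n.+1%:R^-1; first by rewrite invr_gt0.
  exists n%:R => u u0; rewrite leNgt; apply/negP => qu; apply: nu; exists u; split => //.
have [u uP] := choice ex.
have u0 n : 0 < u n by have [/andP[]] := uP n.
have ucvg : u n @[n --> \oo] --> 0^'+.
  have u1 : u n @[n --> \oo] --> (0:R).
    apply: (@squeeze_cvgr _ _ _ _ (fun=> 0) (fun n => n.+1%:R^-1)).
    - by apply: nearW => n; have [/andP[/ltW -> ->]] := uP n.
    - exact: cvg_cst.
    - exact: cvg_harmonic.
  move=> A [e /= e0 eA]; move/cvgrPdist_lt : u1 => /(_ e e0) u1.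
  by rewrite nbhs_simpl /=; apply: filterS u1 => n un; apply: eA => //=; exact: u0.
pose F := range (fun n : nat => S (u n) : H -> H).
have [_ _ Sc S0] := S_semigroup.
have BS : uniform_bounded F.
  apply: Banach_Steinhauss.
    move=> _ [n _ <-]; split; last exact: linearP.
    apply/bounded_funP; apply/linear_bounded_continuous; apply: Sc; exact: ltW.
  move=> x.
  have c1 : S (u n) x @[n --> \oo] --> x := cvg_comp u (S^~ x) ucvg (S0 x).
  have cc : cvgn (fun n => S (u n) x) by apply/cvg_ex; exists x.
  have [M [_ MP]] := cvg_seq_bounded cc.
  exists (M + 1) => _ [n _ <-]; apply: MP => //; by rewrite ltrDl.
have [M MP] := BS 1.
have [C C0 QC] := continuous_linear_bound Q_bounded.
pose K := Num.max M 0.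
have SK n x : `|S (u n) x| <= K * `|x|.
  have [->|x0] := eqVneq x 0; first by rewrite linear0 !normr0 mulr0.
  have x0' : 0 < `|x| by rewrite normr_gt0.
  have := MP _ (ex_intro2 _ _ n I erefl) (`|x|^-1 *: x).
  rewrite normrZ normfV normr_id mulVf ?gt_eqF// => /(_ (lexx _)).
  rewrite linearZ normrZ normfV normr_id ler_pdivrMl// mulrC => h1.
  by apply: le_trans h1 _; rewrite ler_wpM2r// le_max lexx.
have K0 : 0 <= K by rewrite le_max lexx orbT.
have TK n : `|T (u n) h| <= K * `|h|.
  have [->|x0] := eqVneq (T (u n) h) 0; first by rewrite normr0 mulr_ge0.
  have x0' : 0 < `|T (u n) h| by rewrite normr_gt0.
  rewrite -(ler_pM2r x0') -expr2 -dot_norm -(S_adj (ltW (u0 n))).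
  apply: le_trans (ler_norm _) _; apply: le_trans (dot_CS dot_norm _ _) _.
  by rewrite mulrAC ler_wpM2r.
have qK n : q (T (u n) h) (T (u n) h) <= C * (K * `|h|) ^+ 2.
  rewrite /qform; apply: le_trans (ler_norm _) _; apply: le_trans (dot_CS dot_norm _ _) _.
  apply: (@le_trans _ _ (C * `|T (u n) h| * `|T (u n) h|)); first by rewrite ler_wpM2r.
  rewrite -mulrA ler_wpM2l// -expr2 lerXn2r ?nnegrE// mulr_ge0//.
pose N := (Num.truncn (C * (K * `|h|) ^+ 2)).+1.
have := qK N; have [_ h1] := uP N; have := truncnS_gt (C * (K * `|h|) ^+ 2).
rewrite -/N => h2 h3; have := lt_le_trans (lt_trans h2 h1) h3.
by rewrite ltxx.
Qed.

Hypothesis aT : forall t h k, 0 <= t -> a (T t h) k = a h (T t k).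

(** The form of Q_t = Q_oo - S(t) Q_oo S(t)^*, the covariance of Z(t, x). *)
Definition vform t h k := a h k - a (T t h) (T t k).

Lemma vformC t h k : vform t h k = vform t k h.
Proof. by rewrite /vform aC (aC (T t h)). Qed.
Lemma vformDl t h k y : 0 <= t -> vform t (h + k) y = vform t h y + vform t k y.
Proof. by move=> t0; rewrite /vform TD// !aDl; ring. Qed.
Lemma vformZl t (c : R) h y : 0 <= t -> vform t (c *: h) y = c * vform t h y.
Proof. by move=> t0; rewrite /vform TZ// !aZl; ring. Qed.
Lemma vformDr t h k y : 0 <= t -> vform t y (h + k) = vform t y h + vform t y k.
Proof. by move=> t0; rewrite vformC vformDl// !(vformC t y). Qed.
Lemma vformZr t (c : R) h y : 0 <= t -> vform t y (c *: h) = c * vform t y h.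
Proof. by move=> t0; rewrite vformC vformZl// vformC. Qed.
Lemma vform_ge0 t h : 0 <= t -> 0 <= vform t h h.
Proof.
by move=> t0; rewrite subr_ge0; apply: (aform_adj_le dot_norm S_semigroup S_adj Q_ge0 Qoo_int).
Qed.

Lemma vform_adj t s h k : 0 <= t -> 0 <= s -> vform t (T s h) k = vform t h (T s k).
Proof. by move=> t0 s0; rewrite /vform aT// adj_comm// aT// adj_comm. Qed.

(** By symmetry the semigroup can be moved to one side, which turns the diagonal values
of the form into a function of 2 s with a doubling inequality. *)
Lemma vform_adj2 t s h : 0 <= t -> 0 <= s ->
  vform t (T s h) (T s h) = vform t (T (2 * s) h) h.
Proof.
move=> t0 s0; by rewrite -vform_adj// -TT//; have -> : s + s = 2 * s by ring.
Qed.

(** The function r |-> <Q_t T_r h, h> is nonnegative and satisfies the doubling inequality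
by Cauchy-Schwarz for Q_t. The crude bound Q_t <= Q_oo gives it the decay of a, and
[doubling_decay] improves the constant to <Q_t h, h>. *)
Lemma vform_decay t h (g C : R) : 0 <= t ->
  (forall s, 0 <= s -> a (T s h) (T s h) <= C * expR (- (2 * g * s))) ->
  forall s, 0 <= s -> vform t (T s h) (T s h) <= expR (- (2 * g * s)) * vform t h h.
Proof.
move=> t0 aC' s s0.
have half r : 0 <= r -> vform t (T r h) h = vform t (T (r / 2) h) (T (r / 2) h).
  move=> r0; rewrite vform_adj2 ?divr_ge0//.
  by have -> : 2 * (r / 2) = r by field.
rewrite vform_adj2//; have -> : 2 * g * s = g * (2 * s) by ring.
have := @doubling_decay _ (fun r => vform t (T r h) h) C g _ _ _ (2 * s).
rewrite T0; apply => //.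
- by move=> r r0; rewrite half// vform_ge0.
- move=> r r0; rewrite -vform_adj2// mulrC.
  apply: (form_CS (b := vform t)) => //.
  + exact: vformC.
  + by move=> *; exact: vformDl.
  + by move=> *; exact: vformZl.
  + by move=> *; exact: vform_ge0.
- move=> r r0; rewrite half//.
  have r2 : 0 <= r / 2 by rewrite divr_ge0.
  have := aC' _ r2; have -> : 2 * g * (r / 2) = g * r by field.
  by apply: le_trans; rewrite /vform gerBl.
- by rewrite mulr_ge0.
Qed.

Lemma vform_adj_le t s h : 0 <= t -> 0 <= s -> vform t (T s h) (T s h) <= vform t h h.
Proof.
move=> t0 s0; have := @vform_decay t h 0 (a h h) t0 _ s s0.
rewrite mulr0 mul0r oppr0 expR0 mul1r; apply => r r0.
rewrite mul0r oppr0 expR0 mulr1.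
exact: (aform_adj_le dot_norm S_semigroup S_adj Q_ge0 Qoo_int).
Qed.

(** By symmetry the right-hand side exceeds the left-hand side by a(T_t h - h, T_t h - h). *)
Lemma vform_half t h : 0 <= t -> vform t h h <= 2 * vform (t / 2) h h.
Proof.
move=> t0; have t2 : 0 <= t / 2 by rewrite divr_ge0.
have := a0 (T t h - h).
rewrite -scaleN1r !(aDl, aDr, aZl, aZr) (aC h (T t h)) /vform.
have -> : a (T (t / 2) h) (T (t / 2) h) = a (T t h) h.
  by rewrite -aT// -TT//; have -> : t / 2 + t / 2 = t by field.
set x := a h h; set y := a (T t h) h; set z := a (T t h) (T t h) => *; lra.
Qed.

(** Difference quotients at dyadic times: they increase by [vform_half], which is how their
limit is controlled before it is known to be q(h, h). *)
Definition dyadic_form (n : nat) h := 2 ^+ n * vform ((1/2) ^+ n) h h.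

Let half_ge0 n : 0 <= (1/2 : R) ^+ n. Proof. by rewrite exprn_ge0// divr_ge0. Qed.
Let half_gt0 n : 0 < (1/2 : R) ^+ n. Proof. by rewrite exprn_gt0// divr_gt0. Qed.
Let two_half n : 2 ^+ n * (1/2 : R) ^+ n = 1.
Proof. by rewrite -exprMn (_ : 2 * (1/2) = 1 :> R) ?expr1n//; field. Qed.

Lemma dyadic_form_nondecreasing h : {homo (dyadic_form ^~ h) : n m / (n <= m)%N >-> n <= m}.
Proof.
apply: homo_leq => [//|x y z|n]; first exact: le_trans.
rewrite /dyadic_form exprSr -mulrA ler_pM2l ?exprn_gt0//.
have := @vform_half ((1/2) ^+ n) h (half_ge0 n).
by rewrite (_ : (1/2) ^+ n / 2 = (1/2) ^+ n.+1)//; rewrite exprSr; field.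
Qed.

Lemma half_small (e : R) : 0 < e -> exists N : nat, forall n, (N <= n)%N -> (1/2) ^+ n <= e.
Proof.
move=> e0.
have : (1/2 : R) ^+ n @[n --> \oo] --> 0.
  by apply: cvg_expr; rewrite ger0_norm; lra.
move=> /cvgr0_norm_le /(_ e e0)[N _ NP]; exists N => n Nn.
by have := NP n Nn; rewrite ger0_norm.
Qed.

Lemma dyadic_form_bounded h : exists M : R, forall n, dyadic_form n h <= M.
Proof.
have [d d0 [M MP]] := qform_adj_locally_bounded h.
have [N NP] := half_small d0; exists M => n.
apply: (le_trans (dyadic_form_nondecreasing h (leq_addr N n))).
set m := (n + N)%N.
have mN : (1/2) ^+ m <= d by apply: NP; exact: leq_addl.
have hb s : 0 < s <= (1/2) ^+ m -> 0 <= q (T s h) (T s h) <= M.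
  by move=> /andP[s0 sm]; rewrite q0 MP// s0; exact: le_trans mN.
have /andP[_] := qform_adj_integral_bounds dot_norm S_semigroup S_adj Q_ge0 Qoo_int (half_ge0 m) hb.
rewrite /dyadic_form /vform => b.
have -> : M = 2 ^+ m * ((1/2) ^+ m * M) by rewrite mulrA two_half mul1r.
by rewrite ler_pM2l ?exprn_gt0.
Qed.

(** Moving the semigroup to one side leaves scalar products with fixed vectors, for
which weak continuity is enough. *)
Lemma vform_adj_rcontinuous t h : 0 <= t ->
  vform t (T u h) (T u h) @[u --> 0^'+] --> vform t h h.
Proof.
move=> t0.
have c2 : (2 * u) @[u --> 0^'+] --> (0:R)^'+.
  move=> A [e /= e0 eA]; exists (e / 2) => /=; first by rewrite divr_gt0.
  move=> u /=; rewrite sub0r normrN => ue u0; apply: eA => /=; last by rewrite mulr_gt0.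
  by rewrite sub0r normrN normrM ger0_norm//; lra.
have c y k : dot (T (2 * u) y) k @[u --> 0^'+] --> dot y k.
  have w : dot (T u y) k @[u --> 0^'+] --> dot y k.
    exact: (adj_weakly_continuous dot_norm S_semigroup S_adj).
  exact: (cvg_comp (fun u => 2 * u) (fun u => dot (T u y) k) c2 w).
have E : \forall u \near 0^'+, dot (T (2 * u) h) (Qoo h) - dot (T (2 * u) (T t h)) (Qoo (T t h)) =
    vform t (T u h) (T u h).
  near=> u; have u0 : 0 < u by near: u; exact: nbhs_right_gt.
  rewrite vform_adj2 ?(ltW u0)// /vform.
  rewrite (aC _ h) (aC _ (T t h)) /aform !(dotC dot (Qoo _)).
  by rewrite (adj_comm _ t0)// mulr_ge0// ltW.
apply: cvg_trans (near_eq_cvg E) _.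
rewrite /vform {1}/aform {1}/aform !(dotC dot (Qoo _)).
by apply: cvgB; exact: c.
Unshelve. all: by end_near. Qed.

Lemma near_right0 (P : R -> Prop) :
  (\forall u \near 0^'+, P u) -> exists2 d : R, 0 < d & forall u, 0 < u <= d -> P u.
Proof.
move=> [e /= e0 eP]; exists (e / 2); first by rewrite divr_gt0.
move=> u /andP[u0 ue]; apply: eP => //=.
by rewrite sub0r normrN ger0_norm ?ltW//; lra.
Qed.

(** Weak lower semicontinuity of a nonnegative form, from q(T_u k - k, T_u k - k) >= 0. *)
Lemma qform_adj_liminf k (e : R) : 0 < e ->
  exists2 d : R, 0 < d & forall u, 0 < u <= d -> q k k - e <= q (T u k) (T u k).
Proof.
move=> e0.
have c : dot (T u k) (Q k) @[u --> 0^'+] --> dot k (Q k).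
  exact: (adj_weakly_continuous dot_norm S_semigroup S_adj).
have /cvgrPdist_le /(_ (e / 2)) := c.
rewrite divr_gt0// => /(_ isT) /near_right0[d d0 dP]; exists d => // u ud.
have := dP u ud.
have -> : dot k (Q k) = q k k by rewrite /qform (dotC dot).
have -> : dot (T u k) (Q k) = q (T u k) k by rewrite qC /qform (dotC dot).
have := q0 (T u k - k).
rewrite -scaleN1r !(qDl, qDr, qZl, qZr) (qC k (T u k)).
set x := q (T u k) (T u k); set y := q (T u k) k; set z := q k k.
rewrite ler_norml => h1 /andP[h2 h3]; lra.
Qed.

Lemma vform_liminf k (e : R) : 0 < e ->
  exists2 d : R, 0 < d & forall t, 0 < t <= d -> t * (q k k - e) <= vform t k k.
Proof.
move=> e0; have [d d0 dP] := qform_adj_liminf k e0.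
have [d' d'0 [M MP]] := qform_adj_locally_bounded k.
exists (Num.min d d'); first by rewrite lt_min d0.
move=> t /andP[t0]; rewrite le_min => /andP[td td'].
have hb s : 0 < s <= t -> q k k - e <= q (T s k) (T s k) <= M.
  move=> /andP[s0 st]; apply/andP; split; first by apply: dP; rewrite s0 (le_trans st).
  by apply: MP; rewrite s0 (le_trans st).
by have /andP[] := qform_adj_integral_bounds dot_norm S_semigroup S_adj Q_ge0 Qoo_int (ltW t0) hb.
Qed.

(** The liminf of the difference quotients is at least q(k, k) by [vform_liminf]. *)
Lemma qform_le_dyadic_form k (B : R) (N : nat) : (forall n, (N <= n)%N -> dyadic_form n k <= B) -> q k k <= B.
Proof.
move=> kB; apply/ler_addgt0Pr => e e0.
have [d d0 dP] := vform_liminf k e0.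
have [M MP] := half_small d0.
have := dP ((1/2) ^+ (N + M)); rewrite half_gt0 MP ?leq_addl// => /(_ isT) h1.
have := kB _ (leq_addr M N); rewrite /dyadic_form.
have h2 : 2 ^+ (N + M) * ((1/2) ^+ (N + M) * (q k k - e)) <= 2 ^+ (N + M) * vform ((1/2) ^+ (N + M)) k k.
  by rewrite ler_pM2l ?exprn_gt0.
rewrite mulrA two_half [leLHS]mul1r in h2.
by move=> h3; rewrite -lerBlDr; exact: (le_trans h2 h3).
Qed.

(** Strong continuity of T in the form q, for which weak continuity does not suffice.
For the dyadic form d_n, symmetry and contractivity give
d_n(h - T_u h) <= d_n(h) - d_n(T_u h). As n grows d_n(h) increases to a supremum;
fixing N with d_N(h) within e/2 of it, d_n(T_u h) >= d_N(T_u h) and the right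
continuity of d_N(T_u h) at u = 0 bound d_n(h - T_u h) by e for small u and all n >= N. *)
Lemma qform_adjB_small h (e : R) : 0 < e ->
  exists2 d : R, 0 < d & forall u, 0 < u <= d -> q (h - T u h) (h - T u h) <= e.
Proof.
move=> e0; have [M MP] := dyadic_form_bounded h.
pose E := range (dyadic_form ^~ h).
have hsE : has_sup E.
  by split; [exists (dyadic_form 0 h); exists 0%N|exists M => _ [n _ <-]].
have e2 : 0 < e / 2 by rewrite divr_gt0.
have [_ [N _ <-] NL] := sup_adherent e2 hsE.
have c := @vform_adj_rcontinuous ((1/2) ^+ N) h (half_ge0 N).
pose e3 := e / 2 * (1/2) ^+ N.
have /cvgrPdist_le /(_ e3) := c.
rewrite mulr_gt0// => /(_ isT) /near_right0[d d0 dP].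
exists d => // u ud.
have u0 : 0 < u by case/andP: ud.
apply: (@qform_le_dyadic_form _ _ N) => n Nn.
have hd : dyadic_form n h <= sup E.
  by apply: ub_le_sup; [exact: hsE.2|exists n].
have hN : dyadic_form N h - e / 2 <= dyadic_form N (T u h).
  have := dP u ud; rewrite ler_norml => /andP[_ h1].
  have h2 : 2 ^+ N * (vform ((1/2) ^+ N) h h - vform ((1/2) ^+ N) (T u h) (T u h)) <= 2 ^+ N * e3.
    by rewrite ler_pM2l// exprn_gt0.
  move: h2; rewrite mulrBr /e3 mulrCA two_half mulr1 -/(dyadic_form N h) -/(dyadic_form N (T u h)) => h2.
  lra.
have hn : dyadic_form N (T u h) <= dyadic_form n (T u h) by exact: dyadic_form_nondecreasing.
have u2 : 0 <= u / 2 by rewrite divr_ge0// ltW.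
have X : dyadic_form n (h - T u h) <= dyadic_form n h - dyadic_form n (T u h).
  rewrite /dyadic_form -mulrBr ler_pM2l ?exprn_gt0//.
  set t := (1/2) ^+ n; have t0 : 0 <= t by exact: half_ge0.
  rewrite -scaleN1r !(vformDl, vformDr, vformZl, vformZr)// (vformC t h (T u h)).
  have -> : vform t (T u h) h = vform t (T (u / 2) h) (T (u / 2) h).
    by rewrite vform_adj2//; have -> : 2 * (u / 2) = u by field.
  have h1 : vform t (T u h) (T u h) <= vform t (T (u / 2) h) (T (u / 2) h).
    have := @vform_adj_le t (u / 2) (T (u / 2) h) t0 u2.
    by rewrite -TT//; have -> : u / 2 + u / 2 = u by field.
  move: h1; set x := vform t h h; set y := vform t (T u h) (T u h); set z := vform _ _ _.
  move=> h1; lra.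
apply: (le_trans X); rewrite ltrBlDr in NL; lra.
Qed.

Lemma qform_adj_limsup h (e : R) : 0 < e ->
  exists2 d : R, 0 < d & forall u, 0 < u <= d -> q (T u h) (T u h) <= q h h + e.
Proof.
move=> e0.
(* q(h - z) <= (1 + r) q(h) + (1 + 1/r) q(z), with r so small that r q(h) <= e/2. *)
pose r := e / (2 * (q h h + 1)).
have q1 : 0 < q h h + 1 by rewrite ltr_wpDl.
have r0 : 0 < r by rewrite divr_gt0// mulr_gt0.
have rh : r * q h h <= e / 2.
  rewrite /r mulrAC ler_pdivrMr ?mulr_gt0//.
  have -> : e / 2 * (2 * (q h h + 1)) = e * (q h h + 1) by field.
  by rewrite ler_pM2l// lerDl.
pose e1 := (e / 2) / (1 + r^-1).
have r1 : 0 < 1 + r^-1 by rewrite addr_gt0// invr_gt0.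
have e10 : 0 < e1 by rewrite divr_gt0// divr_gt0.
have [d d0 dP] := qform_adjB_small h e10; exists d => // u ud.
have hz := dP u ud; have [z zE] : exists z, z = h - T u h by eexists.
rewrite -zE in hz; have -> : T u h = h - z by rewrite zE subKr.
have hz2 : (1 + r^-1) * q z z <= e / 2.
  by rewrite mulrC -ler_pdivlMr.
have rn0 : r != 0 by exact: lt0r_neq0.
have := q0 (r *: h + z).
rewrite -scaleN1r !(qDl, qDr, qZl, qZr) (qC z h) => h1.
have h2 : 0 <= r * q h h + 2 * q h z + r^-1 * q z z.
  have -> : r * q h h + 2 * q h z + r^-1 * q z z =
    r^-1 * (r * (r * q h h) + q h z * 0 + r * q h z + (r * q h z + q z z)) by field.
  by rewrite mulr_ge0 ?invr_ge0 ?(ltW r0)//; move: h1; set A := q h z; set B := q h h; set C := q z z; lra.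
move: rh hz2 h2; set A := q h z; set B := q h h; set C := q z z.
move=> rh; rewrite mulrDl mul1r => hz2 h2; lra.
Qed.

Lemma vform_limsup h (e : R) : 0 < e ->
  exists2 d : R, 0 < d & forall t, 0 < t <= d -> vform t h h <= t * (q h h + e).
Proof.
move=> e0; have [d d0 dP] := qform_adj_limsup h e0; exists d => // t /andP[t0 td].
have hb s : 0 < s <= t -> 0 <= q (T s h) (T s h) <= q h h + e.
  by move=> /andP[s0 st]; rewrite q0 dP// s0 (le_trans st).
by have /andP[] := qform_adj_integral_bounds dot_norm S_semigroup S_adj Q_ge0 Qoo_int (ltW t0) hb.
Qed.

(** The derivative of Q_t at t = 0 is Q, in the sense of forms. The diagonal values are
squeezed by [vform_liminf] and [vform_limsup]; polarization gives the others. *)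
Lemma vform_cvg h k (e : R) : 0 < e ->
  exists2 d : R, 0 < d & forall t, 0 < t <= d -> `|vform t h k - t * q h k| <= t * e.
Proof.
move=> e0.
have [d1 d10 P1] := vform_liminf (h + k) e0.
have [d2 d20 P2] := vform_limsup (h + k) e0.
have [d3 d30 P3] := vform_liminf (h - k) e0.
have [d4 d40 P4] := vform_limsup (h - k) e0.
exists (Num.min (Num.min d1 d2) (Num.min d3 d4)); first by rewrite !lt_min d10 d20 d30.
move=> t /andP[t0]; rewrite !le_min => /andP[/andP[t1 t2] /andP[t3 t4]].
have tW := ltW t0.
have := P1 t; have := P2 t; have := P3 t; have := P4 t.
rewrite t0 t1 t2 t3 t4 => /(_ isT) h4 /(_ isT) h3 /(_ isT) h2 /(_ isT) h1.
move: h1 h2 h3 h4.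
rewrite -(scaleN1r k) !(vformDl, vformDr, vformZl, vformZr)// !(qDl, qDr, qZl, qZr).
rewrite (vformC t k h) (qC k h).
set A := vform t h h; set B := vform t h k; set C := vform t k k.
set A' := q h h; set B' := q h k; set C' := q k k.
have te : 0 <= t * e by rewrite mulr_ge0// ltW.
move=> h1 h2 h3 h4; rewrite ler_norml; apply/andP; split; lra.
Qed.

Lemma qform_decay (c : R) s h : 0 <= s ->
  (forall t, 0 <= t -> vform t (T s h) (T s h) <= c * vform t h h) ->
  q (T s h) (T s h) <= c * q h h.
Proof.
move=> s0 hc; apply/ler_addgt0Pr => e e0.
have e1 : 0 < e / (1 + `|c|) by rewrite divr_gt0// ltr_pwDl.
have [d1 d10 P1] := vform_cvg (T s h) (T s h) e1.
have [d2 d20 P2] := vform_cvg h h e1.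
pose t := Num.min d1 d2.
have t0 : 0 < t by rewrite lt_min d10.
have := P1 t; rewrite t0 ge_min lexx => /(_ isT); rewrite ler_norml => /andP[h1 _].
have := P2 t; rewrite t0 ge_min lexx orbT => /(_ isT) h2.
have h3 := hc t (ltW t0).
rewrite -(ler_pM2l t0).
have h4 : c * vform t h h <= c * (t * q h h) + `|c| * (t * (e / (1 + `|c|))).
  rewrite -lerBlDl -mulrBr (le_trans (ler_norm _))// normrM ler_wpM2l//.
have h5 : t * e = t * (e / (1 + `|c|)) + `|c| * (t * (e / (1 + `|c|))).
  by field; rewrite gt_eqF// ltr_pwDl.
rewrite mulrDr h5 mulrCA.
move: h1 h3 h4; set A := vform _ _ _; set B := q _ _; set C := vform _ _ _; set D := q _ _ => *.
lra.
Qed.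

(** Symmetry for the forms of Q_t, divided by t, as t tends to 0. *)
Lemma qform_adj_sym s h k : 0 <= s -> q (T s h) k = q h (T s k).
Proof.
move=> s0; apply/eqP; rewrite -subr_eq0 -normr_le0; apply/ler_addgt0Pr => e e0; rewrite add0r.
have e1 : 0 < e / 2 by rewrite divr_gt0.
have [d1 d10 P1] := vform_cvg (T s h) k e1.
have [d2 d20 P2] := vform_cvg h (T s k) e1.
pose t := Num.min d1 d2.
have t0 : 0 < t by rewrite lt_min d10.
have := P1 t; rewrite t0 ge_min lexx => /(_ isT) h1.
have := P2 t; rewrite t0 ge_min lexx orbT => /(_ isT) h2.
rewrite -(ler_pM2l t0) -{1}(ger0_norm (ltW t0)) -normrM mulrBr.
move: h1 h2; rewrite (vform_adj _ _ (ltW t0) s0) !ler_norml.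
set A := vform _ _ _; set B := q _ _; set C := q _ _ => /andP[? ?] /andP[? ?].
apply/andP; split; lra.
Qed.

(** From a to q, decay passes to the forms of Q_t by [vform_decay] and then to q by
differentiation at t = 0. From q to a it is integrated, a(h, h) being the integral of
q(T_s h, T_s h) and T_s commuting with T_t. *)
Lemma aform_qform_decay (b : R) :
  (forall t h, 0 <= t -> a (T t h) (T t h) <= expR (- (2 * b * t)) * a h h) <->
  (forall t h, 0 <= t -> q (T t h) (T t h) <= expR (- (2 * b * t)) * q h h).
Proof.
split=> D t h t0.
  apply: qform_decay => // r r0.
  apply: (@vform_decay r h b (a h h)) => // s s0.
  by rewrite mulrC D.
have qi y := qform_adj_integrable S_adj Qoo_int y y.
rewrite !(aformE S_adj Qoo_int) -(RintegralZl _ _ (qi h))//.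
apply: le_Rintegral => //.
- exact: (qi (T t h)).
- have : (@lebesgue_measure R).-integrable `[0, +oo[ (fun s =>
      ((expR (- (2 * b * t)))%:E * (q (T s h) (T s h))%:E)%E).
    by apply: integrableZl => //; exact: qi.
  exact.
- move=> s /=; rewrite in_itv/= andbT => s0.
  by rewrite adj_comm// D.
Qed.

(** The rate b = 0, which holds for a because Q_t >= 0. *)
Lemma qform_adj_le t h : 0 <= t -> q (T t h) (T t h) <= q h h.
Proof.
move=> t0.
have [D _] := aform_qform_decay 0.
have := D _ t h t0; rewrite mulr0 mul0r oppr0 expR0 mul1r; apply => s k s0.
rewrite mul0r oppr0 expR0 mul1r.
exact: (aform_adj_le dot_norm S_semigroup S_adj Q_ge0 Qoo_int).
Qed.

End symmetric_adjoint_semigroup.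

(** * Operators with dense range and their conjugates *)

Section completeness.
Context {R : realType} {H : completeNormedModType R}.

Lemma cvg_of_cauchy_sqr (g : nat -> H) :
  (forall e : R, 0 < e -> exists N : nat, forall n, (N <= n)%N -> `|g n - g N| ^+ 2 <= e) ->
  cvgn g.
Proof.
move=> hg.
suff : cauchy (g @ \oo) by exact: cauchy_cvg.
suff : cauchy_ex (g @ \oo) by exact: cauchy_exP.
move=> e e0; have e2 : 0 < (e / 2) ^+ 2 by rewrite exprn_gt0// divr_gt0.
have [N NP] := hg _ e2; exists (g N); exists N => // n Nn.
rewrite -ball_normE /= distrC; apply: (@le_lt_trans _ _ (e / 2)).
  have := NP n Nn; by rewrite ler_pXn2r// ?nnegrE// divr_ge0// (ltW e0).
by rewrite ltr_pdivrMr// ltr_pMr// ltr1n.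
Qed.

End completeness.

Section dense_range.
Context {R : realType} {H : completeNormedModType R} (dot : {dot H for idfun}).
Context (dot_norm : forall x, dot x x = `|x| ^+ 2).
Context (K : {linear H -> H}) (K_bounded : continuous K)
  (K_ge0 : selfadjoint_nonneg dot K) (K_inj : forall x, K x = 0 -> x = 0).
Implicit Types x y h : H.

(** For small l > 0 the operator B = 1 - l K satisfies |B x|^2 + l <K x, x> <= |x|^2. The
iterates B^(2n) h converge, since their mutual scalar products are values of the
nonincreasing sequence |B^n h|^2, to a fixed point of B^2, which is killed by K and so
is zero. As h - B^(2n) h lies in the range of K, so h is a limit of such points. *)
Lemma range_dense h : exists k : nat -> H, K (k n) @[n --> \oo] --> h.
Proof.
have [C C0 KC] := continuous_linear_bound K_bounded.
pose l : R := (C + 1)^-1.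
have l0 : 0 < l by rewrite invr_gt0 ltr_wpDl.
have lC : l * C <= 1 by rewrite /l mulrC ler_pdivrMr ?mul1r ?lerDl// ltr_wpDl.
have Ksym x y : dot (K x) y = dot x (K y) := K_ge0.1 x y.
have Kpos x : 0 <= dot (K x) x := K_ge0.2 x.
have Ksq x : l * `|K x| ^+ 2 <= dot (K x) x.
  have [->|Kx0] := eqVneq (K x) 0.
    by rewrite normr0 expr0n/= mulr0 (dot0l dot).
  have n0 : 0 < `|K x| ^+ 2 by rewrite exprn_gt0// normr_gt0.
  rewrite -(ler_pM2r n0) -mulrA -expr2.
  have cs : (`|K x| ^+ 2) ^+ 2 <= dot (K x) x * dot (K (K x)) (K x).
    rewrite -dot_norm.
    apply: (form_CS (b := fun x y => dot (K x) y) _ _ _ _ x (K x)).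
    - by move=> y z; rewrite Ksym (dotC dot).
    - by move=> y z w; rewrite linearD (dotDl dot).
    - by move=> c y z; rewrite linearZ (dotZl dot).
    - exact: Kpos.
  apply: (@le_trans _ _ (l * (dot (K x) x * dot (K (K x)) (K x)))).
    by rewrite ler_pM2l.
  rewrite mulrCA ler_wpM2l//.
  have h1 : dot (K (K x)) (K x) <= C * `|K x| ^+ 2.
    apply: le_trans (ler_norm _) _; apply: le_trans (dot_CS dot_norm _ _) _.
    by rewrite expr2 mulrA ler_wpM2r.
  apply: (@le_trans _ _ (l * (C * `|K x| ^+ 2))); first by rewrite ler_pM2l.
  by rewrite mulrA ler_piMl// ltW.
pose B x := x - l *: K x.
have Bsym x y : dot (B x) y = dot x (B y).
  by rewrite /B (dotBl dot) (dotBr dot) (dotZl dot) (dotZr dot) Ksym.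
have Bnorm x : `|B x| ^+ 2 + l * dot (K x) x <= `|x| ^+ 2.
  rewrite -!dot_norm /B !(dotBl dot, dotBr dot, dotZl dot, dotZr dot).
  rewrite -(Ksym x x) [dot (K x) (K x)]dot_norm.
  have h1 := Ksq x.
  have : l * (l * `|K x| ^+ 2) <= l * dot (K x) x by rewrite ler_pM2l.
  rewrite dot_norm; set A := dot _ _; set D := `|K x| ^+ 2; set E := `|x| ^+ 2; lra.
have Bdec x : `|B x| ^+ 2 <= `|x| ^+ 2.
  by apply: le_trans (Bnorm x); rewrite lerDl mulr_ge0// ltW.
(* Only even iterates are taken: <B^(2n) h, B^(2m) h> = |B^(n+m) h|^2. *)
pose D x := B (B x).
pose g n := iter n D h.
have Dsym n x y : dot (iter n D x) y = dot x (iter n D y).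
  by elim: n x y => // n IH x y; rewrite iterS /D !Bsym IH -iterSr.
pose e n := `|iter n B h| ^+ 2.
have gE n : g n = iter (n + n) B h.
  by elim: n => // n IH; rewrite /g iterS -/(g n) IH /D addnS addSn !iterS.
have gdot n m : dot (g n) (g m) = e (n + m)%N.
  rewrite !gE /e -dot_norm.
  have Bit k x y : dot (iter k B x) y = dot x (iter k B y).
    by elim: k x y => // k IH x y; rewrite iterS Bsym IH -iterSr.
  rewrite !Bit -!iterD; congr (dot h (iter _ B h)).
  by rewrite addnACA addnA.
have edec n m : (n <= m)%N -> e m <= e n.
  move=> /subnK <-; elim: (m - n)%N => // k IH.
  by apply: le_trans IH; rewrite addSn /e iterS; exact: Bdec.
have gc : cvgn g.
  apply: cvg_of_cauchy_sqr => t t0.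
  pose E := range e.
  have E0 : has_inf E.
    split; first by exists (e 0%N); exists 0%N.
    by exists 0 => _ [n _ <-]; rewrite /e sqr_ge0.
  have t2 : 0 < t / 2 by rewrite divr_gt0.
  have [_ [N _ <-] NL] := inf_adherent t2 E0.
  exists N => n Nn.
  rewrite -dot_norm !(dotBl dot, dotBr dot) !gdot.
  have il m : inf E <= e m by apply: ge_inf; [exact: E0.2|exists m].
  have h1 := edec N (n + n)%N (leq_trans Nn (leq_addl _ _)).
  have h2 := edec N (N + N)%N (leq_addl _ _).
  have h3 := il (n + N)%N; have h4 := il (N + n)%N.
  lra.
have /cvg_ex[g0 gg] := gc.
have Kc := K_bounded.
have Bc x : B y @[y --> x] --> B x.
  apply: cvgB; first exact: cvg_id.
  by apply: cvgZl_tmp => //; exact: Kc.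
have Dg : D g0 = g0.
  have c1 : D (g n) @[n --> \oo] --> D g0.
    have c0 : B (g n) @[n --> \oo] --> B g0 := cvg_comp g B gg (Bc g0).
    exact: cvg_comp c0 (Bc _).
  have c2 : D (g n) @[n --> \oo] --> g0.
    have := gg; rewrite -(@cvg_shiftS _ g); exact.
  exact: (cvg_unique _ c1 c2).
have g00 : g0 = 0.
  have h1 : `|B g0| ^+ 2 = `|g0| ^+ 2 by rewrite -!dot_norm Bsym -/(D g0) Dg.
  have := Bnorm g0; rewrite h1 gerDl => h2.
  have h3 : dot (K g0) g0 <= 0 by rewrite -(pmulr_rle0 _ l0).
  have := Ksq g0 => h4; have : l * `|K g0| ^+ 2 <= 0 by exact: le_trans h3.
  rewrite pmulr_rle0// => h5; apply: K_inj; apply/eqP.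
  by rewrite -normr_eq0 -sqrf_eq0 eq_le h5 sqr_ge0.
have step b x k : K k = h - x ->
    K (k + l *: x + l *: b) = h - (x - l *: K x - l *: K b).
  move=> kE; rewrite 2![K (_ + _)]linearD 2![K (_ *: _)]linearZ/= kE.
  rewrite 2!opprB -!addrA; congr (_ + _).
  by rewrite [LHS]addrC [RHS]addrA; congr (_ - _); rewrite addrC.
have ran n : exists k, K k = h - g n.
  elim: n => [|n [k kE]]; first by exists 0; rewrite linear0 subrr.
  exists (k + l *: g n + l *: B (g n)); exact: (step (B (g n)) (g n) k kE).
have [k kE] := choice ran; exists k.
under eq_fun do rewrite kE.
have := cvgB (cvg_cst h) gg; rewrite g00 subr0; exact.
Qed.

End dense_range.

Section conjugate_operator.
Context {R : realType} {H : completeNormedModType R} (dot : {dot H for idfun}).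
Context (dot_norm : forall x, dot x x = `|x| ^+ 2).
Context (K : {linear H -> H}) (K_bounded : continuous K)
  (K_ge0 : selfadjoint_nonneg dot K) (K_inj : forall x, K x = 0 -> x = 0).
Implicit Types x y h k : H.

(** On the range of K the operator K^-1 L K is K T K^-1, which is bounded; extend it by
density. The limit solves K x = L K h because K and L are continuous. *)
Lemma op_inv_bound (L : {linear H -> H}) (T : H -> H) (M : R) :
  continuous L -> 0 <= M ->
  (forall h k, T (h - k) = T h - T k) ->
  (forall k, K (K (T k)) = L (K (K k))) ->
  (forall k, `|K (T k)| <= M * `|K k|) ->
  forall h, K (op_inv K (L (K h))) = L (K h) /\ `|op_inv K (L (K h))| <= M * `|h|.
Proof.
move=> Lc M0 TB KTL KT h.
have Kc := K_bounded.
have [k kh] := range_dense dot_norm K_bounded K_ge0 K_inj h.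
have xc : cvgn (fun n => K (T (k n))).
  apply: cvg_of_cauchy_sqr => e e0.
  have e1 : 0 < e / (M ^+ 2 + 1) by rewrite divr_gt0// ltr_wpDl// sqr_ge0.
  pose e2 := Num.sqrt (e / (M ^+ 2 + 1)) / 2.
  have e20 : 0 < e2 by rewrite divr_gt0// sqrtr_gt0.
  have /cvgrPdist_lt /(_ _ e20) [N _ NP] := kh.
  exists N => n Nn.
  rewrite -linearB -TB.
  have h1 : `|K (k n - k N)| <= Num.sqrt (e / (M ^+ 2 + 1)).
    rewrite linearB -(subrKA h) (le_trans (ler_normD _ _))//.
    rewrite (distrC _ h).
    have := NP n Nn; have := NP N (leqnn N); rewrite /e2 /=; lra.
  have h2 : `|K (T (k n - k N))| ^+ 2 <= (M * `|K (k n - k N)|) ^+ 2.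
    by rewrite ler_pXn2r// ?nnegrE// mulr_ge0.
  apply: le_trans h2 _; rewrite exprMn.
  apply: (@le_trans _ _ (M ^+ 2 * (e / (M ^+ 2 + 1)))).
    have s2 : Num.sqrt (e / (M ^+ 2 + 1)) ^+ 2 = e / (M ^+ 2 + 1) by rewrite sqr_sqrtr// ltW.
    by rewrite ler_wpM2l ?sqr_ge0// -s2 ler_pXn2r// nnegrE// sqrtr_ge0.
  rewrite mulrCA ger_pMr//.
  by rewrite ler_pdivrMr ?mul1r ?lerDl// ltr_wpDl// sqr_ge0.
have /cvg_ex[x xk] := xc.
have Kx : K x = L (K h).
  have c1 : K (K (T (k n))) @[n --> \oo] --> K x.
    exact: (cvg_comp (fun n => K (T (k n))) K xk (Kc _)).
  have c2 : K (K (T (k n))) @[n --> \oo] --> L (K h).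
    under eq_fun do rewrite KTL.
    have c0 := cvg_comp _ K kh (Kc _).
    exact: (cvg_comp (fun n => K (K (k n))) L c0 (Lc _)).
  exact: (cvg_unique _ c1 c2).
have xM : `|x| <= M * `|h|.
  have c1 := cvg_norm xk; have c2 := cvg_norm kh.
  have c3 : M * `|K (k n)| @[n --> \oo] --> M * `|h| by apply: cvgMl_tmp; exact: c2.
  apply: (ler_cvg_to (c1 _) c3).
  by apply: nearW => n; exact: KT.
rewrite /op_inv.
have [y _ /= yK|nex] := xgetP 0; last by exfalso; exact: (nex x).
suff -> : y = x by split.
apply/eqP; rewrite -subr_eq0; apply/eqP/K_inj.
by rewrite linearB yK Kx subrr.
Qed.

End conjugate_operator.

(** * Weak measurability and Hilbert-Schmidt norms *)

Section monotone_integral.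
Context {d} {T : measurableType d} {R : realType} (mu : {measure set T -> \bar R}).

(** The integral of a nonnegative function is a supremum over the simple functions below it,
so monotonicity needs no measurability; the Hilbert-Schmidt norms of the integrands are
not known to be measurable in time. *)
Lemma ge0_le_integral_sup (D : set T) (f1 f2 : T -> \bar R) :
  (forall x, D x -> (0 <= f1 x)%E) -> (forall x, D x -> (f1 x <= f2 x)%E) ->
  (\int[mu]_(x in D) f1 x <= \int[mu]_(x in D) f2 x)%E.
Proof.
move=> f10 f12; rewrite !(integral_mkcond D).
have h10 x : (0 <= (f1 \_ D) x)%E by apply: erestrict_ge0.
have h12 x : ((f1 \_ D) x <= (f2 \_ D) x)%E by apply: lee_restrict.
have h20 x : (0 <= (f2 \_ D) x)%E by exact: le_trans (h12 x).
rewrite !ge0_integralTE//; apply: le_ereal_sup => _ [g gf <-]; exists g => //= x.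
exact: le_trans (h12 x).
Qed.

End monotone_integral.

Section right_continuous_measurable.
Context {R : realType}.

(** G is the pointwise limit of G sampled at the next point of the grid (1/(n+1)) Z. *)
Lemma right_continuous_measurable (G : R -> R) :
  (forall s, G (s + u) @[u --> 0^'+] --> G s) -> measurable_fun setT G.
Proof.
move=> Gc.
pose G_ (n : nat) (s : R) := G ((Num.floor (n.+1%:R * s) + 1)%:~R / n.+1%:R).
apply: (measurable_fun_cvg (h := G_)) => [n|s _].
  move=> _ B mB; rewrite setTI.
  have -> : G_ n @^-1` B = \bigcup_(z : int) (if pselect (B (G ((z + 1)%:~R / n.+1%:R)))
      then `[z%:~R / n.+1%:R, (z + 1)%:~R / n.+1%:R[%classic else set0).
    apply/seteqP; split=> [s Bs|s [z _]].
      exists (Num.floor (n.+1%:R * s)) => //; case: pselect => //= _.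
      rewrite in_itv/= ler_pdivrMr// ltr_pdivlMr// mulrC; exact: floor_itv.
    case: pselect => //= Bz; rewrite in_itv/= ler_pdivrMr// ltr_pdivlMr// mulrC => h.
    by rewrite /preimage/= /G_ (floor_def h).
  apply: countable_bigcupT_measurable => [|z]; first exact: countableP.
  by case: (pselect (B _)) => ? /=; [exact: measurable_itv|exact: measurable0].
pose u (n : nat) := (Num.floor (n.+1%:R * s) + 1)%:~R / n.+1%:R - s.
have u0 n : 0 < u n by rewrite subr_gt0 ltr_pdivlMr// mulrC floorD1_gt.
have un n : u n <= n.+1%:R^-1.
  rewrite /u intrD mulrDl lerBlDr [leLHS]addrC lerD ?mul1r//.
  by rewrite ler_pdivrMr// mulrC floor_le.
have ucvg : u n @[n --> \oo] --> 0^'+.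
  have u1 : u n @[n --> \oo] --> (0:R).
    apply: (@squeeze_cvgr _ _ _ _ (fun=> 0) (fun n => n.+1%:R^-1)).
    - by apply: nearW => n; rewrite un ltW.
    - exact: cvg_cst.
    - exact: cvg_harmonic.
  move=> A [e /= e0 eA]; move/cvgrPdist_lt : u1 => /(_ e e0) u1.
  by rewrite nbhs_simpl /=; apply: filterS u1 => n un'; apply: eA => //=; exact: u0.
have := cvg_comp u (fun u => G (s + u)) ucvg (Gc s).
rewrite /= [X in X @ _](_ : _ = G_ ^~ s)//.
by apply/funext => n /=; rewrite /G_ /u addrC subrK.
Qed.

End right_continuous_measurable.

Section parseval.
Context {R : realType} {H : completeNormedModType R} (dot : {dot H for idfun}).
Context (dot_norm : forall x, dot x x = `|x| ^+ 2).
Context (E : set H) (E_basis : orthonormal_basis dot E).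
Implicit Types (z h : H) (s : seq H).

Definition proj s z : H := \sum_(e <- s) dot z e *: e.

Let Eorth e f : E e -> E f -> dot e f = (e == f)%:R := E_basis.1 e f.

Lemma dot_proj s z e : uniq s -> (forall x, x \in s -> E x) -> E e ->
  dot (proj s z) e = (e \in s)%:R * dot z e.
Proof.
move=> us sE Ee; rewrite /proj (dot_suml dot).
rewrite (eq_big_seq (fun f => (f == e)%:R * dot z e)); last first.
  move=> f fs /=; rewrite (dotZl dot) Eorth//; last exact: sE.
  by have [->|] := eqVneq f e; rewrite ?mulr1 ?mul1r ?mulr0 ?mul0r.
rewrite -mulr_suml; congr (_ * _).
rewrite -natr_sum -(count_uniq_mem _ us) -sum1_count [in RHS]big_mkcond/=.
by congr _%:R; apply: eq_bigr => f _; case: (f == e).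
Qed.

(** The half of Parseval's identity that uses completeness of the basis. The basis is a set
of unknown cardinality, so a sequence of finite subsets is chosen along which
the sums of squares approach their supremum; the projections on their unions form a
Cauchy sequence, whose limit has the coefficients of z: an element missed by all
of them would push a sum above the supremum. *)
Lemma parseval z (M : R) :
  (forall s, uniq s -> (forall x, x \in s -> E x) -> \sum_(e <- s) dot z e ^+ 2 <= M) ->
  `|z| ^+ 2 <= M.
Proof.
move=> hM.
pose A := [set r | exists s, [/\ uniq s, (forall x, x \in s -> E x) & r = \sum_(e <- s) dot z e ^+ 2]].
have A0 : A 0 by exists [::]; split=> //; rewrite big_nil.
have hsA : has_sup A.
  by split; [exists 0|exists M => _ [s [us sE ->]]; exact: hM].
have Aub r : A r -> r <= sup A by move=> Ar; exact: (ub_le_sup hsA.2).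
have AM : sup A <= M.
  by apply: ge_sup; [exists 0|move=> _ [s [us sE ->]]; exact: hM].
have ex (n : nat) : exists s, [/\ uniq s, (forall x, x \in s -> E x) &
     sup A - n.+1%:R^-1 < \sum_(e <- s) dot z e ^+ 2].
  have n0 : 0 < n.+1%:R^-1 :> R by rewrite invr_gt0.
  by have [_ [s [us sE ->]] h] := sup_adherent n0 hsA; exists s.
have [s_ sP] := choice ex.
pose t := fix t n := if n is m.+1 then undup (s_ n ++ t m) else undup (s_ 0%N).
have tu n : uniq (t n) by case: n => [|n] /=; exact: undup_uniq.
have tE n x : x \in t n -> E x.
  elim: n => [|n IH] /=; rewrite mem_undup; first by have [_ + _] := sP 0%N; exact.
  by rewrite mem_cat => /orP[|//]; have [_ + _] := sP n.+1; exact.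
have st n x : x \in s_ n -> x \in t n.
  by case: n => [|n] xs /=; rewrite mem_undup// mem_cat xs.
have tt n m x : (n <= m)%N -> x \in t n -> x \in t m.
  move=> /subnK <-; elim: (m - n)%N => // k IH xn.
  by rewrite addSn /= mem_undup mem_cat IH ?orbT.
have sub_sum (u v : seq H) : uniq u -> uniq v -> {subset u <= v} ->
    \sum_(e <- u) dot z e ^+ 2 <= \sum_(e <- v) dot z e ^+ 2.
  move=> uu uv uvs.
  rewrite [leRHS](bigID (fun e => e \in u))/= -[leLHS]addr0 lerD//; last first.
    by apply: sumr_ge0 => e _; exact: sqr_ge0.
  rewrite -[leRHS]big_filter le_eqVlt; apply/orP; left; apply/eqP.
  apply: perm_big; apply: uniq_perm => //; first exact: seq.filter_uniq.
  by move=> x; rewrite mem_filter; apply/idP/andP => [xu|[]//]; split => //; exact: uvs.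
have tsum n : sup A - n.+1%:R^-1 < \sum_(e <- t n) dot z e ^+ 2.
  have [us sE h] := sP n; apply: lt_le_trans h _; apply: sub_sum => // x; exact: st.
have tsup n : \sum_(e <- t n) dot z e ^+ 2 <= sup A.
  by apply: Aub; exists (t n); split=> //; exact: tE.
pose p n := proj (t n) z.
have pdot n m : (n <= m)%N -> dot (p m) (p n) = \sum_(e <- t n) dot z e ^+ 2.
  move=> nm; rewrite {2}/p /proj (dot_sumr dot); apply: eq_big_seq => e en.
  rewrite (dotZr dot) /p dot_proj ?(tt _ _ _ nm)// ?mul1r ?expr2//.
    exact: tE.
  exact: tE en.
have pc : cvgn p.
  apply: cvg_of_cauchy_sqr => e e0.
  exists (Num.truncn e^-1) => n Nn; set N := Num.truncn _.
  rewrite -dot_norm (dotBl dot) 2!(dotBr dot) (dotC dot (p N) (p n)) !pdot//.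
  have h1 := tsum N; have h2 := tsup n.
  have : N.+1%:R^-1 < e by rewrite invf_plt ?posrE//; exact: truncnS_gt.
  move: h1 h2; set x := \sum_(_ <- _) _; set y := \sum_(_ <- _) _; set k := _^-1.
  lra.
have /cvg_ex[l pl] := pc.
have lz : l = z.
  apply/eqP; rewrite -subr_eq0; apply/eqP; apply: E_basis.2 => e Ee.
  have c1 : dot (p n) e @[n --> \oo] --> dot l e by apply: dot_cvg.
  have [[n ent]|ne] := pselect (exists n, e \in t n).
    have c2 : dot (p n) e @[n --> \oo] --> dot z e.
      apply: cvg_near_cst; exists n => // m nm.
      by rewrite /p dot_proj ?(tt _ _ _ nm ent) ?mul1r//; exact: tE.
    by rewrite (dotBl dot) (cvg_unique _ c1 c2) ?subrr.
  have c2 : dot (p n) e @[n --> \oo] --> 0.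
    apply: cvg_near_cst; apply: nearW => n.
    rewrite /p dot_proj//; last exact: tE.
    have -> : (e \in t n) = false by apply/negP => en; apply: ne; exists n.
    by rewrite mul0r.
  have -> : dot (l - z) e = - dot z e.
    by rewrite (dotBl dot) (cvg_unique _ c1 c2) ?sub0r.
  apply/eqP; rewrite oppr_eq0 -sqrf_eq0 eq_le sqr_ge0 andbT.
  apply/ler_addgt0Pr => r r0; rewrite add0r.
  pose n := Num.truncn r^-1.
  have h1 := tsum n.
  have h2 : dot z e ^+ 2 + \sum_(e <- t n) dot z e ^+ 2 <= sup A.
    apply: Aub; exists (e :: t n); split=> [|x|]; last by rewrite big_cons.
    - rewrite /= tu andbT; apply/negP => en; apply: ne; by exists n.
    - by rewrite inE => /predU1P[->//|]; exact: tE.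
  have : n.+1%:R^-1 < r by rewrite invf_plt ?posrE//; exact: truncnS_gt.
  move: h1 h2; set x := \sum_(_ <- _) _; set y := _ ^+ 2; set k := _^-1.
  lra.
have c : `|p n| ^+ 2 @[n --> \oo] --> `|z| ^+ 2.
  rewrite !expr2; rewrite -lz; have c1 := cvg_norm pl; exact: cvgM (c1 _) (c1 _).
apply: (cvgr_to_le c); apply: nearW => n.
by rewrite -dot_norm pdot// (le_trans (tsup n)).
Qed.

(** With z = T^* h this is |T^* h| <= |h| |T|_HS, from |z|^2 = sum of <T e, h>^2. *)
Lemma adjoint_hs_norm (T : H -> H) h z : (forall x, dot (T x) h = dot x z) ->
  ((`|z| ^+ 2)%:E <= (`|h| ^+ 2)%:E * hs_norm2 E T)%E.
Proof.
move=> Tz.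
have [hy|] := eqVneq (hs_norm2 E T) +oo%E.
  have [h0|h0] := eqVneq h 0.
    have -> : z = 0 by apply: (dot_nondeg dot_norm) => x; rewrite (dotC dot) -Tz h0 (dot0r dot).
    by rewrite normr0 expr0n/= mule_ge0 ?lee_fin ?sqr_ge0// esum_ge0// => x _; rewrite lee_fin sqr_ge0.
  by rewrite hy gt0_muley ?leey// lte_fin exprn_gt0// normr_gt0.
have e0 : (0 <= hs_norm2 E T)%E by apply: esum_ge0 => x _; rewrite lee_fin sqr_ge0.
move=> ny.
have hf : hs_norm2 E T \is a fin_num by rewrite ge0_fin_numE// lt_neqAle ny leey.
rewrite -(fineK hf) -EFinM lee_fin.
apply: parseval => s us sE.
apply: (@le_trans _ _ (\sum_(e <- s) `|h| ^+ 2 * `|T e| ^+ 2)).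
  apply: ler_sum => e _; rewrite (dotC dot) -Tz -exprMn -real_normK ?num_real//.
  by rewrite ler_pXn2r ?nnegrE ?mulr_ge0// mulrC dot_CS.
rewrite -mulr_sumr ler_wpM2l ?sqr_ge0//.
rewrite -lee_fin fineK// -sumEFin.
apply: esum_ge; exists [set x | x \in s].
  by split; [exact: finite_seq|exact: sE].
by rewrite (fsbig_seq _ _ us).
Qed.

End parseval.

(** * Stochastic integrals of step integrands *)

Section integrable_sum.
Context {d} {T : measurableType d} {R : realType} (mu : {measure set T -> \bar R}).

Lemma integrable_sum {I} (r : seq I) (D : set T) (G : I -> T -> R) : measurable D ->
  (forall i, mu.-integrable D (EFin \o G i)) ->
  mu.-integrable D (EFin \o (fun s => \sum_(i <- r) G i s)) /\
  \int[mu]_(s in D) (\sum_(i <- r) G i s) = \sum_(i <- r) \int[mu]_(s in D) G i s.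
Proof.
move=> mD iG; elim: r => [|i r [IH1 IH2]].
  rewrite big_nil; split.
    under eq_fun do rewrite big_nil; exact: integrable0.
  by under eq_Rintegral do rewrite big_nil; rewrite Rintegral_cst// mul0r.
rewrite big_cons -IH2; split.
  have := integrableD mD (iG i) IH1; apply: eq_integrable => // s _ /=.
  by rewrite big_cons EFinD.
by rewrite -RintegralD//; apply: eq_Rintegral => s _; rewrite big_cons.
Qed.

End integrable_sum.

Section step_law.
Context {R : realType} {H : completeNormedModType R} (dot : {dot H for idfun}).
Context (dot_norm : forall x, dot x x = `|x| ^+ 2).
Context {d} {Omega : measurableType d} (P : probability Omega R).
Context (W : R -> H -> Omega -> R) (W_wiener : cylindrical_wiener dot P W).
Local Notation step := (@rank1_step R H).

Lemma wiener_seq (l : seq (R * R * H)) : all (fun q => 0 <= q.1.2) l ->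
  centered_gaussian P (fun w => \sum_(q <- l) q.1.1 * W q.1.2 q.2 w)
    (\sum_(p <- l) \sum_(q <- l)
       p.1.1 * q.1.1 * Num.min p.1.2 q.1.2 * dot p.2 q.2).
Proof.
move=> /allP l0.
pose tn := tnth (in_tuple l).
have t0 i : 0 <= (tn i).1.2 by apply: l0; exact: mem_tnth.
have := W_wiener.1 (size l) (fun i => (tn i).1.1) (fun i => (tn i).1.2) (fun i => (tn i).2) t0.
congr centered_gaussian; first by apply/funext => w; rewrite [RHS]big_tnth.
rewrite [RHS]big_tnth; apply: eq_bigr => i _; by rewrite [RHS]big_tnth.
Qed.

(** The length of the intersection of the two time intervals, as a combination of
the covariances min(s, t) of the four increments. *)
Definition overlap (p q : step) : R :=
  Num.min (step_b p) (step_b q) - Num.min (step_b p) (step_a q)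
  - Num.min (step_a p) (step_b q) + Num.min (step_a p) (step_a q).

(** The variance of <int F dW, h>. *)
Definition step_var (F : seq step) (h : H) : R :=
  \sum_(p <- F) \sum_(q <- F) dot (step_g p) h * dot (step_g q) h *
     dot (step_f p) (step_f q) * overlap p q.

Definition step_ok (t : R) (q : step) : bool :=
  [&& 0 <= step_a q, step_a q <= step_b q & step_b q <= t].

Lemma step_integral_gaussian t (F : seq step) h : all (step_ok t) F ->
  centered_gaussian P (fun w => dot (step_integral W F w) h) (step_var F h).
Proof.
move=> Fok.
pose l := flatten [seq [:: (dot (step_g q) h, step_b q, step_f q);
                         (- dot (step_g q) h, step_a q, step_f q)] | q <- F].
have l0 : all (fun q : R * R * H => 0 <= q.1.2) l.
  rewrite /l; elim: F {l} Fok => //= q F IH /andP[/and3P[a0 ab bt] /IH ->].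
  by rewrite a0 (le_trans a0).
have lsum (f : R * R * H -> R) : \sum_(q <- l) f q = \sum_(q <- F)
   (f (dot (step_g q) h, step_b q, step_f q) + f (- dot (step_g q) h, step_a q, step_f q)).
  rewrite big_flatten big_map; apply: eq_bigr => q _.
  by rewrite big_cons big_seq1.
have := wiener_seq l0; congr centered_gaussian.
  apply/funext => w; rewrite lsum /step_integral (dot_suml dot); apply: eq_bigr => q _ /=.
  by rewrite (dotZl dot); ring.
rewrite lsum; apply: eq_bigr => p _ /=; rewrite !lsum -big_split/=; apply: eq_bigr => q _ /=.
by rewrite /overlap; ring.
Qed.

Definition step_ind (q : step) (s : R) : R := (step_a q < s <= step_b q)%R%:R.

(** The adjoint of the step integrand at time s, applied to h. *)
Definition step_adj (F : seq step) (h : H) (s : R) : H :=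
  \sum_(q <- F) (step_ind q s * dot (step_g q) h) *: step_f q.

Lemma step_adjE (F : seq step) h s x : dot (step_fun dot F s x) h = dot x (step_adj F h s).
Proof.
rewrite /step_fun /step_adj (dot_suml dot) (dot_sumr dot); apply: eq_bigr => q _.
rewrite (dotZr dot) /step_ind; case: ifP => _; last by rewrite (dot0l dot) !mul0r.
by rewrite (dotZl dot) mul1r mulrC (dotC dot x).
Qed.

Lemma step_ind2 (p q : step) (s : R) : step_ind p s * step_ind q s =
  \1_(`]Num.max (step_a p) (step_a q), Num.min (step_b p) (step_b q)]%classic) s.
Proof.
rewrite /step_ind indicE -natrM mulnb; congr (nat_of_bool _)%:R.
apply/idP/idP; rewrite inE /= in_itv/= gt_max le_min.
  by move=> /andP[/andP[-> ->] /andP[-> ->]].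
by move=> /andP[/andP[-> ->] /andP[-> ->]].
Qed.

Lemma step_adj_sqr (F : seq step) h s : `|step_adj F h s| ^+ 2 =
  \sum_(p <- F) \sum_(q <- F) dot (step_g p) h * dot (step_g q) h *
     dot (step_f p) (step_f q) * (step_ind p s * step_ind q s).
Proof.
rewrite -dot_norm /step_adj (dot_suml dot); apply: eq_bigr => p _.
rewrite (dot_sumr dot); apply: eq_bigr => q _.
by rewrite (dotZl dot) (dotZr dot); ring.
Qed.

Local Notation leb := (@lebesgue_measure R).

Lemma step_ind_measurable (q : step) : measurable_fun setT (step_ind q).
Proof.
have -> : step_ind q = \1_(`]step_a q, step_b q]%classic).
  apply/funext => s; rewrite /step_ind indicE; congr (nat_of_bool _)%:R.
  by apply/idP/idP; rewrite inE /= in_itv/=.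
exact: measurable_indic.
Qed.

(** Ito's isometry for step integrands. *)
Lemma step_adj_integral t (F : seq step) h : all (step_ok t) F ->
  leb.-integrable `[0%R, t] (EFin \o (fun s => `|step_adj F h s| ^+ 2)) /\
  \int[leb]_(s in `[0%R, t]) (`|step_adj F h s| ^+ 2) = step_var F h.
Proof.
move=> Fok.
have Dfin : (leb `[0%R, t] < +oo)%E.
  by rewrite lebesgue_measure_itv/=; case: ifP => _; rewrite ?ltry// -EFinB ltry.
have iind (p q : step) : leb.-integrable `[0%R, t] (EFin \o (fun s => step_ind p s * step_ind q s)).
  apply: measurable_bounded_integrable => //.
    by apply: measurable_funTS; apply: measurable_funM; exact: step_ind_measurable.
  exists 1; split; first exact: num_real.
  move=> y y1 s _; apply: le_trans (ltW y1).
  rewrite step_ind2 indicE; case: (_ \in _); by rewrite ?normr1 ?normr0.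
have iterm (p q : step) (c : R) : leb.-integrable `[0%R, t] (EFin \o (fun s => c * (step_ind p s * step_ind q s))).
  have : leb.-integrable `[0%R, t] (fun s => (c%:E * (step_ind p s * step_ind q s)%:E)%E).
    by apply: integrableZl => //; exact: iind.
  exact.
have isum (p : step) := @integrable_sum _ _ _ leb _ F `[0%R, t] (fun q s => dot (step_g p) h * dot (step_g q) h *
     dot (step_f p) (step_f q) * (step_ind p s * step_ind q s)) (measurable_itv _) (fun q => iterm p q _).
have [h1 h2] := @integrable_sum _ _ _ leb _ F `[0%R, t] (fun p s => \sum_(q <- F) dot (step_g p) h * dot (step_g q) h *
     dot (step_f p) (step_f q) * (step_ind p s * step_ind q s)) (measurable_itv _) (fun p => (isum p).1).
split.
  apply: eq_integrable h1 => // s _ /=; by rewrite step_adj_sqr.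
under eq_Rintegral do rewrite step_adj_sqr.
rewrite h2 /step_var -{1 3}(all_filterP Fok) !big_filter.
apply: eq_bigr => p /and3P[ap abp bp]; rewrite (isum p).2.
rewrite -{1 2}(all_filterP Fok) !big_filter.
apply: eq_bigr => q /and3P[aq abq bq]; rewrite RintegralZl//; congr (_ * _).
under eq_Rintegral do rewrite step_ind2.
rewrite /Rintegral integral_indic//=.
rewrite setIidl; last first.
  move=> s /=; rewrite !in_itv/= gt_max le_min => /andP[/andP[h3 h4] /andP[h5 h6]].
  by rewrite (le_trans h5)// andbT (le_trans ap)// ltW.
rewrite lebesgue_measure_itv/= lte_fin /overlap.
case: ifP; rewrite ?(fine_def)/= /Order.min /Order.max;
  do !case: ifP => //=; rewrite /= => *;
  repeat match goal with H : (_ < _) = false |- _ => move/negbT : H; rewrite -leNgt => H end;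
  try lra.
Qed.

End step_law.

(** * The law of the stochastic convolution *)

Lemma cos_lipschitz (R : realType) (x y : R) : `|cos x - cos y| <= `|x - y|.
Proof.
wlog xy : x y / x <= y.
  move=> hw; have [/hw//|/ltW/hw] := leP x y.
  by rewrite distrC (distrC y).
move: xy; rewrite le_eqVlt => /predU1P[->|xy]; first by rewrite !subrr.
have [|c _] := @MVT R cos (fun z => - sin z) _ _ xy (fun z _ => is_derive_cos z).
  by apply: continuous_subspaceT; exact: continuous_cos.
rewrite distrC => ->; rewrite normrM normrN (distrC x) ler_piMl//.
by rewrite ler_norml sin_geN1 sin_le1.
Qed.

Lemma cvg0_near_le (R : realType) (f : nat -> \bar R) (m : R) : 0 < m ->
  f n @[n --> \oo] --> 0%E -> \forall n \near \oo, (f n <= m%:E)%E.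
Proof.
move=> m0 /fine_cvgP[fin c]; near=> n.
have nf : f n \is a fin_num by near: n.
rewrite -(fineK nf) lee_fin; near: n; exact: (cvgr_le 0).
Unshelve. all: by end_near. Qed.

(** Young's inequality: |x - z|^2 differs from |x|^2 by |z|^2 - 2 <x, z>. *)
Lemma sqr_norm_diff_le (R : realType) (H : completeNormedModType R)
    (dot : {dot H for idfun}) (dot_norm : forall x, dot x x = `|x| ^+ 2) (r : R) (x y : H) :
  0 < r -> `| `|y| ^+ 2 - `|x| ^+ 2| <= r * `|x| ^+ 2 + (1 + r^-1) * `|x - y| ^+ 2.
Proof.
move=> r0; have rn0 : r != 0 by exact: lt0r_neq0.
set z := x - y; have yE : y = x - z by rewrite /z subKr.
clearbody z.
have X : 0 <= `|r *: x - z| ^+ 2 / r by rewrite divr_ge0 ?sqr_ge0// ltW.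
have Y : 0 <= `|r *: x + z| ^+ 2 / r by rewrite divr_ge0 ?sqr_ge0// ltW.
have zz : 0 <= dot z z by rewrite dot_norm sqr_ge0.
have e0 : `|y| ^+ 2 - `|x| ^+ 2 = dot z z - 2 * dot x z.
  by rewrite yE -!dot_norm !(dotBl dot, dotBr dot) (dotC dot z x); ring.
have e1 : `|r *: x - z| ^+ 2 / r = r * dot x x - 2 * dot x z + r^-1 * dot z z.
  by rewrite -dot_norm !(dotBl dot, dotBr dot, dotZl dot, dotZr dot) (dotC dot z x); field.
have e2 : `|r *: x + z| ^+ 2 / r = r * dot x x + 2 * dot x z + r^-1 * dot z z.
  by rewrite -dot_norm !(dotDl dot, dotDr dot, dotZl dot, dotZr dot) (dotC dot z x); field.
rewrite e0 -!dot_norm ler_norml mulrDl mul1r; move: zz X Y; rewrite e1 e2.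
set A := r * dot x x; set B := dot x z; set C := dot z z; set G := r^-1 * C.
by move=> zz X Y; apply/andP; split; lra.
Qed.

Section stochastic_integral_law.
Context {R : realType} {H : completeNormedModType R} (dot : {dot H for idfun}).
Context (dot_norm : forall x, dot x x = `|x| ^+ 2) (H_sep : @separable R H).
Context (E : set H) (E_basis : orthonormal_basis dot E).
Context (S : R -> {linear H -> H}) (S_semigroup : c0_semigroup S).
Context (T : R -> H -> H) (S_adj : forall t : R, 0 <= t -> adjoint_of dot (S t) (T t)).
Context (Q : {linear H -> H}) (Q_ge0 : selfadjoint_nonneg dot Q).
Context (Qh : {linear H -> H}) (Qh_ge0 : selfadjoint_nonneg dot Qh)
  (Qh_sqrt : forall x, Qh (Qh x) = Q x).
Context (Qoo : H -> H)
    (Qoo_int : op_integral dot `[0, +oo[ (fun s x => S s (Q (T s x))) Qoo).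
Context {d} {Omega : measurableType d} (P : probability Omega R).
Context (W : R -> H -> Omega -> R) (W_wiener : cylindrical_wiener dot P W).
Implicit Types (s t u : R) (h k x y : H).
Local Notation leb := (@lebesgue_measure R).
Local Notation step := (@rank1_step R H).
Local Notation q := (qform dot Q).
Local Notation a := (aform dot Qoo).

Let TT := adj_semigroup dot_norm S_semigroup S_adj.

(** Extended by 0 to negative times, the function is right continuous. *)
Lemma adj_weakly_measurable h y :
  measurable_fun (`[0%R, +oo[%classic : set R) (fun t => dot (T t h) y).
Proof.
pose G t := if t < 0 then 0 else dot (T t h) y.
have mG : measurable_fun setT G.
  apply: right_continuous_measurable => s; have [s0|s0] := ltP s 0.
    rewrite /G s0; apply: cvg_near_cst; near=> u.
    have us : u < - s by near: u; apply: nbhs_right_lt; rewrite oppr_gt0.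
    by have -> : s + u < 0 by lra.
  rewrite {2}/G ltNge s0 /=.
  have c := adj_weakly_continuous dot_norm S_semigroup S_adj (h := T s h) (y := y).
  have e : \forall u \near 0^'+, dot (T u (T s h)) y = G (s + u).
    near=> u; have u0 : 0 < u by near: u; exact: nbhs_right_gt.
    have su : 0 <= s + u by rewrite addr_ge0// ltW.
    by rewrite /G ltNge su /= -TT ?(ltW u0)// addrC.
  exact: cvg_trans (near_eq_cvg e) c.
have mG2 : measurable_fun (`[0%R, +oo[%classic : set R) G by apply: measurable_funS mG.
apply: eq_measurable_fun mG2 => t; rewrite inE/= in_itv/= andbT => t0.
by rewrite /G ltNge t0.
Unshelve. all: by end_near. Qed.

Section fixed_time.
Context (t : R) (t0 : 0 <= t).
Local Notation D := (`[0%R, t]%classic : set R).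

Let w h s : H := Qh (T (t - s) h).

Let D_ge0 s : D s -> 0 <= t - s.
Proof. by rewrite /= in_itv/= => /andP[_]; rewrite subr_ge0. Qed.

Let w_sqr h s : `|w h s| ^+ 2 = q (T (t - s) h) (T (t - s) h).
Proof. by rewrite -dot_norm /w Qh_ge0.1 Qh_sqrt /qform (dotC dot). Qed.

Let measurable_reflect (f : R -> R) : measurable_fun (`[0%R, +oo[%classic : set R) f ->
  measurable_fun D (fun s => f (t - s)).
Proof.
move=> mf; apply: (@measurable_comp _ _ _ R R R `[0, +oo[%classic f D (fun s => t - s)) => //.
- by move=> _ [s sD <-]; rewrite /= in_itv/= andbT; exact: D_ge0.
- by apply: measurable_funTS; exact: measurable_fun_reflect.
Qed.

Let measurable_w_sqr h : measurable_fun D (fun s => `|w h s| ^+ 2).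
Proof.
rewrite (_ : (fun s => _) = (fun s => q (T (t - s) h) (T (t - s) h))); last by apply/funext => s; exact: w_sqr.
apply: (measurable_reflect (f := fun s => q (T s h) (T s h))).
by have /integrableP[/measurable_EFinP] := qform_adj_integrable S_adj Qoo_int h h.
Qed.

Let int_w_sqr h : (\int[leb]_(s in D) (`|w h s| ^+ 2)%:E)%E = (vform dot T Qoo t h h)%:E.
Proof.
transitivity (\int[leb]_(s in D) (q (T (t - s) h) (T (t - s) h))%:E)%E.
  by apply: eq_integral => s _; rewrite w_sqr.
exact: (qform_adj_integral_reflect dot_norm S_semigroup S_adj Q_ge0 Qoo_int).
Qed.

Let integrable_w_sqr h : leb.-integrable D (EFin \o (fun s => `|w h s| ^+ 2)).
Proof.
apply/integrableP; split; first by apply/measurable_EFinP; exact: measurable_w_sqr.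
apply: le_lt_trans (ltry (vform dot T Qoo t h h)); rewrite -int_w_sqr le_eqVlt; apply/orP; left.
by apply/eqP/eq_integral => s _ /=; rewrite ger0_norm ?sqr_ge0.
Qed.

Let measurable_diff (F : seq step) h :
  measurable_fun D (fun s => `|w h s - step_adj dot F h s| ^+ 2).
Proof.
have -> : (fun s => `|w h s - step_adj dot F h s| ^+ 2) =
  (fun s => `|w h s| ^+ 2 - 2 * (\sum_(q <- F) step_ind q s * dot (step_g q) h *
      dot (T (t - s) h) (Qh (step_f q))) + `|step_adj dot F h s| ^+ 2).
  apply/funext => s; rewrite -!dot_norm (dotBl dot) !(dotBr dot) (dotC dot (step_adj _ _ _ _) (w h s)).
  have -> : dot (w h s) (step_adj dot F h s) = \sum_(q <- F) step_ind q s * dot (step_g q) h *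
      dot (T (t - s) h) (Qh (step_f q)).
    rewrite /step_adj (dot_sumr dot); apply: eq_bigr => q _.
    by rewrite (dotZr dot) /w Qh_ge0.1.
  by ring.
apply: measurable_funD.
  apply: measurable_funB; first exact: measurable_w_sqr.
  apply: measurable_funM => //; apply: measurable_sum => p.
  apply: measurable_funM.
    apply: measurable_funM => //; apply: measurable_funTS; exact: step_ind_measurable.
  apply: (measurable_reflect (f := fun s => dot (T s h) (Qh (step_f p)))).
  exact: adj_weakly_measurable.
rewrite (_ : (fun s => `|step_adj dot F h s| ^+ 2) =
  (fun s => \sum_(p <- F) \sum_(r <- F) dot (step_g p) h * dot (step_g r) h *
     dot (step_f p) (step_f r) * (step_ind p s * step_ind r s))); last first.
  by apply/funext => s; exact: step_adj_sqr.
apply: measurable_funTS.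
have mm (p r : step) : measurable_fun setT (fun s => dot (step_g p) h * dot (step_g r) h *
     dot (step_f p) (step_f r) * (step_ind p s * step_ind r s)).
  by apply: measurable_funM => //; apply: measurable_funM; exact: step_ind_measurable.
by apply: measurable_sum => p; exact: measurable_sum.
Qed.

Let Phi s y := S (t - s) (Qh y).

(** The adjoint of Phi(s) - F(s) maps h to w h s - F(s)^* h. Dividing by |h|^2 + 1 rather
than |h|^2 avoids the case h = 0. *)
Let diff_hs (F : seq step) h s : D s ->
  ((`|w h s - step_adj dot F h s| ^+ 2 / (`|h| ^+ 2 + 1))%:E <=
   hs_norm2 E (fun x => (Phi s x - step_fun dot F s x)%R))%E.
Proof.
move=> sD.
have h1 : 0 < `|h| ^+ 2 + 1 by rewrite ltr_wpDl// sqr_ge0.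
have e0 : (0 <= hs_norm2 E (fun x => (Phi s x - step_fun dot F s x)%R))%E.
  by apply: esum_ge0 => x _; rewrite lee_fin sqr_ge0.
have hz x : dot (Phi s x - step_fun dot F s x) h = dot x (w h s - step_adj dot F h s).
  rewrite (dotBl dot) (dotBr dot) step_adjE; congr (_ - _).
  by rewrite /Phi S_adj ?D_ge0// Qh_ge0.1.
have := adjoint_hs_norm dot_norm E_basis hz.
have [->|ny] := eqVneq (hs_norm2 E (fun x => (Phi s x - step_fun dot F s x)%R)) +oo%E.
  by rewrite leey.
have hf : hs_norm2 E (fun x => (Phi s x - step_fun dot F s x)%R) \is a fin_num.
  by rewrite ge0_fin_numE// lt_neqAle ny leey.
rewrite -(fineK hf) -EFinM !lee_fin => h2.
rewrite ler_pdivrMr// (le_trans h2)// mulrC ler_wpM2l ?fine_ge0//.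
by rewrite lerDl.
Qed.

Let v h := vform dot T Qoo t h h.

(** The variances are the squared norms of w h and of F^* h in L2([0, t]; H), and the two
functions are close there by [diff_hs]. *)
Let step_var_close (F : seq step) h (r : R) (m : R) : 0 < r ->
  all (step_ok t) F ->
  (\int[leb]_(s in D) hs_norm2 E (fun x => (Phi s x - step_fun dot F s x)%R) <= m%:E)%E ->
  `|step_var dot F h - v h| <= r * v h + (1 + r^-1) * ((`|h| ^+ 2 + 1) * m).
Proof.
move=> r0 Fok hm.
have h1 : 0 < `|h| ^+ 2 + 1 by rewrite ltr_wpDl// sqr_ge0.
have [iu uE] := step_adj_integral dot_norm h Fok.
have iw := integrable_w_sqr h.
have md := measurable_diff F h.
have id1 : (\int[leb]_(s in D) (`|w h s - step_adj dot F h s| ^+ 2 / (`|h| ^+ 2 + 1))%:E <= m%:E)%E.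
  apply: le_trans hm; apply: ge0_le_integral_sup => s sD; last exact: diff_hs.
  by rewrite lee_fin divr_ge0 ?sqr_ge0// ltW.
have idd : leb.-integrable D (EFin \o (fun s => `|w h s - step_adj dot F h s| ^+ 2 / (`|h| ^+ 2 + 1))).
  apply/integrableP; split; first by apply/measurable_EFinP; exact: measurable_funM.
  apply: le_lt_trans (ltry m); apply: le_trans id1; rewrite le_eqVlt; apply/orP; left.
  by apply/eqP/eq_integral => s _ /=; rewrite ger0_norm// divr_ge0 ?sqr_ge0// ltW.
have id2 : \int[leb]_(s in D) (`|w h s - step_adj dot F h s| ^+ 2 / (`|h| ^+ 2 + 1)) <= m.
  rewrite -lee_fin /Rintegral fineK//; exact: integrable_fin_num idd.
have wE : \int[leb]_(s in D) (`|w h s| ^+ 2) = v h by rewrite /Rintegral int_w_sqr.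
have mD : measurable D by exact: measurable_itv.
have irw : leb.-integrable D (EFin \o (fun s => r * `|w h s| ^+ 2)).
  have : leb.-integrable D (fun s => (r%:E * (`|w h s| ^+ 2)%:E)%E) by apply: integrableZl => //; exact: iw.
  exact.
pose c : R := (1 + r^-1) * (`|h| ^+ 2 + 1).
have c0 : 0 <= c by rewrite mulr_ge0 ?addr_ge0 ?invr_ge0// ltW.
have icd : leb.-integrable D (EFin \o (fun s => c * (`|w h s - step_adj dot F h s| ^+ 2 / (`|h| ^+ 2 + 1)))).
  have : leb.-integrable D (fun s => (c%:E * (`|w h s - step_adj dot F h s| ^+ 2 / (`|h| ^+ 2 + 1))%:E)%E).
    by apply: integrableZl => //; exact: idd.
  exact.
rewrite -uE -{1}wE -RintegralB//.
apply: (@le_trans _ _ (\int[leb]_(s in D) (r * `|w h s| ^+ 2 +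
    c * (`|w h s - step_adj dot F h s| ^+ 2 / (`|h| ^+ 2 + 1))))); last first.
  rewrite RintegralD// !RintegralZl// wE lerD2l /c -mulrA ler_wpM2l ?addr_ge0 ?invr_ge0 ?(ltW r0)//.
  by rewrite ler_wpM2l// ltW.
have ib : leb.-integrable D (EFin \o (fun s => `|step_adj dot F h s| ^+ 2 - `|w h s| ^+ 2)).
  have : leb.-integrable D (fun s => ((`|step_adj dot F h s| ^+ 2)%:E - (`|w h s| ^+ 2)%:E)%E).
    by apply: integrableB => //.
  exact.
have lb : `|\int[leb]_(s in D) (`|step_adj dot F h s| ^+ 2 - `|w h s| ^+ 2)| <=
    \int[leb]_(s in D) `|(`|step_adj dot F h s| ^+ 2 - `|w h s| ^+ 2)%R|.
  apply: le_normr_Rintegral => //; exact: ib.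
apply: le_trans lb _.
apply: le_Rintegral => //.
- by have := integrable_norm ib; exact.
- have : leb.-integrable D (fun s => ((r * `|w h s| ^+ 2)%:E + (c * (`|w h s - step_adj dot F h s| ^+ 2 / (`|h| ^+ 2 + 1)))%:E)%E).
    by apply: integrableD => //.
  exact.
move=> s _.
have -> : c * (`|w h s - step_adj dot F h s| ^+ 2 / (`|h| ^+ 2 + 1)) =
   (1 + r^-1) * `|w h s - step_adj dot F h s| ^+ 2.
  by rewrite /c; field; rewrite !lt0r_neq0.
exact: (sqr_norm_diff_le dot_norm).
Qed.

(** The variables <int F_n dW, h> are Gaussian with variances that converge to <Q_t h, h>, so
their characteristic functions converge. They tend to <X, h> in L2, hence the
integrals of the 1-Lipschitz function cos converge too. *)
Lemma stoch_integral_cos (X : Omega -> borel H) h th :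
  stoch_integral dot P E W t Phi X ->
  measurable_fun setT X /\
  \int[P]_o cos (dot (X o) h + th) = cos th * expR (- (vform dot T Qoo t h h / 2)).
Proof.
move=> [mX [F [Fok Fhs FX]]]; split => //.
have v0 : 0 <= v h.
  rewrite subr_ge0; exact: (aform_adj_le dot_norm S_semigroup S_adj Q_ge0 Qoo_int).
have h1 : 0 < `|h| ^+ 2 + 1 by rewrite ltr_wpDl// sqr_ge0.
have Fok' n : all (step_ok t) (F n) by exact: Fok.
have var_cvg : step_var dot (F n) h @[n --> \oo] --> v h.
  apply/cvgrPdist_le => e e0.
  pose r : R := e / (2 * (v h + 1)).
  have v1 : 0 < v h + 1 by rewrite ltr_wpDl.
  have r0 : 0 < r by rewrite divr_gt0// mulr_gt0.
  have rv : r * v h <= e / 2.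
    rewrite /r mulrAC ler_pdivrMr ?mulr_gt0//.
    have -> : e / 2 * (2 * (v h + 1)) = e * (v h + 1) by field.
    by rewrite ler_pM2l// lerDl.
  have r1 : 0 < 1 + r^-1 by rewrite addr_gt0// invr_gt0.
  pose m : R := e / 2 / ((1 + r^-1) * (`|h| ^+ 2 + 1)).
  have m0 : 0 < m by rewrite divr_gt0 ?divr_gt0// mulr_gt0.
  have mE : (1 + r^-1) * ((`|h| ^+ 2 + 1) * m) = e / 2.
    by rewrite /m mulrA mulrC divfK// gt_eqF// mulr_gt0.
  have ev : \forall n \near \oo, (\int[leb]_(s in D)
      hs_norm2 E (fun x => (Phi s x - step_fun dot (F n) s x)%R) <= m%:E)%E.
    exact: cvg0_near_le.
  near=> n; rewrite distrC; apply: (le_trans (y := r * v h + e / 2)); last lra.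
  have hm : (\int[leb]_(s in D)
      hs_norm2 E (fun x => (Phi s x - step_fun dot (F n) s x)%R) <= m%:E)%E by near: n.
  by have := step_var_close h r0 (Fok' n) hm; rewrite mE.
pose f n o := dot (X o) h - dot (step_integral W (F n) o) h.
have mXh : measurable_fun setT (fun o => dot (X o) h).
  exact: measurableT_comp (measurable_dot dot_norm h) mX.
have mIh n : measurable_fun setT (fun o => dot (step_integral W (F n) o) h).
  exact: (step_integral_gaussian W_wiener h (Fok' n)).1.
have mf n : measurable_fun setT (f n) by exact: measurable_funB.
have bc (g : Omega -> R) : measurable_fun setT g -> bounded_measurable (fun o => cos (g o + th)).
  move=> mg; have := bmf_comp mg (bmf_cos 1 th).
  by congr bounded_measurable; apply/funext => o /=; rewrite mul1r.
have cn n : \int[P]_o cos (dot (step_integral W (F n) o) h + th) =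
    cos th * expR (- (step_var dot (F n) h / 2)).
  apply: gauss_cos (step_integral_gaussian W_wiener h (Fok' n)).
  rewrite -(step_adj_integral dot_norm h (Fok' n)).2.
  by apply: Rintegral_ge0 => s _; rewrite sqr_ge0.
have c1 : \int[P]_o cos (dot (step_integral W (F n) o) h + th) @[n --> \oo] -->
    cos th * expR (- (v h / 2)).
  rewrite (funext cn); apply: cvgMr.
  apply: (@cvg_comp _ _ _ (fun n => - (step_var dot (F n) h / 2)) expR); last exact: continuous_expR.
  by apply: cvgN; apply: cvgMl.
have c2 : \int[P]_o cos (dot (step_integral W (F n) o) h + th) @[n --> \oo] -->
    \int[P]_o cos (dot (X o) h + th).
  apply/cvgrPdist_le => e e0.
  pose m : R := (e / 2) ^+ 2 / (`|h| ^+ 2 + 1).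
  have e20 : 0 < e / 2 by rewrite divr_gt0.
  have m0 : 0 < m by rewrite divr_gt0// exprn_gt0.
  near=> n.
  have hm : (\int[P]_w ((`|(X w : H) - step_integral W (F n) w| ^+ 2)%R)%:E <= m%:E)%E.
    by near: n; exact: cvg0_near_le FX.
  have id1 : (\int[P]_o ((f n o) ^+ 2 / (`|h| ^+ 2 + 1))%:E <= m%:E)%E.
    apply: le_trans hm; apply: ge0_le_integral_sup => o _.
      by rewrite lee_fin divr_ge0 ?sqr_ge0// ltW.
    rewrite lee_fin ler_pdivrMr// /f -(dotBl dot).
    have := dot_CS dot_norm ((X o : H) - step_integral W (F n) o) h.
    rewrite -(@ler_pXn2r _ 2)// ?nnegrE ?mulr_ge0// real_normK ?num_real// exprMn => hh.
    by apply: (le_trans hh); rewrite ler_wpM2l ?sqr_ge0// lerDl.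
  have idd : P.-integrable setT (EFin \o (fun o => (f n o) ^+ 2 / (`|h| ^+ 2 + 1))).
    apply/integrableP; split; first by apply/measurable_EFinP; apply: measurable_funM => //; exact: measurable_funX.
    apply: le_lt_trans (ltry m); apply: le_trans id1; rewrite le_eqVlt; apply/orP; left.
    by apply/eqP/eq_integral => s _ /=; rewrite ger0_norm// divr_ge0 ?sqr_ge0// ltW.
  have id2 : \int[P]_o ((f n o) ^+ 2 / (`|h| ^+ 2 + 1)) <= m.
    rewrite -lee_fin /Rintegral fineK//; exact: integrable_fin_num idd.
  pose c : R := (e / 2)^-1 * (`|h| ^+ 2 + 1).
  have c0 : 0 <= c by rewrite mulr_ge0 ?invr_ge0// ltW.
  have icd : P.-integrable setT (EFin \o (fun o => c * ((f n o) ^+ 2 / (`|h| ^+ 2 + 1)))).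
    have : P.-integrable setT (fun o => (c%:E * ((f n o) ^+ 2 / (`|h| ^+ 2 + 1))%:E)%E).
      by apply: integrableZl => //; exact: idd.
    exact.
  have ice := bmf_integrable P (bmf_cst (e / 2)).
  have bd := bmfB (bc _ mXh) (bc _ (mIh n)).
  rewrite -bmf_intB; [|exact: bc|exact: bc].
  apply: le_trans (le_normr_Rintegral measurableT (bmf_integrable P bd)) _.
  apply: (@le_trans _ _ (\int[P]_o (e / 2 + c * ((f n o) ^+ 2 / (`|h| ^+ 2 + 1))))); last first.
    rewrite RintegralD// RintegralZl// prob_int_cst.
    have : c * (\int[P]_o (f n o ^+ 2 / (`|h| ^+ 2 + 1))) <= c * m by rewrite ler_wpM2l.
    have -> : c * m = e / 2.
      by rewrite /c /m; field; rewrite !lt0r_neq0.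
    lra.
  apply: le_Rintegral => //.
  - by have := integrable_norm (bmf_integrable P bd); exact.
  - have : P.-integrable setT (fun o => ((e / 2)%:E + (c * ((f n o) ^+ 2 / (`|h| ^+ 2 + 1)))%:E)%E).
      by apply: integrableD => //.
    exact.
  move=> o _; apply: le_trans (cos_lipschitz _ _) _.
  have -> : c * (f n o ^+ 2 / (`|h| ^+ 2 + 1)) = (e / 2)^-1 * f n o ^+ 2.
    by rewrite /c; field; rewrite !lt0r_neq0.
  have -> : dot (X o) h + th - (dot (step_integral W (F n) o) h + th) = f n o.
    by rewrite /f; ring.
  rewrite -real_normK ?num_real// -subr_ge0.
  move: (e / 2) e20 (`|f n o|) => g g0 y.
  have -> : g + g^-1 * y ^+ 2 - y = ((g - y / 2) ^+ 2 + 3 / 4 * y ^+ 2) / g.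
    by field; exact: lt0r_neq0.
  by rewrite divr_ge0 ?(ltW g0)// addr_ge0 ?sqr_ge0// mulr_ge0 ?sqr_ge0.
exact: cvg_unique c2 c1.
Unshelve. all: by end_near. Qed.

End fixed_time.
End stochastic_integral_law.

(** * The space of square integrable functions *)

Section square_integrable.
Context {d} {T : measurableType d} {R : realType} (P : probability T R).
Implicit Types f g : T -> R.

Definition square_integrable f :=
  measurable_fun setT f /\ P.-integrable setT (EFin \o (fun x => f x ^+ 2)).

Lemma integrable_le f g : measurable_fun setT f -> P.-integrable setT (EFin \o g) ->
  (forall x, `|f x| <= g x) -> P.-integrable setT (EFin \o f).
Proof.
move=> mf ig fg; apply: (le_integrable measurableT _ _ ig).
  exact/measurable_EFinP.
by move=> x _; rewrite lee_fin/= (le_trans (fg x))// ler_norm.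
Qed.

Lemma integrableDR f g : P.-integrable setT (EFin \o f) -> P.-integrable setT (EFin \o g) ->
  P.-integrable setT (EFin \o (fun x => f x + g x)).
Proof. by move=> i j; have := integrableD measurableT i j; exact. Qed.

Lemma integrableZR (c : R) f : P.-integrable setT (EFin \o f) ->
  P.-integrable setT (EFin \o (fun x => c * f x)).
Proof. by move=> i; have := integrableZl measurableT c i; exact. Qed.

Lemma square_integrable_ltyP f : measurable_fun setT f ->
  square_integrable f <-> (\int[P]_x (f x ^+ 2)%:E < +oo)%E.
Proof.
move=> mf.
have E : (\int[P]_x `|(EFin \o (fun x => f x ^+ 2)%R) x| = \int[P]_x (f x ^+ 2)%:E)%E.
  by apply: eq_integral => x _ /=; rewrite ger0_norm ?sqr_ge0.
split=> [[_ /integrableP[_]]|h]; first by rewrite E.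
split=> //; apply/integrableP; split; last by rewrite E.
by apply/measurable_EFinP; exact: measurable_funX.
Qed.

Lemma square_integrable_bmf f : bounded_measurable f -> square_integrable f.
Proof. by move=> bf; split; [exact: bf.1|exact: bmf_integrable (bmfX 2 bf)]. Qed.

Lemma square_integrableZ (c : R) f : square_integrable f -> square_integrable (fun x => c * f x).
Proof.
move=> [mf i]; split; first exact: measurable_funM.
by under eq_fun do rewrite exprMn; exact: integrableZR.
Qed.

Lemma square_integrableM f g : square_integrable f -> square_integrable g ->
  P.-integrable setT (EFin \o (fun x => f x * g x)).
Proof.
move=> [mf i] [mg j]; apply: integrable_le (integrableDR i j) _.
  exact: measurable_funM.
move=> x; have := sqr_ge0 (f x + g x); have := sqr_ge0 (f x - g x).
rewrite ler_norml !expr2; move: (f x) (g x) => a b *; apply/andP; split; nra.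
Qed.

Lemma square_integrable_int f : square_integrable f -> P.-integrable setT (EFin \o f).
Proof.
move=> sf; have := square_integrableM sf (square_integrable_bmf (bmf_cst 1)).
by under eq_fun do rewrite mulr1.
Qed.

Lemma square_integrableD f g : square_integrable f -> square_integrable g ->
  square_integrable (fun x => f x + g x).
Proof.
move=> sf sg; split; first exact: measurable_funD sf.1 sg.1.
rewrite (_ : (fun x => _) = (fun x => f x ^+ 2 + 2 * (f x * g x) + g x ^+ 2)); last first.
  by apply/funext => x; ring.
apply: integrableDR sg.2; apply: integrableDR sf.2 _; apply: integrableZR.
exact: square_integrableM.
Qed.

Lemma square_integrableB f g : square_integrable f -> square_integrable g ->
  square_integrable (fun x => f x - g x).
Proof.
move=> sf sg; have := square_integrableD sf (square_integrableZ (-1) sg).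
by under eq_fun do rewrite mulN1r.
Qed.

Definition inner f g : R := \int[P]_x (f x * g x).

Lemma innerC f g : inner f g = inner g f.
Proof. by apply: eq_Rintegral => x _; rewrite mulrC. Qed.

Lemma innerDl f g h : square_integrable f -> square_integrable g -> square_integrable h ->
  inner (fun x => f x + g x) h = inner f h + inner g h.
Proof.
move=> sf sg sh; rewrite -RintegralD//; try exact: square_integrableM.
by apply: eq_Rintegral => x _; rewrite mulrDl.
Qed.

Lemma innerZl c f g : square_integrable f -> square_integrable g ->
  inner (fun x => c * f x) g = c * inner f g.
Proof.
move=> sf sg; rewrite -RintegralZl//; last exact: square_integrableM.
by apply: eq_Rintegral => x _; rewrite mulrA.
Qed.

Lemma innerBl f g h : square_integrable f -> square_integrable g -> square_integrable h ->
  inner (fun x => f x - g x) h = inner f h - inner g h.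
Proof.
move=> sf sg sh; rewrite -RintegralB//; try exact: square_integrableM.
by apply: eq_Rintegral => x _; rewrite mulrBl.
Qed.

Lemma innerDr f g h : square_integrable f -> square_integrable g -> square_integrable h ->
  inner h (fun x => f x + g x) = inner h f + inner h g.
Proof. by move=> *; rewrite innerC innerDl// !(innerC h). Qed.
Lemma innerBr f g h : square_integrable f -> square_integrable g -> square_integrable h ->
  inner h (fun x => f x - g x) = inner h f - inner h g.
Proof. by move=> *; rewrite innerC innerBl// !(innerC h). Qed.
Lemma innerZr c f g : square_integrable f -> square_integrable g ->
  inner g (fun x => c * f x) = c * inner g f.
Proof. by move=> *; rewrite innerC innerZl// innerC. Qed.

Lemma inner_ge0 f : 0 <= inner f f.
Proof. by apply: Rintegral_ge0 => x _; rewrite -expr2 sqr_ge0. Qed.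

Lemma inner_CS f g : square_integrable f -> square_integrable g ->
  inner f g ^+ 2 <= inner f f * inner g g.
Proof.
move=> sf sg; apply: discriminant_le (inner_ge0 g) _ => t.
have st := square_integrableZ t sg.
have := inner_ge0 (fun x => f x + t * g x).
rewrite innerDl ?innerDr ?innerZl ?innerZr//; last exact: square_integrableD.
by rewrite (innerC g f); congr (_ <= _); ring.
Qed.

Definition l2norm f : R := Num.sqrt (inner f f).

Lemma l2norm_sqr f : l2norm f ^+ 2 = inner f f.
Proof. by rewrite sqr_sqrtr// inner_ge0. Qed.

Lemma l2norm_ge0 f : 0 <= l2norm f. Proof. exact: sqrtr_ge0. Qed.

Lemma inner_le f g : square_integrable f -> square_integrable g ->
  `|inner f g| <= l2norm f * l2norm g.
Proof.
move=> sf sg; rewrite -(@ler_pXn2r _ 2)// ?nnegrE ?mulr_ge0 ?l2norm_ge0//.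
by rewrite real_normK ?num_real// exprMn !l2norm_sqr inner_CS.
Qed.

Lemma l2normD f g : square_integrable f -> square_integrable g ->
  l2norm (fun x => f x + g x) <= l2norm f + l2norm g.
Proof.
move=> sf sg; rewrite -(@ler_pXn2r _ 2)// ?nnegrE ?addr_ge0 ?l2norm_ge0//.
rewrite l2norm_sqr innerDl ?innerDr ?(square_integrableD sf sg)//; last exact: square_integrableD.
have := inner_le sf sg; rewrite ler_norml => /andP[_].
rewrite sqrrD !l2norm_sqr (innerC g f) -mulr_natr.
move: (l2norm f * _) => c; move: (inner f g) (inner f f) (inner g g) => *; lra.
Qed.

Lemma l2normZ c f : square_integrable f -> l2norm (fun x => c * f x) = `|c| * l2norm f.
Proof.
move=> sf; have scf := square_integrableZ c sf.
by rewrite /l2norm innerZl// innerZr// mulrA -expr2 sqrtrM ?sqr_ge0// sqrtr_sqr.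
Qed.

Lemma l2normB f g : square_integrable f -> square_integrable g ->
  l2norm f <= l2norm g + l2norm (fun x => f x - g x).
Proof.
move=> sf sg; have := l2normD sg (square_integrableB sf sg).
rewrite /l2norm /inner; under eq_Rintegral do rewrite subrKC.
done.
Qed.

Lemma l2normC f g : l2norm (fun x => f x - g x) = l2norm (fun x => g x - f x).
Proof. by rewrite /l2norm; congr Num.sqrt; apply: eq_Rintegral => x _; ring. Qed.

Lemma Lfun2P f : f \in Lfun P 2%:E <-> square_integrable f.
Proof.
split=> [f2|[mf i]].
  split; last exact: Lfun2_integrable_sqr.
  by move: f2; rewrite inE => /andP[]; rewrite inE.
rewrite inE; apply/andP; split; rewrite inE//= /finite_norm unlock.
apply: poweR_lty; move/integrableP : i => [_]; apply: le_lt_trans.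
rewrite le_eqVlt; apply/orP; left; apply/eqP/eq_integral => x _ /=.
by rewrite powR_mulrn// normrX.
Qed.

Lemma Lnorm2E f : square_integrable f -> 'N[P]_2%:E[EFin \o f]%E = (l2norm f)%:E.
Proof.
move=> [mf i]; rewrite unlock.
have -> : (\int[P]_x `|(EFin \o f) x| `^ 2 = (inner f f)%:E)%E.
  rewrite /inner /Rintegral fineK; last first.
    by apply: integrable_fin_num (square_integrableM (conj mf i) (conj mf i)).
  by apply: eq_integral => x _ /=; rewrite powR_mulrn// real_normK ?num_real// expr2.
by rewrite poweR_EFin /l2norm powR12_sqrt ?inner_ge0.
Qed.

Lemma Lnorm2_cvg0 (f_ : nat -> T -> R) : (forall n, square_integrable (f_ n)) ->
  ('N[P]_2%:E[EFin \o f_ n])%E @[n --> \oo] --> 0%E <-> l2norm (f_ n) @[n --> \oo] --> 0.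
Proof.
move=> sf; rewrite (_ : (fun n => 'N[P]_2%:E[EFin \o f_ n])%E = EFin \o (fun n => l2norm (f_ n))).
  split=> [/fine_cvgP[_]//|c]; apply: cvg_EFin c; exact: nearW.
by apply/funext => n; rewrite Lnorm2E.
Qed.

Lemma l2norm_cvg (f_ : nat -> T -> R) f :
  (forall n, square_integrable (f_ n)) -> square_integrable f ->
  l2norm (fun x => f_ n x - f x) @[n --> \oo] --> 0 ->
  l2norm (f_ n) @[n --> \oo] --> l2norm f.
Proof.
move=> sf_ sf c; apply/subr_cvg0; apply/norm_cvg0P; apply: (squeeze_cvgr _ (cvg_cst 0) c).
apply: nearW => n; rewrite normr_ge0/= ler_norml.
have := l2normB (sf_ n) sf; have := l2normB sf (sf_ n); rewrite (l2normC f (f_ n)).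
by move=> *; apply/andP; split; lra.
Qed.

Definition recenter f (x : T) := f x - \int[P]_y f y.

Lemma square_integrable_recenter f : square_integrable f -> square_integrable (recenter f).
Proof.
by move=> sf; apply: square_integrableB => //; exact: square_integrable_bmf (bmf_cst _).
Qed.

Lemma inner_recenter f g : square_integrable f -> square_integrable g ->
  inner (recenter f) (recenter g) = inner f g - (\int[P]_x f x) * \int[P]_x g x.
Proof.
move=> sf sg.
have sc c : square_integrable (fun=> c) := square_integrable_bmf (bmf_cst c).
have ic c h : square_integrable h -> inner (fun=> c) h = c * \int[P]_x h x.
  by move=> sh; rewrite /inner RintegralZl//; exact: square_integrable_int.
have sgc : square_integrable (fun x => g x - \int[P]_y g y) := square_integrable_recenter sg.
rewrite /recenter innerBl// innerBr// (ic _ _ sgc) (innerC f (fun=> \int[P]_y g y)) (ic _ _ sf).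
rewrite RintegralB ?(prob_int_cst P); [ring|exact: measurableT|
  exact: square_integrable_int|exact: square_integrable_int (sc _)].
Qed.

(** Dominated convergence applied to the squares. *)
Lemma l2norm_dct (f_ : nat -> T -> R) g : square_integrable g ->
  (forall n, measurable_fun setT (f_ n)) ->
  (forall n x, `|f_ n x| <= `|g x|) -> (forall x, f_ n x @[n --> \oo] --> (0 : R)) ->
  l2norm (f_ n) @[n --> \oo] --> 0.
Proof.
move=> sg mf_ fg c.
have c2 x : (f_ n x) ^+ 2 @[n --> \oo] --> (0 : R).
  rewrite -[X in _ --> X](expr0n R 2); apply: (cvg_comp (fun n => f_ n x) (fun y => y ^+ 2) (c x)).
  exact: exprn_continuous.
have le n x : `|f_ n x ^+ 2| <= g x ^+ 2.
  by rewrite -(real_normK (num_real (g x))) normrX ler_pXn2r ?nnegrE.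
have [_] := Rintegral_dct (fun n => measurable_funX 2 (mf_ n)) c2 sg.2 le.
rewrite prob_int_cst => ci; rewrite -[X in _ --> X](@sqrtr0 R).
apply: (@cvg_comp _ _ _ (fun n => inner (f_ n) (f_ n)) Num.sqrt); last exact: sqrt_continuous.
apply: cvg_trans ci; apply: near_eq_cvg; apply: nearW => n.
by apply: eq_Rintegral => x _; rewrite expr2.
Qed.

(** Truncation of f where |f| > n. *)
Lemma square_integrable_approx f : square_integrable f ->
  exists f_ : nat -> T -> R, (forall n, bounded_measurable (f_ n)) /\
    l2norm (fun x => f_ n x - f x) @[n --> \oo] --> 0.
Proof.
move=> sf; pose f_ n x := if `|f x| <= n%:R then f x else 0.
have bf n : bounded_measurable (f_ n).
  split; last by exists n%:R => x; rewrite /f_; case: ifPn => //; rewrite normr0.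
  apply: measurable_fun_ifT; [|exact: sf.1|exact: measurable_cst].
  by apply: measurable_fun_ler => //; apply: measurableT_comp => //; exact: sf.1.
exists f_; split => //.
have c := @l2norm_dct (fun n x => f_ n x - f x) f sf; apply: c.
- by move=> n; apply: measurable_funB; [exact: (bf n).1|exact: sf.1].
- move=> n x; rewrite /f_; case: ifPn => _; first by rewrite subrr normr0.
  by rewrite sub0r normrN.
move=> x; apply: cvg_near_cst; near=> n; rewrite /f_ ifT ?subrr//.
by near: n; exact: nbhs_infty_ger.
Unshelve. all: by end_near. Qed.

End square_integrable.

(** * Transition operators with independent noise *)

(** Two random vectors with the same characteristic function have the same law, phrased for
integrals of bounded Borel functions so that [functional_monotone_class] applies. *)
Lemma int_eq_of_cos {R : realType} {H : completeNormedModType R} (dot : {dot H for idfun})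
  (dot_norm : forall x, dot x x = `|x| ^+ 2) (H_sep : @separable R H)
  {d d'} {T : measurableType d} {T' : measurableType d'}
  (P : probability T R) (P' : probability T' R) (Y : T -> borel H) (Y' : T' -> borel H) :
  measurable_fun setT Y -> measurable_fun setT Y' ->
  (forall h th, \int[P]_w cos (dot (Y w) h + th) = \int[P']_w cos (dot (Y' w) h + th)) ->
  forall f, bounded_measurable (f : borel H -> R) ->
  \int[P]_w f (Y w) = \int[P']_w f (Y' w).
Proof.
move=> mY mY' cosE f bf.
pose V : set (H -> R) := [set g | bounded_measurable (g : borel H -> R) /\
   \int[P]_w g (Y w) = \int[P']_w g (Y' w)].
suff [] : V f by [].
apply: (functional_monotone_class dot_norm H_sep (V := V)) bf.
- move=> _ [l ->]; split; first by apply: (bmf_trig dot_norm); exists l.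
  have b d0 (T0 : measurableType d0) (Y0 : T0 -> borel H) (mY0 : measurable_fun setT Y0)
      (q : R * H * R) : bounded_measurable (fun w => q.1.1 * cos (dot (Y0 w) q.1.2 + q.2)).
    by apply: bmfZ; exact: (bmf_comp mY0 (bmf_cos_dot dot_norm q.1.2 q.2)).
  have b' d0 (T0 : measurableType d0) (Y0 : T0 -> borel H) (mY0 : measurable_fun setT Y0)
      (q : R * H * R) : bounded_measurable (fun w => cos (dot (Y0 w) q.1.2 + q.2)).
    exact: (bmf_comp mY0 (bmf_cos_dot dot_norm q.1.2 q.2)).
  rewrite !bmf_int_sum; [|exact: b|exact: b]; apply: eq_bigr => q _.
  by rewrite !bmf_intZ ?cosE//; exact: b'.
- move=> g k [bg gE] [bk kE]; split; first exact: bmfD.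
  by rewrite !bmf_intD ?gE ?kE//; [exact: (bmf_comp mY' bg)|exact: (bmf_comp mY' bk)|
    exact: (bmf_comp mY bg)|exact: (bmf_comp mY bk)].
- move=> c g [bg gE]; split; first exact: bmfZ.
  by rewrite !bmf_intZ ?gE//; [exact: (bmf_comp mY' bg)|exact: (bmf_comp mY bg)].
move=> f_ g M Vf fM fg.
have mf_ n : measurable_fun setT (f_ n : borel H -> R) by exact: (Vf n).1.1.
have b0 : bounded_measurable (g : borel H -> R).
  split; first by apply: (measurable_fun_cvg mf_) => x _; exact: fg.
  exists M => x; have h := cvg_norm (fg x).
  by apply: (cvgr_to_le (h _)); apply: nearW => n; exact: fM.
split => //.
have [_ c1] := bmf_int_dct P (f_ := fun n w => f_ n (Y w)) (f := fun w => g (Y w)) (M := M)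
  (fun n => measurableT_comp (mf_ n) mY) (fun n w => fM n (Y w)) (fun w => fg (Y w)).
have [_ c2] := bmf_int_dct P' (f_ := fun n w => f_ n (Y' w)) (f := fun w => g (Y' w)) (M := M)
  (fun n => measurableT_comp (mf_ n) mY') (fun n w => fM n (Y' w)) (fun w => fg (Y' w)).
rewrite (funext (fun n => (Vf n).2)) in c1.
exact: cvg_unique c1 c2.
Qed.

Section transition.
Context {R : realType} {H : completeNormedModType R} (dot : {dot H for idfun}).
Context (dot_norm : forall x, dot x x = `|x| ^+ 2) (H_sep : @separable R H).
Context (mu : probability (borel H) R).
Context {d} {Omega : measurableType d} (P : probability Omega R).
Context (A L : H -> H) (AL : adjoint_of dot A L).
Context (X : Omega -> borel H) (mX : measurable_fun setT X).

(** Under mu x P the two components are independent, so the law of [flow] is that of one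
step of the process started from mu. *)
Definition flow (z : borel H * Omega) : borel H := A z.1 + (X z.2 : H).

Definition transition (phi : borel H -> R) (x : borel H) : R :=
  \int[P]_w phi (flow (x, w)).

Lemma measurable_flow : measurable_fun setT flow.
Proof.
apply: (measurable_to_borel dot_norm H_sep) => h; rewrite /flow.
under eq_fun do rewrite (dotDl dot) AL.
apply: measurable_funD.
  exact: (measurableT_comp (measurable_dot dot_norm (L h)) measurable_fst).
exact: (measurableT_comp (measurableT_comp (measurable_dot dot_norm h) mX) measurable_snd).
Qed.

Lemma measurable_flow1 x : measurable_fun setT (fun w => flow (x, w)).
Proof. exact: (measurableT_comp measurable_flow (measurable_pair1 x)). Qed.

Lemma flow_fubini f : bounded_measurable (f : borel H -> R) ->
  \int[(mu \x P)%E]_z f (flow z) = \int[mu]_x transition f x.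
Proof.
move=> bf; rewrite /Rintegral -integral12_prod_meas1; last first.
  exact: (bmf_integrable (mu \x P)%E (bmf_comp measurable_flow bf)).
congr fine; apply: eq_integral => x _; rewrite /fubini_F /transition /Rintegral fineK//.
apply: integrable_fin_num => //.
exact: (bmf_integrable P (bmf_comp (measurable_flow1 x) bf)).
Qed.

Context (v m : H -> R).
Context (X_cos : forall h th, \int[P]_w cos (dot (X w) h + th) = cos th * expR (- (v h / 2))).

(** The independent noise only contributes its characteristic function. *)
Lemma transition_cos h th x :
  transition (fun y => cos (dot y h + th)) x = expR (- (v h / 2)) * cos (dot x (L h) + th).
Proof.
rewrite mulrC -X_cos; apply: eq_Rintegral => w _.
by rewrite /flow (dotDl dot) AL; congr cos; ring.
Qed.

Context (mu_cos : forall h th, \int[mu]_x cos (dot x h + th) = cos th * expR (- (m h / 2))).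
Context (v_m : forall h, v h + m (L h) = m h).

(** Invariance of mu: the characteristic functions agree because the covariance of mu is
the sum of that of the noise and that of the image of mu under A. *)
Lemma flow_law f : bounded_measurable (f : borel H -> R) ->
  \int[(mu \x P)%E]_z f (flow z) = \int[mu]_x f x.
Proof.
apply: (int_eq_of_cos dot_norm H_sep measurable_flow (@measurable_id _ _ _)) => h th.
rewrite (flow_fubini (bmf_cos_dot dot_norm h th)).
transitivity (\int[mu]_x (expR (- (v h / 2)) * cos (dot x (L h) + th))).
  by apply: eq_Rintegral => x _; exact: transition_cos.
rewrite bmf_intZ; last exact: bmf_cos_dot.
by rewrite !mu_cos mulrCA -expRD -(v_m h); congr (_ * expR _); ring.
Qed.

Lemma flow_pushforward B : measurable B -> (mu \x P)%E (flow @^-1` B) = mu B.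
Proof.
move=> mB; have E := flow_law (bmf_indic mB).
have e1 : \int[(mu \x P)%E]_z (\1_B (flow z)) = fine ((mu \x P)%E (flow @^-1` B)).
  rewrite /Rintegral; congr fine.
  rewrite -[X in X = _]/(\int[(mu \x P)%E]_z (\1_(flow @^-1` B) z)%:E)%E.
  rewrite integral_indic//; first by rewrite setIT.
  by rewrite -[_ @^-1` _]setTI; exact: measurable_flow.
have e2 : \int[mu]_x (\1_B x) = fine (mu B).
  by rewrite /Rintegral integral_indic// setIT.
have mGB : measurable (flow @^-1` B).
  by rewrite -[_ @^-1` _]setTI; exact: measurable_flow.
have f1 : (mu \x P)%E (flow @^-1` B) \is a fin_num.
  by rewrite ge0_fin_numE//; exact: le_lt_trans (probability_le1 (mu \x P)%E mGB) (ltry 1).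
have f2 : mu B \is a fin_num.
  by rewrite ge0_fin_numE//; exact: le_lt_trans (probability_le1 mu mB) (ltry 1).
by rewrite -(fineK f1) -(fineK f2) -e1 -e2 E.
Qed.

(** Invariance for nonnegative functions that may be unbounded or infinite. *)
Lemma transition_tonelli (f : borel H -> \bar R) : measurable_fun setT f -> (forall x, 0 <= f x)%E ->
  measurable_fun setT (fun x => \int[P]_w f (flow (x, w)))%E /\
  (\int[mu]_x \int[P]_w f (flow (x, w)) = \int[mu]_x f x)%E.
Proof.
move=> mf f0.
have mff : measurable_fun setT (f \o flow) by exact: measurableT_comp mf measurable_flow.
split; first by have := @measurable_fun_fubini_tonelli_F _ _ _ _ R P (f \o flow) mff (fun z => f0 _); exact.
rewrite -[LHS](@fubini_tonelli1 _ _ _ _ _ mu P (f \o flow))//; last by move=> z; exact: f0.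
transitivity (\int[pushforward (mu \x P)%E flow]_y f y)%E.
  by rewrite ge0_integral_pushforward ?preimage_setT//; exact: measurable_flow.
by apply: eq_measure_integral => [|? B mB _]; [exact: measurable_flow|exact: flow_pushforward].
Qed.

Lemma measurable_transition phi : measurable_fun setT phi -> measurable_fun setT (transition phi).
Proof.
move=> mphi; rewrite /transition /Rintegral; apply: measurableT_comp => //.
have mE : measurable_fun setT (EFin \o phi) by exact/measurable_EFinP.
rewrite (_ : (fun x => _) = (fun x => \int[P]_w ((EFin \o phi)^\+ (flow (x, w)))
    - \int[P]_w ((EFin \o phi)^\- (flow (x, w))))%E); last first.
  apply/funext => x. rewrite [LHS]integralE; congr (_ - _)%E; apply: eq_integral => w _; by rewrite ?funeposE ?funenegE.
have [mp _] := transition_tonelli (measurable_funepos mE) (funepos_ge0 _).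
have [mn _] := transition_tonelli (measurable_funeneg mE) (funeneg_ge0 _).
exact: emeasurable_funB mp mn.
Qed.

Lemma bmf_transition phi : bounded_measurable phi -> bounded_measurable (transition phi).
Proof.
move=> [mphi [M phiM]]; split; first exact: measurable_transition.
exists M => x; apply: bmf_int_norm_le => //.
by apply: (bmf_comp (measurable_flow1 x)); split => //; exists M.
Qed.

(** Jensen's inequality. When the right-hand side is finite the integrals of phi and psi both
make sense; when it is infinite nothing is claimed, so an arbitrary measurable psi
is allowed. *)
Lemma transition_diff_le phi psi x : bounded_measurable phi -> measurable_fun setT psi ->
  (((transition phi x - transition psi x) ^+ 2)%:E <=
   \int[P]_w ((phi (flow (x, w)) - psi (flow (x, w))) ^+ 2)%:E)%E.
Proof.
move=> bphi mpsi.
have [->|ny] := eqVneq (\int[P]_w ((phi (flow (x, w)) - psi (flow (x, w))) ^+ 2)%:E)%E +oo%E.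
  by rewrite leey.
have bp : bounded_measurable (fun w => phi (flow (x, w))) := bmf_comp (measurable_flow1 x) bphi.
have mq : measurable_fun setT (fun w => psi (flow (x, w))).
  exact: (measurableT_comp mpsi (measurable_flow1 x)).
have sd : square_integrable P (fun w => phi (flow (x, w)) - psi (flow (x, w))).
  apply/square_integrable_ltyP; first exact: measurable_funB bp.1 mq.
  by rewrite lt_neqAle ny leey.
have sp := square_integrable_bmf P bp.
have sq : square_integrable P (fun w => psi (flow (x, w))).
  have := square_integrableB sp sd; congr square_integrable.
  by apply/funext => w; rewrite subKr.
have -> : transition phi x - transition psi x = \int[P]_w (phi (flow (x, w)) - psi (flow (x, w))).
  by rewrite RintegralB//; exact: square_integrable_int.
have := inner_CS sd (square_integrable_bmf P (bmf_cst 1)).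
rewrite /inner (prob_int_cst P) !mulr1 => h.
under [X in (_ <= X)%E]eq_integral do rewrite expr2.
rewrite -[X in (_ <= X)%E]fineK; last by apply: integrable_fin_num (square_integrableM sd sd).
rewrite lee_fin; apply: le_trans h; rewrite le_eqVlt; apply/orP; left; apply/eqP.
by congr (_ ^+ 2); apply: eq_Rintegral => w _; rewrite mulr1.
Qed.

(** The L2 contraction property, from Jensen's inequality and invariance. The function psi is
only square integrable, so that its image is a candidate for the continuous extension. *)
Lemma l2norm_transition_diff phi psi : bounded_measurable phi -> square_integrable mu psi ->
  square_integrable mu (transition psi) /\
  l2norm mu (fun x => transition phi x - transition psi x) <= l2norm mu (fun x => phi x - psi x).
Proof.
move=> bphi spsi.
have sd := square_integrableB (square_integrable_bmf mu bphi) spsi.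
have mtd := measurable_funB (measurable_transition bphi.1) (measurable_transition spsi.1).
have mdd : measurable_fun setT (fun y : borel H => ((phi y - psi y) ^+ 2)%:E).
  by apply/measurable_EFinP; apply: measurable_funX; exact: sd.1.
have ge0 y : (0 <= ((phi y - psi y) ^+ 2)%:E)%E by rewrite lee_fin sqr_ge0.
have [mt te] := transition_tonelli mdd ge0.
have le1 : (\int[mu]_x ((transition phi x - transition psi x) ^+ 2)%:E <=
    \int[mu]_x ((phi x - psi x) ^+ 2)%:E)%E.
  rewrite -te; apply: ge0_le_integral => //.
  - by move=> x _; rewrite lee_fin; exact: sqr_ge0.
  - by apply/measurable_EFinP; apply: measurable_funX; exact: mtd.
  - by move=> x _; exact: transition_diff_le bphi spsi.1.
have std : square_integrable mu (fun x => transition phi x - transition psi x).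
  apply/square_integrable_ltyP => //; apply: le_lt_trans le1 _.
  exact: ((square_integrable_ltyP mu sd.1).1 sd).
split.
  have := square_integrableB (square_integrable_bmf mu (bmf_transition bphi)) std.
  by congr square_integrable; apply/funext => x; rewrite subKr.
rewrite ler_wsqrtr// /inner -lee_fin /Rintegral !fineK; [|exact: integrable_fin_num (square_integrableM _ _)..].
by under eq_integral do rewrite -expr2; under [leRHS]eq_integral do rewrite -expr2.
Qed.

End transition.

(** * The Ornstein-Uhlenbeck semigroup on plane waves *)

Section ornstein_uhlenbeck.
Context {R : realType} {H : completeNormedModType R} (dot : {dot H for idfun}).
Context (dot_norm : forall x, dot x x = `|x| ^+ 2) (H_sep : @separable R H).
Context (E : set H) (E_basis : orthonormal_basis dot E).
Context (Q : {linear H -> H}) (Q_ge0 : selfadjoint_nonneg dot Q).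
Context (Qh : {linear H -> H}) (Qh_ge0 : selfadjoint_nonneg dot Qh)
  (Qh_sqrt : forall x, Qh (Qh x) = Q x).
Context (S : R -> {linear H -> H}) (S_semigroup : c0_semigroup S).
Context (T : R -> H -> H) (S_adj : forall t : R, 0 <= t -> adjoint_of dot (S t) (T t)).
Context (Qoo : H -> H)
    (Qoo_int : op_integral dot `[0, +oo[ (fun s x => S s (Q (T s x))) Qoo).
Context {d} {Omega : measurableType d} (P : probability Omega R).
Context (W : R -> H -> Omega -> R) (W_wiener : cylindrical_wiener dot P W).
Context (Z : R -> H -> Omega -> H) (Z_ou : ou_process dot P E S Qh W Z).
Context (mu : probability (borel H) R) (mu_gauss : gaussian_measure dot Qoo mu).
Implicit Types (s t u th : R) (h k x y : H) (phi psi f g : borel H -> R).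
Local Notation a := (aform dot Qoo).
Local Notation wave h th := (fun x : borel H => cos (dot x h + th)).

Lemma mu_cos h th : \int[mu]_x cos (dot x h + th) = cos th * expR (- (a h h / 2)).
Proof.
exact: gauss_cos (aform_ge0 S_adj Q_ge0 Qoo_int h) (mu_gauss h).
Qed.

(** The law of Z(t, x) - S(t) x does not depend on x, so the noise of the process started
at 0 serves for all x at once; S(t) x + noise is then jointly measurable in x and the
sample point. *)
Definition noise t (w : Omega) : borel H := Z t 0 w - S t 0.

Lemma measurable_noise t : 0 <= t -> measurable_fun setT (noise t).
Proof. by move=> t0; exact: (Z_ou 0 t0).1. Qed.

Lemma Z_cos t x h th : 0 <= t -> \int[P]_w cos (dot (Z t x w - S t x) h + th) =
  cos th * expR (- (vform dot T Qoo t h h / 2)).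
Proof.
move=> t0; exact: (stoch_integral_cos dot_norm E_basis S_semigroup S_adj Q_ge0 Qh_ge0
  Qh_sqrt Qoo_int W_wiener t0 h th (Z_ou x t0)).2.
Qed.

(** The Mehler form of R_t. *)
Definition ou_op t := transition P (S t) (noise t).

(** Z(t, x) and S(t) x + noise have the same characteristic function. *)
Lemma ou_semigroupE t phi x : 0 <= t -> bounded_measurable phi ->
  ou_semigroup P Z t phi x = ou_op t phi x.
Proof.
move=> t0; apply: (int_eq_of_cos dot_norm H_sep).
- apply: (measurable_to_borel dot_norm H_sep) => h.
  have := measurableT_comp (measurable_dot dot_norm h) (Z_ou x t0).1 => m.
  have := measurable_funD m (measurable_cst (dot (S t x) h)).
  by congr (measurable_fun _ _); apply/funext => w /=; rewrite -(dotDl dot) subrK.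
- exact: (measurable_flow1 dot_norm H_sep (S_adj t0) (measurable_noise t0)).
move=> h th; rewrite [RHS](transition_cos (S_adj t0) (fun h th => Z_cos 0 h th t0)).
rewrite mulrC -(Z_cos x)//; apply: eq_Rintegral => w _.
by rewrite -S_adj// addrA -(dotDl dot) subrK.
Qed.

Let vform_aform t h : 0 <= t -> vform dot T Qoo t h h + a (T t h) (T t h) = a h h.
Proof. by move=> t0; rewrite /vform subrK. Qed.

Lemma ou_op_cos t h th x : 0 <= t ->
  ou_op t (wave h th) x = expR (- (vform dot T Qoo t h h / 2)) * cos (dot x (T t h) + th).
Proof. by move=> t0; exact: (transition_cos (S_adj t0) (fun h th => Z_cos 0 h th t0)). Qed.

Lemma bmf_ou_op t phi : 0 <= t -> bounded_measurable phi -> bounded_measurable (ou_op t phi).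
Proof.
move=> t0; exact: (bmf_transition dot_norm H_sep (S_adj t0) (measurable_noise t0)
 (fun h th => Z_cos 0 h th t0) mu_cos (fun h => vform_aform h t0)).
Qed.

Lemma ou_op_contraction t phi psi : 0 <= t -> bounded_measurable phi -> square_integrable mu psi ->
  square_integrable mu (ou_op t psi) /\
  l2norm mu (fun x => ou_op t phi x - ou_op t psi x) <= l2norm mu (fun x => phi x - psi x).
Proof.
move=> t0; exact: (l2norm_transition_diff dot_norm H_sep (S_adj t0) (measurable_noise t0)
 (fun h th => Z_cos 0 h th t0) mu_cos (fun h => vform_aform h t0)).
Qed.

Lemma ou_op_mean t phi : 0 <= t -> bounded_measurable phi ->
  \int[mu]_x ou_op t phi x = \int[mu]_x phi x.
Proof.
move=> t0 bphi.
rewrite -(flow_law dot_norm H_sep (S_adj t0) (measurable_noise t0)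
 (fun h th => Z_cos 0 h th t0) mu_cos (fun h => vform_aform h t0) bphi).
symmetry; apply: (flow_fubini dot_norm H_sep mu P (S_adj t0) (measurable_noise t0)) => //.
Qed.

(** The set that defines the extension is not empty: truncations of phi converge to phi, and
their images converge to [ou_op] t phi by contraction. *)
Lemma ou2_spec t phi : 0 <= t -> square_integrable mu phi ->
  square_integrable mu (ou_semigroup2 P Z mu t phi) /\
  exists phi_ : nat -> borel H -> R,
    [/\ forall n, bounded_measurable (phi_ n),
        l2norm mu (fun x => phi_ n x - phi x) @[n --> \oo] --> 0 &
        l2norm mu (fun x => ou_op t (phi_ n) x - ou_semigroup2 P Z mu t phi x) @[n --> \oo] --> 0].
Proof.
move=> t0 sphi.
have E1 phi0 : bounded_measurable phi0 -> ou_semigroup P Z t phi0 = ou_op t phi0.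
  by move=> b; apply/funext => x; exact: ou_semigroupE.
have sB (f_ : nat -> borel H -> R) f : (forall n, bounded_measurable (f_ n)) -> square_integrable mu f ->
    forall n, square_integrable mu (f_ n \- f).
  by move=> bf sf n; apply: square_integrableB => //; exact: square_integrable_bmf.
have := @xgetPex _ (cst 0) [set psi | psi \in Lfun mu 2%:E /\
    exists phi_ : nat -> borel H -> R,
      [/\ forall n, bounded_borel (phi_ n),
          ('N[mu]_2%:E[EFin \o (phi_ n \- phi)%R])%E @[n --> \oo] --> 0%E &
          ('N[mu]_2%:E[EFin \o (ou_semigroup P Z t (phi_ n) \- psi)%R])%E
            @[n --> \oo] --> 0%E]] _.
case.
  have [phi_ [bphi cphi]] := square_integrable_approx sphi.
  have b0 : bounded_measurable (phi_ 0%N) by exact: bphi.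
  have [str _] := ou_op_contraction t0 b0 sphi.
  exists (ou_op t phi); split; first exact/Lfun2P.
  exists phi_; split => //.
    by apply/(Lnorm2_cvg0 (sB _ _ bphi sphi)).
  apply/Lnorm2_cvg0.
    by move=> n; rewrite E1//; apply: (sB (fun n => ou_op t (phi_ n))) => // m; exact: (bmf_ou_op t0 (bphi m)).
  apply: (squeeze_cvgr _ (cvg_cst 0) cphi); apply: nearW => n; rewrite l2norm_ge0/=.
  rewrite E1//; exact: (ou_op_contraction t0 (bphi n) sphi).2.
rewrite -/(ou_semigroup2 P Z mu t phi) => /Lfun2P sp [phi_ [bphi c1 c2]].
split=> //; exists phi_; split => //.
  by apply/(Lnorm2_cvg0 (sB _ _ bphi sphi)).
have E2 n : ou_semigroup P Z t (phi_ n) = ou_op t (phi_ n) by apply: E1; exact: bphi.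
move: c2; under eq_fun do rewrite E2.
move=> c2; apply/(Lnorm2_cvg0 (f_ := fun n => ou_op t (phi_ n) \- _)) => //.
by move=> n; apply: (sB (fun n => ou_op t (phi_ n))) => // m; exact: (bmf_ou_op t0 (bphi m)).
Qed.

(** Uniqueness of the extension, again by contraction. *)
Lemma ou2_bounded t phi : 0 <= t -> bounded_measurable phi ->
  l2norm mu (fun x => ou_semigroup2 P Z mu t phi x - ou_op t phi x) = 0.
Proof.
move=> t0 bphi.
have sphi := square_integrable_bmf mu bphi.
have [sp [phi_ [bphi_ c1 c2]]] := ou2_spec t0 sphi.
apply/eqP; rewrite eq_le l2norm_ge0 andbT.
have c3 : l2norm mu (fun x => ou_op t (phi_ n) x - ou_semigroup2 P Z mu t phi x) +
   l2norm mu (fun x => phi_ n x - phi x) @[n --> \oo] --> 0.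
  by rewrite -[X in _ --> X](addr0 (0 : R)); exact: cvgD.
apply: (cvgr_to_ge c3); apply: nearW => n.
have st := square_integrable_bmf mu (bmf_ou_op t0 bphi).
have sn := square_integrable_bmf mu (bmf_ou_op t0 (bphi_ n)).
apply: le_trans (lerD (lexx _) (ou_op_contraction t0 (bphi_ n) sphi).2).
rewrite [X in _ <= X + _]l2normC.
have := l2normD (square_integrableB sp sn) (square_integrableB sn st).
rewrite /l2norm /inner.
by under eq_Rintegral do rewrite addrA subrK.
Qed.

Let aC := aformC S_adj Q_ge0 Qoo_int.
Let aDl := aformDl dot_norm S_adj Qoo_int.
Let aBl h k y : a (h - k) y = a h y - a k y.
Proof. by rewrite -scaleN1r aDl (aformZl dot_norm S_adj Qoo_int) mulN1r. Qed.
Let aZl := aformZl dot_norm S_adj Qoo_int.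
Let aDr := aformDr dot_norm S_adj Q_ge0 Qoo_int.
Let aZr := aformZr dot_norm S_adj Q_ge0 Qoo_int.
Let a_ge0 := aform_ge0 S_adj Q_ge0 Qoo_int.
Let T0 := adjoint_at0 dot_norm S_semigroup S_adj.
Let TT := adj_semigroup dot_norm S_semigroup S_adj.
Let TZ := adjointZ dot_norm S_adj.

Let bmf_wave h th : bounded_measurable (wave h th).
Proof. exact: bmf_cos_dot. Qed.

Let si_wave h th : square_integrable mu (wave h th).
Proof. exact/square_integrable_bmf/bmf_wave. Qed.

(** The L2(mu) scalar product of two plane waves whose frequencies have variances A and B
and covariance c. *)
Definition pairing (A B th et c : R) : R :=
  2^-1 * expR (- ((A + B) / 2)) * (cos (th + et) * expR (- c) + cos (th - et) * expR c).

Lemma inner_waves h th k et :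
  inner mu (wave h th) (wave k et) = pairing (a h h) (a k k) th et (a h k).
Proof.
transitivity (\int[mu]_x (2^-1 * cos (dot x (h + k) + (th + et)) + 2^-1 * cos (dot x (h - k) + (th - et)))).
  apply: eq_Rintegral => x _; rewrite cosM_sum (dotDr dot) (dotBr dot) div1r.
  by congr (_ * cos _ + _ * cos _); ring.
rewrite bmf_intD; [|apply: bmfZ; exact: bmf_wave..].
rewrite !bmf_intZ; [|exact: bmf_wave..].
rewrite !mu_cos /pairing.
have e1 : expR (- (a (h + k) (h + k) / 2)) = expR (- ((a h h + a k k) / 2)) * expR (- a h k).
  by rewrite -expRD !(aDl, aDr) (aC k h); congr expR; field.
have e2 : expR (- (a (h - k) (h - k) / 2)) = expR (- ((a h h + a k k) / 2)) * expR (a h k).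
  by rewrite -expRD aBl (aC h (h - k)) (aC k (h - k)) !aBl (aC k h); congr expR; field.
rewrite e1 e2; ring.
Qed.

(** The damping factor of R_t turns the variances of the transported frequencies T_s h and
T_t k back into those of h and k: only the covariance changes. *)
Lemma inner_ou_op_waves s t h th k et : 0 <= s -> 0 <= t ->
  inner mu (ou_op s (wave h th)) (ou_op t (wave k et)) =
  pairing (a h h) (a k k) th et (a (T s h) (T t k)).
Proof.
move=> s0 t0.
rewrite (funext (fun x => ou_op_cos h th x s0)) (funext (fun x => ou_op_cos k et x t0)).
rewrite innerZl ?innerZr; [|exact: si_wave|exact: si_wave|exact: si_wave|
  by apply: square_integrableZ; exact: si_wave].
rewrite inner_waves /pairing.
have -> : expR (- ((a h h + a k k) / 2)) = expR (- (vform dot T Qoo s h h / 2)) *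
   expR (- (vform dot T Qoo t k k / 2)) * expR (- ((a (T s h) (T s h) + a (T t k) (T t k)) / 2)).
  by rewrite -!expRD /vform; congr expR; field.
ring.
Qed.

Lemma ou_op0_wave h th : ou_op 0 (wave h th) = wave h th.
Proof.
apply/funext => x; rewrite ou_op_cos// /vform T0 subrr mul0r oppr0 expR0 mul1r.
by [].
Qed.

Lemma ou2_inner t phi g : 0 <= t -> bounded_measurable phi -> square_integrable mu g ->
  inner mu (ou_semigroup2 P Z mu t phi) g = inner mu (ou_op t phi) g.
Proof.
move=> t0 bphi sg.
have [sp _] := ou2_spec t0 (square_integrable_bmf mu bphi).
have st := square_integrable_bmf mu (bmf_ou_op t0 bphi).
apply/eqP; rewrite -subr_eq0 -innerBl// -normr_le0.
have := inner_le (square_integrableB sp st) sg.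
by rewrite ou2_bounded// mul0r.
Qed.

Definition twice_sinh (c : R) := expR c - expR (- c).

Lemma twice_sinh_inj : injective twice_sinh.
Proof.
have lt (x y : R) : x < y -> twice_sinh x < twice_sinh y.
  by move=> xy; rewrite /twice_sinh ltrD ?ltrN2 ?ltr_expR// ltrN2.
by move=> x y e; case: (ltgtP x y) => // /lt; rewrite e ltxx.
Qed.

(** The phase that turns cosines into sines. *)
Let phase : R := - (pi / 2).

Lemma pairing_sin A B c : pairing A B phase phase c = 2^-1 * expR (- ((A + B) / 2)) * twice_sinh c.
Proof.
rewrite /pairing subrr cos0 mul1r.
have -> : phase + phase = - pi by rewrite /phase; field.
by rewrite cosN cospi /twice_sinh; ring.
Qed.

(** Both scalar products of the sines of frequencies h and k are the same nonzero multiple of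
a hyperbolic sine, at a(T_t h, k) and at a(h, T_t k). *)
Lemma symmetric_aform t h k : ou_symmetric P Z mu -> 0 <= t -> a (T t h) k = a h (T t k).
Proof.
move=> sym t0; have := sym t (wave h phase) (wave k phase) t0.
move=> /(_ ((Lfun2P _ _).2 (si_wave _ _)) ((Lfun2P _ _).2 (si_wave _ _))).
move=> e; have {e} : inner mu (ou_semigroup2 P Z mu t (wave h phase)) (wave k phase) =
  inner mu (ou_semigroup2 P Z mu t (wave k phase)) (wave h phase) by rewrite [RHS]innerC.
rewrite !ou2_inner// [RHS]innerC -{1}(ou_op0_wave k) -{2}(ou_op0_wave h).
rewrite !inner_ou_op_waves// !pairing_sin !T0.
move=> /mulfI e; apply: twice_sinh_inj; apply: e.
by rewrite mulf_neq0// lt0r_neq0// expR_gt0.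
Qed.

(** The decay for bounded functions, stated with [ou_op] so that no representative of an
L2 class has to be chosen. *)
Definition bounded_decay (b : R) := forall t phi, 0 <= t -> bounded_measurable phi ->
  l2norm mu (fun x => ou_op t phi x - \int[mu]_y phi y) <= expR (- (b * t)) * l2norm mu phi.

(** Linearization at s = 0, from 2 x e^{-x} <= e^x - e^{-x} <= 2 x e^x. *)
Lemma twice_sinh_decay_le (A B c : R) : 0 <= A -> 0 <= B -> 0 <= c ->
  (forall s, 0 < s -> twice_sinh (s * A) <= c * twice_sinh (s * B)) -> A <= c * B.
Proof.
move=> A0 B0 c0 hs.
have up s : twice_sinh s <= 2 * s * expR s.
  have -> : twice_sinh s = expR s * (1 - expR (- (2 * s))).
    by rewrite /twice_sinh mulrBr mulr1 -expRD; congr (_ - expR _); ring.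
  rewrite mulrC ler_wpM2r ?expR_ge0//.
  by have := expR_ge1Dx (- (2 * s)); move: (expR _) => e; lra.
have lo s : 2 * s * expR (- s) <= twice_sinh s.
  have -> : twice_sinh s = expR (- s) * (expR (2 * s) - 1).
    by rewrite /twice_sinh mulrBr mulr1 -expRD; congr (expR _ - _); ring.
  rewrite mulrC ler_wpM2l ?expR_ge0// lerBrDl; exact: expR_ge1Dx.
have key s : 0 < s -> A * expR (- (s * A)) <= c * (B * expR (s * B)).
  move=> s0; have := le_trans (lo (s * A)) (le_trans (hs s s0) (ler_wpM2l c0 (up _))).
  have -> : 2 * (s * A) * expR (- (s * A)) = (2 * s) * (A * expR (- (s * A))) by ring.
  have -> : c * (2 * (s * B) * expR (s * B)) = (2 * s) * (c * (B * expR (s * B))) by ring.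
  by rewrite ler_pM2l// mulr_gt0.
have cf : (fun s : R => A * expR (- (s * A))) s @[s --> 0^'+] --> A * expR (- (0 * A)).
  apply: cvg_at_right_filter; apply: cvgMr.
  apply: (@cvg_comp _ _ _ (fun s : R => - (s * A)) expR); last exact: continuous_expR.
  by apply: cvgN; apply: cvgMl; exact: cvg_id.
have cg : (fun s : R => c * (B * expR (s * B))) s @[s --> 0^'+] --> c * (B * expR (0 * B)).
  apply: cvg_at_right_filter; apply: cvgMr; apply: cvgMr.
  apply: (@cvg_comp _ _ _ (fun s : R => s * B) expR); last exact: continuous_expR.
  by apply: cvgMl; exact: cvg_id.
have := ler_cvg_to cf cg; rewrite !mul0r oppr0 expR0 !mulr1; apply.
by near=> s; apply: key; near: s; exact: nbhs_right_gt.
Unshelve. all: by end_near. Qed.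

(** The decay for the sine of frequency r h, of mean zero, with r^2 = s. *)
Lemma bounded_decay_aform b : bounded_decay b -> forall t h, 0 <= t ->
  a (T t h) (T t h) <= expR (- (2 * b * t)) * a h h.
Proof.
move=> D t h t0; apply: twice_sinh_decay_le; [exact: a_ge0|exact: a_ge0|exact: expR_ge0|].
move=> s s0; pose r := Num.sqrt s.
have rr : r * r = s by rewrite -expr2 sqr_sqrtr// ltW.
have := D t (wave (r *: h) phase) t0 (bmf_wave _ _).
rewrite mu_cos /phase cosN cos_pihalf mul0r -/phase.
rewrite -(@ler_pXn2r _ 2)// ?nnegrE ?mulr_ge0 ?l2norm_ge0 ?expR_ge0//.
rewrite exprMn !l2norm_sqr.
have -> : (fun x => ou_op t (wave (r *: h) phase) x - 0) = ou_op t (wave (r *: h) phase).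
  by apply/funext => x; rewrite subr0.
rewrite -{3 4}(ou_op0_wave (r *: h)) !inner_ou_op_waves// !pairing_sin T0 TZ// !(aZl, aZr) !mulrA rr.
have -> : expR (- (b * t)) ^+ 2 = expR (- (2 * b * t)).
  by rewrite -expRM_natl; congr expR; ring.
set e := expR _; set c := expR _; set p := twice_sinh _; set q := twice_sinh _ => le.
have e0 : 0 < 2^-1 * e by rewrite mulr_gt0// expR_gt0.
rewrite -(ler_pM2l e0); have -> : 2^-1 * e * (c * q) = c / 2 * e * q by ring.
exact: le.
Qed.

(** * From decay of the covariance form to decay in mean square *)

Lemma ou_op_trig t l : 0 <= t ->
  ou_op t (trig_poly dot l) = (fun x : borel H => \sum_(q <- l) q.1.1 * ou_op t (wave q.1.2 q.2) x).
Proof.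
move=> t0; apply/funext => x.
have mf := measurable_flow1 dot_norm H_sep (S_adj t0) (measurable_noise t0) x.
have b (q : R * H * R) : bounded_measurable (fun w =>
    cos (dot (flow (S t) (noise t) (x, w)) q.1.2 + q.2)) := bmf_comp mf (bmf_wave q.1.2 q.2).
rewrite /ou_op /transition /trig_poly bmf_int_sum; last by move=> q; exact/bmfZ/b.
by apply: eq_bigr => q _; rewrite bmf_intZ//; exact: b.
Qed.

Lemma ou_op0_trig l : ou_op 0 (trig_poly dot l) = trig_poly dot l.
Proof.
by rewrite ou_op_trig//; apply/funext => x; apply: eq_bigr => q _; rewrite ou_op0_wave.
Qed.

Let bmf_trig_poly l : bounded_measurable (trig_poly dot l : borel H -> R).
Proof. by apply: (bmf_trig dot_norm); exists l. Qed.

Lemma inner_ou_op_trig s t l : 0 <= s -> 0 <= t ->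
  inner mu (ou_op s (trig_poly dot l)) (ou_op t (trig_poly dot l)) =
  \sum_(p <- l) \sum_(q <- l) p.1.1 * q.1.1 *
     pairing (a p.1.2 p.1.2) (a q.1.2 q.1.2) p.2 q.2 (a (T s p.1.2) (T t q.1.2)).
Proof.
move=> s0 t0; rewrite !ou_op_trig//.
have b u (q : R * H * R) : 0 <= u -> bounded_measurable (ou_op u (wave q.1.2 q.2)).
  by move=> u0; apply: bmf_ou_op.
transitivity (\int[mu]_x (\sum_(p <- l) \sum_(q <- l) p.1.1 * q.1.1 *
   (ou_op s (wave p.1.2 p.2) x * ou_op t (wave q.1.2 q.2) x))).
  apply: eq_Rintegral => x _; rewrite mulr_suml; apply: eq_bigr => p _.
  by rewrite mulr_sumr; apply: eq_bigr => q _; ring.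
have bpq (p q : R * H * R) : bounded_measurable (fun x : borel H => p.1.1 * q.1.1 *
   (ou_op s (wave p.1.2 p.2) x * ou_op t (wave q.1.2 q.2) x)).
  by apply: bmfZ; apply: bmfM; exact: b.
rewrite bmf_int_sum; last by move=> p; exact: bmf_sum.
apply: eq_bigr => p _; rewrite bmf_int_sum//; apply: eq_bigr => q _.
rewrite bmf_intZ -?inner_ou_op_waves//; by apply: bmfM; exact: b.
Qed.

Lemma pairing0 A B th et :
  pairing A B th et 0 = cos th * expR (- (A / 2)) * (cos et * expR (- (B / 2))).
Proof.
rewrite /pairing oppr0 expR0 !mulr1.
have -> : expR (- ((A + B) / 2)) = expR (- (A / 2)) * expR (- (B / 2)).
  by rewrite -expRD; congr expR; field.
by rewrite cosD cosB; field.
Qed.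

(** The squared mean is the double sum of [inner_ou_op_trig] with covariances replaced by 0,
as if distinct plane waves were independent. *)
Lemma trig_mean_sqr l : (\int[mu]_x trig_poly dot l x) ^+ 2 =
  \sum_(p <- l) \sum_(q <- l) p.1.1 * q.1.1 *
     pairing (a p.1.2 p.1.2) (a q.1.2 q.1.2) p.2 q.2 0.
Proof.
have -> : \int[mu]_x trig_poly dot l x =
    \sum_(q <- l) q.1.1 * (cos q.2 * expR (- (a q.1.2 q.1.2 / 2))).
  rewrite /trig_poly bmf_int_sum; last by move=> q; exact/bmfZ/bmf_wave.
  by apply: eq_bigr => q _; rewrite bmf_intZ ?mu_cos//; exact: bmf_wave.
rewrite expr2 mulr_suml; apply: eq_bigr => p _; rewrite mulr_sumr; apply: eq_bigr => q _.
by rewrite pairing0; ring.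
Qed.

Lemma expR_sub1_le (x : R) : `|expR x - 1| <= `|x| * expR `|x|.
Proof.
have h1 := expR_ge1Dx x; have h2 := expR_ge1Dx (- x).
have xx : expR x * (1 - x) <= 1.
  by rewrite -[leRHS](expRxMexpNx_1 x) ler_wpM2l ?expR_ge0.
have [x0|x0] := leP 0 x.
  have e1 : 1 <= expR x by rewrite -expR0 ler_expR.
  rewrite (ger0_norm x0) ger0_norm ?subr_ge0//.
  by move: xx; rewrite mulrBr mulr1 mulrC; lra.
have : expR x <= 1 by rewrite -expR0 ler_expR ltW.
move=> e1; rewrite (ltr0_norm x0) ler0_norm ?subr_le0//.
have : 1 <= expR (- x) by rewrite -expR0 ler_expR oppr_ge0 ltW.
move=> e2; apply: (@le_trans _ _ (- x * 1)); first lra.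
by rewrite ler_wpM2l// oppr_ge0 ltW.
Qed.

Lemma pairing_dist (A B th et c D : R) : 0 <= A -> 0 <= B -> `|c| <= D ->
  `|pairing A B th et c - pairing A B th et 0| <= `|c| * expR D.
Proof.
move=> A0 B0 cD.
rewrite /pairing oppr0 expR0 !mulr1 -mulrBr normrM.
have e0 : `|2^-1 * expR (- ((A + B) / 2))| <= 2^-1.
  rewrite ger0_norm ?mulr_ge0 ?expR_ge0// ler_piMr// -expR0 ler_expR oppr_le0.
  by rewrite divr_ge0// addr_ge0.
have h (x : R) : `|x| = `|c| -> `|expR x - 1| <= `|c| * expR D.
  move=> xc; apply: le_trans (expR_sub1_le x) _; rewrite xc.
  by rewrite ler_wpM2l// ler_expR.
have cb (x y : R) : `|cos x * y| <= `|y|.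
  by rewrite normrM ler_piMl// ler_norml cos_geN1 cos_le1.
have -> : cos (th + et) * expR (- c) + cos (th - et) * expR c - (cos (th + et) + cos (th - et)) =
   cos (th + et) * (expR (- c) - 1) + cos (th - et) * (expR c - 1) by ring.
have -> : `|c| * expR D = 2^-1 * (`|c| * expR D + `|c| * expR D) by field.
apply: ler_pM => //; apply: le_trans (ler_normD _ _) _; apply: lerD.
  by apply: le_trans (cb _ _) _; apply: h; rewrite normrN.
by apply: le_trans (cb _ _) _; exact: h.
Qed.

Section symmetric.
Context (aT : forall t h k, 0 <= t -> a (T t h) k = a h (T t k)).
Context (b : R) (a_decay : forall t h, 0 <= t ->
  a (T t h) (T t h) <= expR (- (2 * b * t)) * a h h).

(** The rate max(b, 0) is available because T_t always contracts a; a nonnegative rate keeps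
the exponentials of the covariances bounded. *)
Let g := Num.max b 0.

Let a_decay_g t h : 0 <= t -> a (T t h) (T t h) <= expR (- (2 * g * t)) * a h h.
Proof.
move=> t0; rewrite /g; case: (leP b 0) => [_|_]; last exact: a_decay.
rewrite mulr0 mul0r oppr0 expR0 mul1r.
exact: (aform_adj_le dot_norm S_semigroup S_adj Q_ge0 Qoo_int).
Qed.

Let g0 : 0 <= g. Proof. by rewrite le_max lexx orbT. Qed.

Let a_cross_decay t h k : 0 <= t -> `|a h (T t k)| <= expR (- (g * t)) * (a h h + a k k).
Proof.
move=> t0; have D0 : 0 <= a h h + a k k by rewrite addr_ge0.
rewrite -(@ler_pXn2r _ 2)// ?nnegrE ?mulr_ge0 ?expR_ge0//.
rewrite real_normK ?num_real// exprMn.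
apply: le_trans (aform_CS dot_norm S_adj Q_ge0 Qoo_int h (T t k)) _.
apply: (@le_trans _ _ (a h h * (expR (- (2 * g * t)) * a k k))).
  by rewrite ler_wpM2l// a_decay_g.
rewrite mulrCA -expRM_natl; have -> : 2%:R * - (g * t) = - (2 * g * t) by ring.
rewrite ler_wpM2l ?expR_ge0//; have := a_ge0 h; have := a_ge0 k; rewrite expr2.
move: (a h h) (a k k) => A B *; nra.
Qed.

Let si_ou_op_trig u l : 0 <= u -> square_integrable mu (ou_op u (trig_poly dot l)).
Proof. by move=> u0; apply/square_integrable_bmf/bmf_ou_op/bmf_trig_poly. Qed.

(** The covariance of R_s phi and R_t phi, a function of s + t by symmetry. *)
Definition trig_cov u l := \sum_(p <- l) \sum_(q <- l) p.1.1 * q.1.1 *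
    (pairing (a p.1.2 p.1.2) (a q.1.2 q.1.2) p.2 q.2 (a p.1.2 (T u q.1.2)) -
     pairing (a p.1.2 p.1.2) (a q.1.2 q.1.2) p.2 q.2 0).

Lemma trig_covariance s u l : 0 <= s -> 0 <= u ->
  inner mu (recenter mu (ou_op s (trig_poly dot l))) (recenter mu (ou_op u (trig_poly dot l))) =
  trig_cov (s + u) l.
Proof.
move=> s0 u0.
apply: (etrans (inner_recenter (si_ou_op_trig l s0) (si_ou_op_trig l u0))).
rewrite (ou_op_mean s0 (bmf_trig_poly l)) (ou_op_mean u0 (bmf_trig_poly l)).
rewrite -expr2 trig_mean_sqr inner_ou_op_trig// -sumrB.
apply: eq_bigr => p _; rewrite -sumrB; apply: eq_bigr => q _.
by rewrite -mulrBr aT// TT.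
Qed.

Let D (p q : R * H * R) := a p.1.2 p.1.2 + a q.1.2 q.1.2.

Lemma trig_cov_le l u : 0 <= u -> trig_cov u l <=
  (\sum_(p <- l) \sum_(q <- l) `|p.1.1 * q.1.1| * (D p q * expR (D p q))) * expR (- (g * u)).
Proof.
move=> u0; rewrite /trig_cov mulr_suml.
apply: ler_sum => p _; rewrite mulr_suml; apply: ler_sum => q _.
apply: le_trans (ler_norm _) _; rewrite normrM -mulrA ler_wpM2l//.
have D0 : 0 <= D p q by rewrite addr_ge0.
have c1 : `|a p.1.2 (T u q.1.2)| <= expR (- (g * u)) * D p q by exact: a_cross_decay.
have c2 : `|a p.1.2 (T u q.1.2)| <= D p q.
  apply: le_trans c1 _; rewrite ler_piMl// -expR0 ler_expR oppr_le0 mulr_ge0//.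
apply: le_trans (pairing_dist _ _ (a_ge0 _) (a_ge0 _) c2) _.
rewrite [leRHS](_ : _ = (expR (- (g * u)) * D p q) * expR (D p q)); last by ring.
by rewrite ler_wpM2r ?expR_ge0.
Qed.

(** With f(t) = [trig_cov] t, the squared norm of R_t phi minus its mean is f(2t), and
Cauchy-Schwarz for R_t phi and phi gives the doubling inequality. *)
Lemma trig_decay t l : 0 <= t ->
  l2norm mu (fun x => ou_op t (trig_poly dot l) x - \int[mu]_y trig_poly dot l y) <=
  expR (- (b * t)) * l2norm mu (trig_poly dot l).
Proof.
move=> t0.
pose psi u := recenter mu (ou_op u (trig_poly dot l)).
have spsi u : 0 <= u -> square_integrable mu (psi u).
  by move=> u0; apply: square_integrable_recenter; exact: si_ou_op_trig.
have psi0 : inner mu (psi 0) (psi 0) <= inner mu (trig_poly dot l) (trig_poly dot l).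
  rewrite /psi (inner_recenter (si_ou_op_trig l (lexx 0)) (si_ou_op_trig l (lexx 0))).
  by rewrite ou_op0_trig lerBlDr lerDl -expr2 sqr_ge0.
have psiE : (fun x => ou_op t (trig_poly dot l) x - \int[mu]_y trig_poly dot l y) = psi t.
  by apply/funext => x; rewrite /psi /recenter (ou_op_mean t0 (bmf_trig_poly l)).
have covE s u : 0 <= s -> 0 <= u -> inner mu (psi s) (psi u) = trig_cov (s + u) l.
  by move=> s0 u0; exact: trig_covariance.
move: psi spsi psi0 psiE covE => psi spsi psi0 -> covE.
have f_ge0 u : 0 <= u -> 0 <= trig_cov u l.
  move=> u0; have u2 : 0 <= u / 2 by rewrite divr_ge0.
  by have := covE _ _ u2 u2; rewrite -splitr => <-; exact: inner_ge0.
have f_sqr u : 0 <= u -> trig_cov u l ^+ 2 <= trig_cov 0 l * trig_cov (2 * u) l.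
  move=> u0; rewrite mulrC mulr_natl mulr2n -(covE u u)//.
  have := covE 0 0 (lexx 0) (lexx 0); rewrite addr0 => <-.
  have := covE u 0 u0 (lexx 0); rewrite addr0 => <-.
  by apply: inner_CS; exact: spsi.
have := doubling_decay f_ge0 f_sqr (trig_cov_le l) (mulr_ge0 (ler0n R 2) t0).
rewrite mulr_natl mulr2n -(covE t t)//.
have := covE 0 0 (lexx 0) (lexx 0); rewrite addr0 => <- h.
rewrite -(@ler_pXn2r _ 2)// ?nnegrE ?mulr_ge0 ?l2norm_ge0 ?expR_ge0//.
rewrite exprMn !l2norm_sqr -expRM_natl.
apply: le_trans h _; apply: ler_pM; rewrite ?expR_ge0 ?inner_ge0//.
have bg : 0 <= (g - b) * t by rewrite mulr_ge0// subr_ge0 le_max lexx.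
by rewrite ler_expR; move: bg; rewrite mulrBl mulrDr; set x := g * t; set y := b * t; lra.
Qed.

End symmetric.

Lemma l2norm_cst (c : R) : l2norm mu (fun=> c) = `|c|.
Proof. by rewrite /l2norm /inner prob_int_cst -expr2 sqrtr_sqr. Qed.

Lemma mean_dist_le f phi : square_integrable mu f -> square_integrable mu phi ->
  `|\int[mu]_x f x - \int[mu]_x phi x| <= l2norm mu (fun x => f x - phi x).
Proof.
move=> sf sphi; have sd := square_integrableB sf sphi.
rewrite -RintegralB//; [|exact: square_integrable_int..].
have := inner_le sd (square_integrable_bmf mu (bmf_cst 1)).
by rewrite l2norm_cst normr1 mulr1 /inner; under eq_Rintegral do rewrite mulr1.
Qed.

Lemma decay_limit (c : R) (phi_ psi_ : nat -> borel H -> R) phi psi :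
  (forall n, square_integrable mu (phi_ n)) -> (forall n, square_integrable mu (psi_ n)) ->
  square_integrable mu phi -> square_integrable mu psi ->
  l2norm mu (fun x => phi_ n x - phi x) @[n --> \oo] --> 0 ->
  l2norm mu (fun x => psi_ n x - psi x) @[n --> \oo] --> 0 ->
  (forall n, l2norm mu (fun x => psi_ n x - \int[mu]_y phi_ n y) <= c * l2norm mu (phi_ n)) ->
  l2norm mu (fun x => psi x - \int[mu]_y phi y) <= c * l2norm mu phi.
Proof.
move=> sphi_ spsi_ sphi spsi cphi cpsi D.
have sc (e : R) : square_integrable mu (fun=> e) := square_integrable_bmf mu (bmf_cst e).
have c1 : l2norm mu (phi_ n) @[n --> \oo] --> l2norm mu phi by exact: l2norm_cvg.
have c2 : l2norm mu (fun x => psi_ n x - \int[mu]_y phi_ n y) @[n --> \oo] -->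
    l2norm mu (fun x => psi x - \int[mu]_y phi y).
  have cv := @l2norm_cvg _ _ _ mu (fun n x => psi_ n x - \int[mu]_y phi_ n y)
    (fun x => psi x - \int[mu]_y phi y); apply: cv.
  - by move=> n; exact: square_integrableB.
  - exact: square_integrableB.
  have c3 : l2norm mu (fun x => psi_ n x - psi x) + l2norm mu (fun x => phi_ n x - phi x) @[n --> \oo] --> 0.
    by rewrite -[X in _ --> X](addr0 (0 : R)); exact: cvgD.
  apply: (squeeze_cvgr _ (cvg_cst 0) c3); apply: nearW => n; rewrite l2norm_ge0/=.
  apply: le_trans (lerD (lexx _) (mean_dist_le (sphi_ n) sphi)).
  rewrite -normrN -l2norm_cst.
  have := l2normD (square_integrableB (spsi_ n) spsi)
    (sc (- (\int[mu]_x phi_ n x - \int[mu]_x phi x))).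
  congr (_ <= _); congr l2norm; apply/funext => x; ring.
have c4 : c * l2norm mu (phi_ n) @[n --> \oo] --> c * l2norm mu phi by exact: cvgMr.
by apply: (ler_cvg_to c2 c4); apply: nearW => n; exact: D.
Qed.

(** The functions that are L2 limits of trigonometric polynomials form a vector space closed
under bounded pointwise limits. *)
Lemma trig_dense phi : bounded_measurable phi ->
  exists l_ : nat -> seq (R * H * R),
    l2norm mu (fun x => trig_poly dot (l_ n) x - phi x) @[n --> \oo] --> 0.
Proof.
move=> bphi.
have sc (e : R) : square_integrable mu (fun=> e) := square_integrable_bmf mu (bmf_cst e).
pose V : set (H -> R) := [set f | bounded_measurable (f : borel H -> R) /\
  forall e : R, 0 < e -> exists l, l2norm mu (fun x : borel H => trig_poly dot l x - f x) <= e].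
have [_ dense] : V phi.
  apply: (functional_monotone_class dot_norm H_sep (V := V)) bphi.
  - move=> _ [l ->]; split; first exact: bmf_trig_poly.
    move=> e e0; exists l; under eq_fun do rewrite subrr.
    by rewrite l2norm_cst normr0 ltW.
  - move=> f g [bf df] [bg dg]; split; first exact: bmfD.
    move=> e e0; have e2 : 0 < e / 2 by rewrite divr_gt0.
    have [l1 h1] := df _ e2; have [l2 h2] := dg _ e2.
    exists (l1 ++ l2); have -> : e = e / 2 + e / 2 by field.
    apply: le_trans (lerD h1 h2).
    have s1 l f0 : bounded_measurable (f0 : borel H -> R) ->
        square_integrable mu (fun x : borel H => trig_poly dot l x - f0 x).
      move=> b0; apply: square_integrable_bmf; apply: bmfB => //; exact: bmf_trig_poly.
    apply: le_trans (l2normD (s1 l1 _ bf) (s1 l2 _ bg)); rewrite le_eqVlt; apply/orP; left; apply/eqP.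
    by congr l2norm; apply/funext => x; rewrite /trig_poly big_cat/=; ring.
  - move=> c f [bf df]; split; first exact: bmfZ.
    move=> e e0; have e2 : 0 < e / (`|c| + 1) by rewrite divr_gt0// ltr_wpDl.
    have [l h] := df _ e2.
    have [l' l'E] := is_trigZ c (ex_intro (fun l => _ = trig_poly dot l) l erefl).
    exists l'; rewrite -l'E.
    have -> : (fun x : borel H => c * trig_poly dot l x - c * f x) =
      (fun x => c * (trig_poly dot l x - f x)) by apply/funext => x; rewrite mulrBr.
    rewrite l2normZ; last first.
      by apply: square_integrable_bmf; apply: bmfB => //; exact: bmf_trig_poly.
    apply: le_trans (ler_wpM2l (normr_ge0 c) h) _.
    by rewrite mulrA ler_pdivrMr ?ltr_wpDl// mulrC ler_pM2l// lerDl.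
  move=> f_ f M Vf fM ff.
  have [bf _] := bmf_int_dct mu (fun n => (Vf n).1.1) fM ff.
  split=> // e e0; have e2 : 0 < e / 2 by rewrite divr_gt0.
  have c0 : l2norm mu (fun x : borel H => f_ n x - f x) @[n --> \oo] --> 0.
    have [_ [M' fM']] := bf.
    have cv := @l2norm_dct _ _ _ mu (fun n (x : borel H) => f_ n x - f x) _ (sc (M + M')); apply: cv.
    - by move=> n; apply: measurable_funB; [exact: (Vf n).1.1|exact: bf.1].
    - move=> n x; apply: le_trans (ler_normB _ _) _; apply: le_trans (ler_norm _).
      by rewrite lerD.
    by move=> x; rewrite -[X in _ --> X](subrr (f x)); apply: cvgB => //; exact: cvg_cst.
  have [n _ /(_ n (leqnn n)) hn] := cvgr_le 0 c0 _ e2.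
  have [l h] := (Vf n).2 _ e2; exists l.
  have -> : e = e / 2 + e / 2 by field.
  apply: le_trans (lerD h hn).
  have sfn := square_integrable_bmf mu (Vf n).1.
  have s1 := square_integrableB (square_integrable_bmf mu (bmf_trig_poly l)) sfn.
  have s2 := square_integrableB sfn (square_integrable_bmf mu bf).
  apply: le_trans (l2normD s1 s2); rewrite le_eqVlt; apply/orP; left; apply/eqP.
  by congr l2norm; apply/funext => x; ring.
have pos n : 0 < n.+1%:R^-1 :> R by rewrite invr_gt0.
have [l_ hl] := choice (fun n => dense _ (pos n)).
exists l_; apply: (squeeze_cvgr _ (cvg_cst 0) cvg_harmonic); apply: nearW => n.
by rewrite l2norm_ge0 hl.
Qed.

Lemma aform_bounded_decay b : (forall t h k, 0 <= t -> a (T t h) k = a h (T t k)) ->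
  (forall t h, 0 <= t -> a (T t h) (T t h) <= expR (- (2 * b * t)) * a h h) -> bounded_decay b.
Proof.
move=> aT D t phi t0 bphi; have [l_ cl] := trig_dense bphi.
have sl n := square_integrable_bmf mu (bmf_trig_poly (l_ n)).
have sphi := square_integrable_bmf mu bphi.
have bl n := bmf_ou_op t0 (bmf_trig_poly (l_ n)).
apply: (decay_limit (phi_ := fun n => trig_poly dot (l_ n))
   (psi_ := fun n => ou_op t (trig_poly dot (l_ n)))) => //.
- by move=> n; exact: square_integrable_bmf.
- exact: (ou_op_contraction t0 bphi sphi).1.
- apply: (squeeze_cvgr _ (cvg_cst 0) cl); apply: nearW => n; rewrite l2norm_ge0/=.
  exact: (ou_op_contraction t0 (bmf_trig_poly (l_ n)) sphi).2.
by move=> n; exact: trig_decay.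
Qed.

Lemma ou2_decay_iff b : bounded_decay b <->
  (forall t phi, 0 <= t -> phi \in Lfun mu 2%:E ->
      ('N[mu]_2%:E[EFin \o (fun x =>
          (ou_semigroup2 P Z mu t phi x - \int[mu]_y phi y)%R)]
       <= (expR (- (b * t)))%:E * 'N[mu]_2%:E[EFin \o phi])%E).
Proof.
have sc (e : R) : square_integrable mu (fun=> e) := square_integrable_bmf mu (bmf_cst e).
split=> [D t phi t0 /Lfun2P sphi|D t phi t0 bphi].
  have [sp [phi_ [bphi_ c1 c2]]] := ou2_spec t0 sphi.
  rewrite !Lnorm2E//; last exact: square_integrableB.
  rewrite -EFinM lee_fin.
  apply: (decay_limit (phi_ := phi_) (psi_ := fun n => ou_op t (phi_ n))) => //.
  - by move=> n; exact: square_integrable_bmf.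
  - by move=> n; apply: square_integrable_bmf; exact: bmf_ou_op.
  by move=> n; exact: D.
have sphi := square_integrable_bmf mu bphi.
have st := square_integrable_bmf mu (bmf_ou_op t0 bphi).
have [sp _] := ou2_spec t0 sphi.
have := D t phi t0 ((Lfun2P _ _).2 sphi); rewrite !Lnorm2E//; last exact: square_integrableB.
rewrite -EFinM lee_fin; apply: le_trans.
have sm := square_integrableB st (sc (\int[mu]_y phi y)).
have := l2normB sm (square_integrableB sp (sc (\int[mu]_y phi y))).
have -> : (fun x => ou_op t phi x - \int[mu]_y phi y -
   (ou_semigroup2 P Z mu t phi x - \int[mu]_y phi y)) =
   (fun x => ou_op t phi x - ou_semigroup2 P Z mu t phi x) by apply/funext => x; ring.
by rewrite (l2normC mu (ou_op t phi) (ou_semigroup2 P Z mu t phi)) ou2_bounded// addr0.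
Qed.
End ornstein_uhlenbeck.

(** * The conjugate semigroup *)

Section conjugate_semigroup.
Context {R : realType} {H : completeNormedModType R} (dot : {dot H for idfun}).
Context (dot_norm : forall x, dot x x = `|x| ^+ 2).
Context (S : R -> {linear H -> H}) (S_semigroup : c0_semigroup S).
Context (T : R -> H -> H) (S_adj : forall t : R, 0 <= t -> adjoint_of dot (S t) (T t)).
Context (Q : {linear H -> H}) (Q_bounded : continuous Q) (Q_ge0 : selfadjoint_nonneg dot Q).
Context (Qh : {linear H -> H}) (Qh_bounded : continuous Qh) (Qh_ge0 : selfadjoint_nonneg dot Qh)
  (Qh_sqrt : forall x, Qh (Qh x) = Q x).
Context (Qoo : H -> H) (Qoo_inj : injective Qoo)
    (Qoo_int : op_integral dot `[0, +oo[ (fun s x => S s (Q (T s x))) Qoo).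
Local Notation q := (qform dot Q).
Local Notation a := (aform dot Qoo).
Context (aT : forall t h k, 0 <= t -> a (T t h) k = a h (T t k)).

Let Qh_sqr x : `|Qh x| ^+ 2 = q x x.
Proof. by rewrite -dot_norm Qh_ge0.1 Qh_sqrt (dotC dot). Qed.

(** If Q^{1/2} x = 0 then q(T_s x, T_s x) <= q(x, x) = 0 for all s, so a(x, x) = 0 and
Q_oo x = 0. *)
Lemma sqrt_inj x : Qh x = 0 -> x = 0.
Proof.
move=> Qx; apply: Qoo_inj.
have qT s : 0 <= s -> q (T s x) (T s x) = 0.
  move=> s0; apply/eqP; rewrite eq_le qform_ge0// andbT.
  have := qform_adj_le dot_norm S_semigroup S_adj Q_bounded Q_ge0 Qoo_int aT x s0.
  by rewrite -[leRHS]Qh_sqr Qx normr0 expr0n.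
have ax : a x x = 0.
  rewrite (aformE S_adj Qoo_int).
  transitivity (\int[@lebesgue_measure R]_(s in `[0%R, +oo[) (0 : R)).
    by apply: eq_Rintegral => s; rewrite inE/= in_itv/= andbT => /qT.
  by rewrite /Rintegral integral0.
have a0 z : a 0 z = 0.
  by have := aformZl dot_norm S_adj Qoo_int 0 0 z; rewrite scale0r mul0r.
have axz z : a x z = 0.
  apply/eqP; rewrite -sqrf_eq0 eq_le sqr_ge0 andbT.
  by have := aform_CS dot_norm S_adj Q_ge0 Qoo_int x z; rewrite ax mul0r.
by apply: (dot_inj dot_norm) => z; have := axz z; rewrite -(a0 z).
Qed.

(** Symmetry of T_t for q, read as an identity of operators. *)
Lemma covariance_intertwine t k : 0 <= t -> Qh (Qh (T t k)) = S t (Qh (Qh k)).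
Proof.
move=> t0; apply: (dot_inj dot_norm) => z; rewrite !Qh_sqrt S_adj//.
exact: (qform_adj_sym dot_norm S_semigroup S_adj Q_bounded Q_ge0 Qoo_int aT k z t0).
Qed.

(** Decay in q is |Q^{1/2} T_t k| <= c |Q^{1/2} k|, and S_Q(t) Q^{1/2} k = Q^{1/2} T_t k. For the
converse, the existence of S_Q(t) h comes from the contraction case c = 1, without
which [op_inv] would be a default value. *)
Lemma qform_decay_SQ (b : R) :
  (forall t h, 0 <= t -> q (T t h) (T t h) <= expR (- (2 * b * t)) * q h h) <->
  (forall t h, 0 <= t -> `|SQ S Qh t h| <= expR (- (b * t)) * `|h|).
Proof.
have inv M t : 0 <= t -> 0 <= M -> (forall k, `|Qh (T t k)| <= M * `|Qh k|) ->
    forall h, Qh (SQ S Qh t h) = S t (Qh h) /\ `|SQ S Qh t h| <= M * `|h|.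
  move=> t0 M0 TM; apply: (op_inv_bound dot_norm Qh_bounded Qh_ge0 sqrt_inj (T := T t)) => //.
  - by have [_ _ + _] := S_semigroup; exact.
  - by move=> h k; exact: (adjointB dot_norm S_adj).
  - by move=> k; exact: covariance_intertwine.
have sqr_le t k c : 0 <= c -> q (T t k) (T t k) <= c ^+ 2 * q k k <->
    `|Qh (T t k)| <= c * `|Qh k|.
  move=> c0; rewrite -!Qh_sqr -exprMn ler_pXn2r ?nnegrE ?mulr_ge0//.
have e2 t : expR (- (b * t)) ^+ 2 = expR (- (2 * b * t)).
  by rewrite -expRM_natl; congr expR; ring.
split=> D t h t0.
  apply: (inv (expR (- (b * t))) t t0 (expR_ge0 _) _ h).2 => k.
  by apply/sqr_le; rewrite ?expR_ge0// e2 D.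
rewrite -e2; apply/sqr_le; rewrite ?expR_ge0//.
have h1 k : `|Qh (T t k)| <= 1 * `|Qh k|.
  apply/sqr_le => //; rewrite expr1n mul1r.
  exact: (qform_adj_le dot_norm S_semigroup S_adj Q_bounded Q_ge0 Qoo_int aT).
have [SQE _] := inv 1 t t0 ler01 h1 (Qh h).
set y := Qh (T t h).
have : `|y| ^+ 2 <= expR (- (b * t)) * `|Qh h| * `|y|.
  rewrite -dot_norm /y -Qh_ge0.1 covariance_intertwine// -SQE Qh_ge0.1.
  apply: le_trans (ler_norm _) _; apply: le_trans (dot_CS dot_norm _ _) _.
  by rewrite ler_wpM2r// D.
have [->|y0] := eqVneq y 0; first by rewrite normr0 mulr_ge0 ?expR_ge0.
by rewrite expr2 ler_pM2r ?normr_gt0.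
Qed.

End conjugate_semigroup.

Theorem theorem4p1 (R : realType) (H : completeNormedModType R)
    (dot : {dot H for idfun})
    (dot_norm : forall x, dot x x = `|x| ^+ 2)
    (H_sep : @separable R H) (H_neq0 : exists h : H, h != 0)
    (E : set H) (E_basis : orthonormal_basis dot E)
    (Q : {linear H -> H}) (Q_bounded : continuous Q)
    (Q_ge0 : selfadjoint_nonneg dot Q)
    (Qh : {linear H -> H}) (Qh_bounded : continuous Qh)
    (Qh_ge0 : selfadjoint_nonneg dot Qh)
    (Qh_sqrt : forall x, Qh (Qh x) = Q x)
    (S : R -> {linear H -> H}) (S_semigroup : c0_semigroup S)
    (Sadj : R -> H -> H)
    (S_adj : forall t, 0 <= t -> adjoint_of dot (S t) (Sadj t))
    (tr_fin : (\int[@lebesgue_measure R]_(s in `[0%R, +oo[)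
                 trace dot E (fun x => S s (Q (Sadj s x))) < +oo)%E)
    (Qoo : H -> H)
    (Qoo_int : op_integral dot `[0, +oo[ (fun s x => S s (Q (Sadj s x))) Qoo)
    (Qoo_inj : injective Qoo)
    (d : measure_display) (Omega : measurableType d) (P : probability Omega R)
    (W : R -> H -> Omega -> R) (W_wiener : cylindrical_wiener dot P W)
    (Z : R -> H -> Omega -> H) (Z_ou : ou_process dot P E S Qh W Z)
    (mu : probability (borel H) R) (mu_gauss : gaussian_measure dot Qoo mu)
    (beta : R) :
  ou_symmetric P Z mu ->
  ((forall (t : R) (h : H), 0 <= t ->
      `|SQ S Qh t h| <= expR (- (beta * t)) * `|h|) <->
   (forall (t : R) (phi : borel H -> R), 0 <= t -> phi \in Lfun mu 2%:E ->
      ('N[mu]_2%:E[EFin \o (fun x =>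
          (ou_semigroup2 P Z mu t phi x - \int[mu]_y phi y)%R)]
       <= (expR (- (beta * t)))%:E * 'N[mu]_2%:E[EFin \o phi])%E)).
Proof.
move=> sym.
have aT (t : R) h k : 0 <= t -> aform dot Qoo (Sadj t h) k = aform dot Qoo h (Sadj t k).
  exact: (symmetric_aform dot_norm H_sep E_basis Q_ge0 Qh_ge0 Qh_sqrt
    S_semigroup S_adj Qoo_int W_wiener Z_ou mu_gauss h k sym).
have ad := aform_qform_decay dot_norm S_semigroup S_adj Q_bounded Q_ge0 Qoo_int aT beta.
have qd := qform_decay_SQ dot_norm S_semigroup S_adj Q_bounded Q_ge0 Qh_bounded Qh_ge0
  Qh_sqrt Qoo_inj Qoo_int aT beta.
have od := ou2_decay_iff dot_norm H_sep E_basis Q_ge0 Qh_ge0 Qh_sqrt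
  S_semigroup S_adj Qoo_int W_wiener Z_ou mu_gauss beta.
split=> [D|/od D].
  have D' : forall t h, 0 <= t -> `|SQ S Qh t h| <= expR (- (beta * t)) * `|h|.
    by move=> t h; exact: D.
  apply/od; apply: (aform_bounded_decay dot_norm H_sep E_basis Q_ge0 Qh_ge0 Qh_sqrt
    S_semigroup S_adj Qoo_int W_wiener Z_ou mu_gauss aT).
  by apply/ad/qd.
apply: qd.1; apply: ad.1; exact: (bounded_decay_aform dot_norm E_basis Q_ge0 Qh_ge0 Qh_sqrt
    S_semigroup S_adj Qoo_int W_wiener Z_ou mu_gauss D).
Qed.
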